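(* Let $N\ge1$, let $P,Q$ be fixed invertible $N\times N$ complex matrices, and let $V:\mathrm H(N)\to\mathbb C$ be any potential. Define $$\mathcal Z_{\rm CM}[V](P,Q)=\iint_{\mathbb C^{N\times N}}\mathcal DM^\dagger\mathcal DM\;e^{-N\mathrm{Tr}(P^{-1}M^\dagger Q^{-1}M)+V(M^\dagger M)},$$ $$\mathcal Z_{\rm HM}[V,Y]=\iint_{\mathrm H(N)^2}\mathcal DA\,\mathcal DB\;e^{-iN\mathrm{Tr}(AB)+V(A)+Y(B)},$$ and $Y[P,Q](B)=-\mathrm{Tr}\ln\left(\mathbb 1^{\otimes 2}-i\,Q\otimes(PB)\right)$. Then $$\frac{\mathcal Z_{\rm CM}[V](P,Q)}{\mathcal Z_{\rm CM}[0](P,Q)}=\frac{\mathcal Z_{\rm HM}[V,Y[P,Q]]}{\mathcal Z_{\rm HM}[0,Y[P,Q]]}.$$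
   Context: $\mathrm H(N)$ denotes the $N\times N$ Hermitian matrices; $\mathcal DM^\dagger\mathcal DM=\prod_{ij}dM_{ij}$ is Lebesgue measure on $\mathbb C^{N\times N}$ and $\mathcal DA=\prod_{i\le j}dA_{ij}$ on $\mathrm H(N)$. $\mathbb 1^{\otimes 2}$ is the identity on $\mathbb C^N\otimes\mathbb C^N$ and the trace in $Y[P,Q]$ is over $\mathbb C^N\otimes\mathbb C^N$. All integrals are assumed to be well defined. *)

(* Defs.v *)
From HB Require Import structures.
From mathcomp Require Import all_boot all_order all_algebra.
From mathcomp Require Import all_classical all_reals all_analysis.
From mathcomp.real_closed Require Import complex mxtens.

Set Implicit Arguments.
Unset Strict Implicit.
Unset Printing Implicit Defensive.

Import Order.TTheory GRing.Theory Num.Theory.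
Import numFieldNormedType.Exports.

Local Open Scope classical_set_scope.
Local Open Scope ring_scope.

Section Defs.
Variable R : realType.
Local Notation C := (R[i]).

Definition cexp (z : C) : C :=
  Complex (expR (complex.Re z) * cos (complex.Im z)) (expR (complex.Re z) * sin (complex.Im z)).

(** principal logarithm: the w with exp w = z and complex.Im w in (-pi, pi]
    (arbitrary value 0 when z = 0, where no logarithm exists) *)
Definition clog (z : C) : C :=
  xget 0 [set w | cexp w = z /\ - pi < complex.Im w <= pi].

(** ** Tr ln of a square complex matrix: sum of the (principal) logarithms of
    its eigenvalues counted with algebraic multiplicity, i.e. the trace of the
    principal matrix logarithm. *)
Definition eigenvalues n (A : 'M[C]_n) : seq C :=
  xget [::] [set s | char_poly A = \prod_(z <- s) ('X - z%:P)].

Definition trln n (A : 'M[C]_n) : C := \sum_(z <- eigenvalues A) clog z.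

Definition adjmx n (M : 'M[C]_n) : 'M[C]_n := \matrix_(i, j) (M j i)^*%C.

Local Unset Implicit Arguments.
Fixpoint lebn (n : nat) : set (n.-tuple R) -> \bar R :=
  match n return set (n.-tuple R) -> \bar R with
  | 0 => \d_ [tuple]
  | n'.+1 => pushforward (product_measure1 (@lebesgue_measure R) (lebn n'))
               (fun p : R * n'.-tuple R => [tuple of p.1 :: p.2])
  end.
Local Set Implicit Arguments.

Definition rint n (D : set (n.-tuple R)) (f : n.-tuple R -> R) : R :=
  fine (\int[lebn n]_(x in D) (f x)%:E)%E.

Definition cint n (D : set (n.-tuple R)) (f : n.-tuple R -> C) : C :=
  Complex (rint D (fun x => complex.Re (f x))) (rint D (fun x => complex.Im (f x))).

Definition cintegrable n (D : set (n.-tuple R)) (f : n.-tuple R -> C) : Prop :=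
  (lebn n).-integrable D (fun x => (complex.Re (f x))%:E) /\
  (lebn n).-integrable D (fun x => (complex.Im (f x))%:E).

Definition ccvg_pinfty (F : R -> C) : Prop :=
  cvg (complex.Re (F r) @[r --> +oo]) /\ cvg (complex.Im (F r) @[r --> +oo]).

Definition clim_pinfty (F : R -> C) : C :=
  Complex (lim (complex.Re (F r) @[r --> +oo])) (lim (complex.Im (F r) @[r --> +oo])).

Definition cmat N (x : (N * N + N * N).-tuple R) : 'M[C]_N :=
  \matrix_(i, j) Complex (tnth x (lshift (N * N) (mxvec_index i j)))
                         (tnth x (rshift (N * N) (mxvec_index i j))).

(** H(N) = R^{N^2}: coordinates A_ii (i), Re A_ij (i<j), Im A_ij (stored at
    position (j,i), i<j); the measure DA = prod_{i<=j} dA_ij *)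
Definition hermmat N (x : (N * N).-tuple R) : 'M[C]_N :=
  \matrix_(i, j)
    let a k l := tnth x (mxvec_index k l) in
    if i == j then Complex (a i i) 0
    else if (i < j)%N then Complex (a i j) (a j i)
    else Complex (a j i) (- a i j).

Definition cube n (r : R) : set (n.-tuple R) :=
  [set x | forall k, - r <= tnth x k <= r].

Definition integrandCM N (V : 'M[C]_N -> C) (P Q : 'M[C]_N)
    (x : (N * N + N * N).-tuple R) : C :=
  let M := cmat x in
  cexp (- N%:R * \tr (invmx P *m adjmx M *m invmx Q *m M) + V (adjmx M *m M)).

Definition ZCM N (V : 'M[C]_N -> C) (P Q : 'M[C]_N) : C :=
  cint setT (integrandCM V P Q).

(** Z_HM[V,Y] = \int DA \int DB exp(-i N Tr(AB) + V(A) + Y(B)), the outer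
    integral over A a Lebesgue integral, the inner (oscillatory) integral over
    B the limit of the integrals over the cubes [-r,r]^{N^2} as r -> +oo *)
Definition integrandHM N (V Y : 'M[C]_N -> C) (A B : 'M[C]_N) : C :=
  cexp (- 'i * N%:R * \tr (A *m B) + V A + Y B).

Definition innerHM N (V Y : 'M[C]_N -> C) (A : 'M[C]_N) (r : R) : C :=
  cint (@cube (N * N) r) (fun y => integrandHM V Y A (hermmat y)).

Definition ZHM N (V Y : 'M[C]_N -> C) : C :=
  cint setT (fun x => clim_pinfty (innerHM V Y (hermmat x))).

Definition Ypot N (P Q : 'M[C]_N) (B : 'M[C]_N) : C :=
  - trln (1%:M - 'i *: (Q *t (P *m B))).

Definition CM_well_defined N (V : 'M[C]_N -> C) (P Q : 'M[C]_N) : Prop :=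
  cintegrable setT (integrandCM V P Q).

Definition HM_well_defined N (V Y : 'M[C]_N -> C) : Prop :=
  {ae lebn (N * N), forall x,
     (forall r, cintegrable (@cube (N * N) r)
                  (fun y => integrandHM V Y (hermmat x) (hermmat y)))
     /\ ccvg_pinfty (innerHM V Y (hermmat x))}
  /\ cintegrable setT (fun x => clim_pinfty (innerHM V Y (hermmat x))).

End Defs.

(* Main.v *)
(** The integrand F(M) = exp(-N Tr(P^-1 M^* Q^-1 M)) is Gaussian, and its
    integrability forces the Hermitian part of the quadratic form to be positive
    definite. A linear change of variables then gives
      phi(B) = \int F(M) exp(iN Tr(M^* M B)) dM = phi(0) / det(1 - i Q (x) PB)
             = phi(0) exp(Y(B)).
    The map M |-> M^* M pushes Lebesgue measure forward to a measure of bounded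
    density on Hermitian matrices, supported by the positive definite cone. Hence
    phi and the Fourier transform of the indicator of a bounded Borel set T are
    square integrable, and Parseval's identity, obtained by Abel summation (the
    Poisson kernel is a nonnegative approximate identity) for boxes and by a
    Dynkin class argument for Borel sets, shows that
      g(A) = \int exp(-iN Tr(AB) + Y(B)) dB,   the limit over the cubes,
    satisfies \int_T g = kappa \int_(M^* M in T) F first on sets where the partial
    integrals are bounded, then for all T. Passing from sets to functions,
    Z_HM[V, Y] = kappa Z_CM[V] with a constant kappa that does not depend on V.
    The potential itself is not assumed measurable: exp V is measurable on the
    cone because it is the composite of exp(V(M^* M)) with the Cholesky section
    of M |-> M^* M. *)
Require Import Defs.
From HB Require Import structures.
From mathcomp Require Import all_boot all_order all_algebra.
From mathcomp Require Import all_classical all_reals all_analysis.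
From mathcomp.real_closed Require Import complex mxtens.
From mathcomp Require Import measurable_realfun spectral ring lra.

Import Order.TTheory GRing.Theory Num.Theory.
Import numFieldNormedType.Exports.
Local Open Scope classical_set_scope.
Local Open Scope ring_scope.

Set Implicit Arguments.
Unset Strict Implicit.
Unset Printing Implicit Defensive.

(** * Lebesgue measure on tuples *)

(** The inner integral over $B$ converges only conditionally and no majorant is uniform in $A$, so
    its limit cannot simply be exchanged with the outer integral. Pairing with an indicator is the
    way out: by Fubini it turns the partial integrals into integrals over cubes of one fixed product
    of two square integrable transforms.

    The density of the image measure is bounded because the matrices are square: left multiplication
    by $g$ on $\mathbb C^{N\times N}$ and congruence by $g$ on $\mathrm H(N)$ have the same Jacobian
    $|\det g|^{2N}$, so the image is a constant multiple of Lebesgue measure on the cone. Jacobians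
    come from the uniqueness of translation-invariant measures and from multiplicativity in $g$;
    most normalising constants stay unevaluated, since they cancel in the final quotient.

    The identity for $\varphi(B)$ is proved as $\varphi(B)\det(\dots)=k$ with $k>0$. Hence the
    determinant vanishes at no Hermitian $B$, and $e^{Y(B)}$ is its inverse whatever branch of the
    logarithm is used.

    Finally $g$ vanishes almost everywhere off the cone, so values of $V$ at matrices that are not
    of the form $M^* M$ do not disturb the Hermitian integral. *)

Section sigma_finite_pack.
Context d (T : measurableType d) (R : realType).
Variables (m : {measure set T -> \bar R}) (sm : sigma_finite setT m).

Let m' : set T -> \bar R := m.

HB.instance Definition _ := Measure.on m'.
HB.instance Definition _ := Measure_isSigmaFinite.Build _ _ _ m' sm.

Definition sigma_finite_pack : {sigma_finite_measure set T -> \bar R} := m'.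

End sigma_finite_pack.

(* The library registers no sigma-finite structure on the product of two
   sigma-finite measures. *)
Section sigma_finite_product.
Context d1 d2 (T1 : measurableType d1) (T2 : measurableType d2) (R : realType).
Variable m1 : {sigma_finite_measure set T1 -> \bar R}.
Variable m2 : {sigma_finite_measure set T2 -> \bar R}.

Lemma sigma_finite_product : sigma_finite setT (product_measure1 m1 m2).
Proof.
have /sigma_finiteP[F [FT Fnd Ffin]] := sigma_finiteT m1.
have /sigma_finiteP[G [GT Gnd Gfin]] := sigma_finiteT m2.
exists (fun k => F k `*` G k).
  apply/esym/seteqP; split => // -[x y] _.
  have [i _ Fx] : (\bigcup_i F i) x by rewrite -FT.
  have [j _ Gy] : (\bigcup_i G i) y by rewrite -GT.
  exists (maxn i j) => //; split => /=.
    by have /subsetPset := Fnd _ _ (leq_maxl i j); exact.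
  by have /subsetPset := Gnd _ _ (leq_maxr i j); exact.
move=> k; have [mF ?] := Ffin k; have [mG ?] := Gfin k.
split; first exact: measurableX.
by rewrite product_measure1E// lte_mul_pinfty// ge0_fin_numE.
Qed.

Definition sfproduct : {sigma_finite_measure set (T1 * T2)%type -> \bar R} :=
  sigma_finite_pack sigma_finite_product.

End sigma_finite_product.

Section lebn_measure.
Variable R : realType.
Local Notation lebn := (@lebn R).

Definition tcons n (p : R * n.-tuple R) : n.+1.-tuple R := [tuple of p.1 :: p.2].

Definition tuncons n (x : n.+1.-tuple R) : R * n.-tuple R :=
  (thead x, [tuple of behead x]).

Lemma tconsK n : cancel (@tcons n) (@tuncons n).
Proof. by move=> [a x]; rewrite /tuncons /tcons theadE; congr (_, _); apply/val_inj. Qed.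

Lemma tunconsK n : cancel (@tuncons n) (@tcons n).
Proof. by move=> x; rewrite /tuncons /tcons/=; rewrite [RHS]tuple_eta. Qed.

Lemma measurable_tcons n : measurable_fun setT (@tcons n).
Proof. exact: measurable_cons. Qed.

Lemma measurable_tuncons n : measurable_fun setT (@tuncons n).
Proof.
apply: measurable_fun_pair => /=; last exact: measurable_behead.
exact: measurable_tnth.
Qed.

(** [lebn] is a recursion on bare set functions, so the measure axioms are transported from a
    bundled measure built along the same recursion. Sigma-finiteness is carried along because the
    next product needs it. *)
Let lebn_sfin n : exists m : {sigma_finite_measure set (n.-tuple R) -> \bar R},
  lebn n = m.
Proof.
elim: n => [|n [m IH]]; first by exists (\d_ ([tuple] : 0.-tuple R)).
pose M := measure_function_pushforward__canonical__measure_function_Measure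
  (product_measure1 (@lebesgue_measure R) m) (@measurable_tcons n).
have sM : sigma_finite setT M.
  have [F FT F_] := @sigma_finite_product _ _ _ _ _ (@lebesgue_measure R) m.
  exists (fun k => @tuncons n @^-1` F k).
    by rewrite -preimage_bigcup -FT preimage_setT.
  move=> k; have [mF Foo] := F_ k; split.
    by rewrite -[X in measurable X]setTI; exact: measurable_tuncons.
  rewrite /M/= /pushforward -comp_preimage.
  by rewrite (_ : _ \o _ = idfun)//; apply/funext => x /=; rewrite tconsK.
exists (sigma_finite_pack sM).
by rewrite /= IH.
Qed.

Let lebn0 n : lebn n set0 = 0%E.
Proof. by have [m ->] := lebn_sfin n; exact: measure0. Qed.

Let lebn_ge0 n A : (0 <= lebn n A)%E.
Proof. by have [m ->] := lebn_sfin n; exact: measure_ge0. Qed.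

Let lebn_sigma_additive n : semi_sigma_additive (lebn n).
Proof. by have [m ->] := lebn_sfin n; exact: measure_semi_sigma_additive. Qed.

HB.instance Definition _ n := isMeasure.Build _ _ _ (lebn n)
  (lebn0 n) (@lebn_ge0 n) (@lebn_sigma_additive n).

Let lebn_sigma_finite n : sigma_finite setT (lebn n).
Proof. by have [m ->] := lebn_sfin n; exact: sigma_finiteT. Qed.

HB.instance Definition _ n := Measure_isSigmaFinite.Build _ _ _ (lebn n)
  (@lebn_sigma_finite n).

End lebn_measure.

Section lebn_integral.
Variable R : realType.
Local Notation lebn := (@lebn R).

Lemma ge0_integral_lebnS n (f : n.+1.-tuple R -> \bar R) :
  measurable_fun setT f -> (forall x, 0 <= f x)%E ->
  (\int[lebn n.+1]_x f x =
   \int[@lebesgue_measure R]_t \int[lebn n]_x f (tcons (t, x)))%E.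
Proof.
move=> mf f0; rewrite /=.
rewrite ge0_integral_pushforward//; last exact: measurable_tcons.
rewrite preimage_setT fubini_tonelli1//=.
  exact: sigma_finiteT.
by apply: measurableT_comp => //; exact: measurable_tcons.
Qed.

Lemma ge0_integral_lebn0 (f : 0.-tuple R -> \bar R) :
  (\int[lebn 0]_x f x = f [tuple])%E.
Proof.
have -> : f = cst (f [tuple]) by apply/funext => x; rewrite (tuple0 x).
by rewrite integral_dirac//= diracT mul1e.
Qed.

#[local] Arguments Defs.lebn : simpl never.

Lemma ge0_integral_translate (a : R) (f : R -> \bar R) :
  measurable_fun setT f -> (forall x, 0 <= f x)%E ->
  (\int[@lebesgue_measure R]_x f (x + a)%R = \int[@lebesgue_measure R]_x f x)%E.
Proof.
move=> mf f0.
pose h := (fun x : R => x + a) : measurableTypeR R -> measurableTypeR R.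
have mh : measurable_fun setT h by exact: measurable_funD.
pose M := measure_function_pushforward__canonical__measure_function_Measure
  (@lebesgue_measure R) mh.
transitivity (\int[M]_x f x)%E.
  by rewrite ge0_integral_pushforward//= preimage_setT.
apply: eq_measure_integral => A mA _.
apply/esym; apply: (@lebesgue_measure_unique R M) => // _ [[u v]] _ <-.
rewrite /M/= /pushforward (_ : _ @^-1` _ = `](u - a), (v - a)]%classic).
  by rewrite !lebesgue_measure_itv/= !lte_fin ltrD2r; case: ifP => // _; congr (_%:E); lra.
by apply/seteqP; split => x /=; rewrite /h !in_itv/= ltrBlDr lerBrDr.
Qed.

Definition tadd n (x y : n.-tuple R) : n.-tuple R :=
  [tuple tnth x i + tnth y i | i < n].

Definition topp n (x : n.-tuple R) : n.-tuple R := [tuple - tnth x i | i < n].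

Lemma tnth_tadd n (x y : n.-tuple R) i : tnth (tadd x y) i = tnth x i + tnth y i.
Proof. by rewrite tnth_mktuple. Qed.

Lemma tnth_topp n (x : n.-tuple R) i : tnth (topp x) i = - tnth x i.
Proof. by rewrite tnth_mktuple. Qed.

Lemma tadd_tcons n (p q : R * n.-tuple R) :
  tadd (tcons p) (tcons q) = tcons (p.1 + q.1, tadd p.2 q.2).
Proof.
apply: eq_from_tnth => i; rewrite tnth_tadd.
by case: (unliftP ord0 i) => [j|] ->; rewrite ?tnthS ?tnth0 ?tnth_tadd.
Qed.

Lemma taddC n : commutative (@tadd n).
Proof. by move=> x y; apply: eq_from_tnth => i; rewrite !tnth_tadd addrC. Qed.

Lemma taddK n (x y : n.-tuple R) : tadd (tadd x y) (topp y) = x.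
Proof. by apply: eq_from_tnth => i; rewrite !tnth_tadd tnth_topp addrK. Qed.

Lemma measurable_tuple_fun d (T : measurableType d) n (f : T -> n.-tuple R) :
  (forall i, measurable_fun setT (fun x => tnth (f x) i)) -> measurable_fun setT f.
Proof. by move=> mf; apply/measurable_fun_tnthP. Qed.

Lemma measurable_tnth_comp d (T : measurableType d) n (f : T -> n.-tuple R) i :
  measurable_fun setT f -> measurable_fun setT (fun x => tnth (f x) i).
Proof. by move=> /measurable_fun_tnthP; exact. Qed.

Lemma measurable_tadd d (T : measurableType d) n (f g : T -> n.-tuple R) :
  measurable_fun setT f -> measurable_fun setT g ->
  measurable_fun setT (fun x => tadd (f x) (g x)).
Proof.
move=> mf mg; apply: measurable_tuple_fun => i.
under eq_fun do rewrite tnth_tadd.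
by apply: measurable_funD; exact: measurable_tnth_comp.
Qed.

Lemma measurable_topp d (T : measurableType d) n (f : T -> n.-tuple R) :
  measurable_fun setT f -> measurable_fun setT (fun x => topp (f x)).
Proof.
move=> mf; apply: measurable_tuple_fun => i.
under eq_fun do rewrite tnth_topp.
by apply: measurableT_comp => //; exact: measurable_tnth_comp.
Qed.

Lemma ge0_integral_tadd n (a : n.-tuple R) (f : n.-tuple R -> \bar R) :
  measurable_fun setT f -> (forall x, 0 <= f x)%E ->
  (\int[lebn n]_x f (tadd x a) = \int[lebn n]_x f x)%E.
Proof.
elim: n a f => [|n IH] a f mf f0.
  by rewrite !ge0_integral_lebn0; congr f; rewrite [LHS]tuple0.
have mfa : measurable_fun setT (fun x => f (tadd x a)).
  by apply: measurableT_comp => //; apply: measurable_tadd.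
rewrite (ge0_integral_lebnS mfa (fun x => f0 _)) (ge0_integral_lebnS mf f0).
pose F t := (\int[lebn n]_x f (tcons (t, x)))%E.
have mfc : measurable_fun setT (fun p : R * n.-tuple R => f (tcons p)).
  by apply: measurableT_comp => //; exact: measurable_tcons.
have mF : measurable_fun setT F.
  by apply: (measurable_fun_fubini_tonelli_F (fun p : R * n.-tuple R => f (tcons p))).
have F0 t : (0 <= F t)%E by apply: integral_ge0.
rewrite -[RHS](ge0_integral_translate (tuncons a).1 mF F0).
apply: eq_integral => t _; rewrite /F -[RHS](IH (tuncons a).2)//.
  by apply: eq_integral => x _; rewrite -{1}(tunconsK a) tadd_tcons/=.
apply: (measurableT_comp mf); apply: (measurableT_comp (@measurable_tcons R n)).
exact: measurable_pair1.
Qed.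

Lemma emeasurable_prod d (T : measurableType d) n (f : 'I_n -> T -> \bar R) :
  (forall i, measurable_fun setT (f i)) ->
  measurable_fun setT (fun x => \prod_(i < n) f i x)%E.
Proof.
elim: n f => [|n IH] f mf.
  by under eq_fun do rewrite big_ord0; exact: measurable_cst.
under eq_fun do rewrite big_ord_recl.
by apply: emeasurable_funM => //; exact: IH.
Qed.

Lemma ge0_integral_prod n (f : 'I_n -> R -> \bar R) :
  (forall i, measurable_fun setT (f i)) -> (forall i x, 0 <= f i x)%E ->
  (\int[lebn n]_x \prod_(i < n) f i (tnth x i) =
   \prod_(i < n) \int[@lebesgue_measure R]_t f i t)%E.
Proof.
elim: n f => [|n IH] f mf f0; first by rewrite ge0_integral_lebn0 !big_ord0.
have mt m i : measurable_fun setT (fun x : m.-tuple R => tnth x i).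
  exact: measurable_tnth.
have mP m (g : 'I_m -> R -> \bar R) : (forall i, measurable_fun setT (g i)) ->
    measurable_fun setT (fun x : m.-tuple R => \prod_(i < m) g i (tnth x i))%E.
  by move=> mg; apply: emeasurable_prod => i; exact: (measurableT_comp (mg i) (mt m i)).
rewrite (ge0_integral_lebnS (mP _ _ mf)); last by move=> x; apply: prode_ge0.
have E t : (\int[lebn n]_x \prod_(i < n.+1) f i (tnth (tcons (t, x)) i) =
  f ord0 t * \prod_(i < n) \int[@lebesgue_measure R]_t f (lift ord0 i) t)%E.
  rewrite -IH// -ge0_integralZl//; last 2 first.
  - exact: (mP _ (fun i => f (lift ord0 i))).
  - by move=> x _; apply: prode_ge0.
  by apply: eq_integral => x _; rewrite big_ord_recl tnth0; congr (_ * _)%E;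
    apply: eq_bigr => i _; rewrite tnthS.
under eq_integral do rewrite E.
rewrite ge0_integralZr// ?big_ord_recl//.
  exact: mf.
by apply: prode_ge0 => i _; apply: integral_ge0.
Qed.

End lebn_integral.

Arguments lebn : simpl never.

(** * Complex-valued integrals *)

Lemma le_integrableR d (T : measurableType d) (R : realType)
    (mu : {measure set T -> \bar R}) (f g : T -> R) :
  measurable_fun setT f -> (forall x, `|f x| <= g x) ->
  mu.-integrable setT (EFin \o g) -> mu.-integrable setT (EFin \o f).
Proof.
move=> mf fg; apply: le_integrable => //; first exact/measurable_EFinP.
by move=> x _; rewrite lee_fin (le_trans (fg x))// ler_norm.
Qed.

Section dominated_product.
Context d1 d2 (T1 : measurableType d1) (T2 : measurableType d2) (R : realType).
Variable m1 : {sigma_finite_measure set T1 -> \bar R}.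
Variable m2 : {sigma_finite_measure set T2 -> \bar R}.
Variables (a : T1 -> R) (b : T2 -> R).
Hypothesis ia : m1.-integrable setT (EFin \o a).
Hypothesis ib : m2.-integrable setT (EFin \o b).
Variable h : T1 * T2 -> R.
Hypothesis mh : measurable_fun setT h.
Hypothesis hab : forall x y, `|h (x, y)| <= a x * b y.

(** A majorant of product form makes every section integrable, not just almost every one, so
    iterated integrals carry no exceptional null set. *)
Lemma dominated_section1 x : m2.-integrable setT (fun y => (h (x, y))%:E).
Proof.
apply: (@le_integrableR _ _ _ _ _ (fun y => a x * b y)) => //.
- exact: measurableT_comp.
- exact: (integrableZl measurableT (a x) ib).
Qed.

Lemma dominated_section2 y : m1.-integrable setT (fun x => (h (x, y))%:E).
Proof.
apply: (@le_integrableR _ _ _ _ _ (fun x => b y * a x)) => //.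
- exact: measurableT_comp.
- by move=> x; rewrite mulrC.
- exact: (integrableZl measurableT (b y) ia).
Qed.

Lemma integrable_dominated_product :
  (m1 \x m2)%E.-integrable setT (EFin \o h).
Proof.
apply/integrable12ltyP; first exact/measurable_EFinP.
have mab : measurable_fun setT (fun p : T1 * T2 => `|a p.1 * b p.2|).
  apply: measurableT_comp => //; apply: measurable_funM.
    by apply: measurableT_comp => //; apply/measurable_EFinP; exact: measurable_int ia.
  by apply: measurableT_comp => //; apply/measurable_EFinP; exact: measurable_int ib.
have mh' : measurable_fun setT (fun p : T1 * T2 => (`|h p|)%:E).
  by apply/measurable_EFinP; exact: measurableT_comp.
have mab' : measurable_fun setT (fun p : T1 * T2 => (`|a p.1 * b p.2|)%:E).
  exact/measurable_EFinP.
apply: (@le_lt_trans _ _ (\int[m1]_x \int[m2]_y (`|a x * b y|%:E))%E).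
  apply: ge0_le_integral => //.
  - by move=> x _; exact: integral_ge0.
  - exact: (measurable_fun_fubini_tonelli_F (fun p => (`|h p|)%:E)).
  - exact: (measurable_fun_fubini_tonelli_F (fun p => (`|a p.1 * b p.2|)%:E)).
  - move=> x _; apply: ge0_le_integral => //.
    + by apply/measurable_EFinP/measurableT_comp => //; exact: measurableT_comp.
    + exact: (measurableT_comp mab' (measurable_pair1 x)).
    + by move=> y _; rewrite lee_fin (le_trans (hab x y))// ler_norm.
have -> : (\int[m1]_x \int[m2]_y (`|a x * b y|%:E) =
    (\int[m1]_x `|(a x)%:E|) * (\int[m2]_y `|(b y)%:E|))%E.
  under eq_integral => x _.
    under eq_integral => y _ do rewrite normrM EFinM.
    rewrite ge0_integralZl//; last first.
      by apply/measurable_EFinP/measurableT_comp => //; apply/measurable_EFinP; exact: measurable_int ib.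
    over.
  rewrite ge0_integralZr//; last exact: integral_ge0.
  by apply/measurable_EFinP/measurableT_comp => //; apply/measurable_EFinP; exact: measurable_int ia.
move/integrableP : ia => [_ ia']; move/integrableP : ib => [_ ib'].
by rewrite lte_mul_pinfty// ?ge0_fin_numE ?integral_ge0.
Qed.

Lemma measurable_Rintegral1 :
  measurable_fun setT (fun x => \int[m2]_y h (x, y)).
Proof.
apply: measurableT_comp => //.
exact: (measurable_fubini_F integrable_dominated_product).
Qed.

Lemma measurable_Rintegral2 :
  measurable_fun setT (fun y => \int[m1]_x h (x, y)).
Proof.
apply: measurableT_comp => //.
exact: (measurable_fubini_G integrable_dominated_product).
Qed.

Lemma RFubini :
  \int[m1]_x (\int[m2]_y h (x, y)) = \int[m2]_y (\int[m1]_x h (x, y)).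
Proof.
rewrite /Rintegral.
under eq_integral => x _.
  rewrite fineK; first over.
  exact: (integrable_fin_num _ (dominated_section1 x)).
under [in RHS]eq_integral => y _.
  rewrite fineK; first over.
  exact: (integrable_fin_num _ (dominated_section2 y)).
by rewrite (integral12_prod_meas1 integrable_dominated_product)
  (integral21_prod_meas1 integrable_dominated_product).
Qed.

End dominated_product.

Section complex_arith.
Variable R : realType.
Local Notation C := R[i].
Local Notation Re := (@complex.Re R).
Local Notation Im := (@complex.Im R).

Lemma cReD (z w : C) : Re (z + w) = Re z + Re w. Proof. by case: z; case: w. Qed.
Lemma cImD (z w : C) : Im (z + w) = Im z + Im w. Proof. by case: z; case: w. Qed.
Lemma cReN (z : C) : Re (- z) = - Re z. Proof. by case: z. Qed.
Lemma cImN (z : C) : Im (- z) = - Im z. Proof. by case: z. Qed.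
Lemma cReM (z w : C) : Re (z * w) = Re z * Re w - Im z * Im w.
Proof. by case: z; case: w. Qed.
Lemma cImM (z w : C) : Im (z * w) = Re z * Im w + Im z * Re w.
Proof. by case: z; case: w. Qed.
Lemma cReJ (z : C) : Re z^*%C = Re z. Proof. by case: z. Qed.
Lemma cImJ (z : C) : Im z^*%C = - Im z. Proof. by case: z. Qed.
Definition cReImE := (cReD, cImD, cReN, cImN, cReM, cImM, cReJ, cImJ).

Lemma complex_eq (z w : C) : Re z = Re w -> Im z = Im w -> z = w.
Proof. by case: z => a b; case: w => a' b' /= -> ->. Qed.

Lemma cRe_sum (I : Type) (s : seq I) (P : pred I) (F : I -> C) :
  Re (\sum_(i <- s | P i) F i) = \sum_(i <- s | P i) Re (F i).
Proof. by apply: (big_morph Re cReD). Qed.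

Lemma cIm_sum (I : Type) (s : seq I) (P : pred I) (F : I -> C) :
  Im (\sum_(i <- s | P i) F i) = \sum_(i <- s | P i) Im (F i).
Proof. by apply: (big_morph Im cImD). Qed.

(** The $\ell^1$ norm of $\mathbb R^2$: real valued, submultiplicative, and a bound for both parts
    at once. Its value at a point of the unit circle can exceed 1, which is where the factors 2 in
    later bounds come from. *)
Definition n1 (z : C) : R := `|Re z| + `|Im z|.

Lemma n1_ge0 z : 0 <= n1 z. Proof. by rewrite addr_ge0. Qed.

Lemma n1D z w : n1 (z + w) <= n1 z + n1 w.
Proof.
rewrite /n1 !cReImE addrACA.
by apply: lerD; exact: ler_normD.
Qed.

Lemma n1N z : n1 (- z) = n1 z.
Proof. by rewrite /n1 !cReImE !normrN. Qed.

Lemma n1J z : n1 z^*%C = n1 z.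
Proof. by rewrite /n1 !cReImE normrN. Qed.

Lemma n1M z w : n1 (z * w) <= n1 z * n1 w.
Proof.
rewrite /n1 !cReImE mulrDl !mulrDr.
apply: (@le_trans _ _ ((`|Re z| * `|Re w| + `|Im z| * `|Im w|) +
  (`|Re z| * `|Im w| + `|Im z| * `|Re w|))).
  by rewrite -!normrM; apply: lerD; [exact: ler_normB|exact: ler_normD].
lra.
Qed.

Lemma n1_real (x : R) : n1 x%:C%C = `|x|.
Proof. by rewrite /n1/= normr0 addr0. Qed.

Lemma n10 : n1 0 = 0. Proof. by rewrite /n1/= normr0 addr0. Qed.

Lemma n1_eq0 z : n1 z <= 0 -> z = 0.
Proof.
move=> z0; have := normr_ge0 (Re z); have := normr_ge0 (Im z).
move: z0; rewrite /n1 => z0 a0 b0.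
by apply: complex_eq => /=; apply/eqP; rewrite -normr_le0; lra.
Qed.

Definition ccvg (u : nat -> C) (l : C) :=
  (Re (u n) @[n --> \oo] --> Re l) /\ (Im (u n) @[n --> \oo] --> Im l).

Lemma ccvg_unique u l l' : ccvg u l -> ccvg u l' -> l = l'.
Proof.
move=> [a b] [a' b']; apply: complex_eq.
  by apply: cvg_unique a a'; exact: norm_hausdorff.
by apply: cvg_unique b b'; exact: norm_hausdorff.
Qed.

Lemma ccvg_cst l : ccvg (fun=> l) l.
Proof. by split; exact: cvg_cst. Qed.

Lemma ccvgD u v l l' : ccvg u l -> ccvg v l' -> ccvg (fun n => u n + v n) (l + l').
Proof.
move=> [a b] [a' b']; split; rewrite !cReImE; under eq_fun do rewrite !cReImE;
  exact: cvgD.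
Qed.

Lemma ccvgM u v l l' : ccvg u l -> ccvg v l' -> ccvg (fun n => u n * v n) (l * l').
Proof.
move=> [a b] [a' b']; split; rewrite !cReImE; under eq_fun do rewrite !cReImE.
  by apply: cvgB; apply: cvgM.
by apply: cvgD; apply: cvgM.
Qed.

Lemma ccvg_n1 u l (e : nat -> R) : (forall n, n1 (u n - l) <= e n) ->
  (e n @[n --> \oo] --> 0) -> ccvg u l.
Proof.
move=> ule e0.
have sq (v : nat -> R) : (forall n, `|v n| <= e n) -> v n @[n --> \oo] --> 0.
  move=> ve; apply: (@squeeze_cvgr _ _ _ _ (fun n => - e n) e) => //.
    by apply: nearW => n; rewrite -ler_norml.
  by rewrite -[X in _ --> X]oppr0; exact: cvgN.
split; apply/subr_cvg0; apply: sq => n; apply: le_trans (ule n);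
  by rewrite /n1 !cReImE ?lerDl ?lerDr.
Qed.

Lemma n1_cvg u l : ccvg u l -> n1 (u n) @[n --> \oo] --> n1 l.
Proof. by move=> [a b]; apply: cvgD; apply: cvg_norm. Qed.

Lemma n1_lim_le u l (M : R) : ccvg u l -> (forall n, n1 (u n) <= M) -> n1 l <= M.
Proof.
move=> ul uM; have h := n1_cvg ul.
rewrite -(cvg_lim _ h)//; apply: limr_le; first by apply/cvg_ex; eexists; exact: h.
exact: nearW.
Qed.

End complex_arith.

Section complex_measurability.
Context d (T : measurableType d) (R : realType).
Local Notation C := R[i].
Local Notation Re := (@complex.Re R).
Local Notation Im := (@complex.Im R).
Implicit Types f g : T -> C.

Definition cmeas (f : T -> C) :=
  measurable_fun setT (fun x => Re (f x)) /\ measurable_fun setT (fun x => Im (f x)).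

Lemma cmeas_cst c : cmeas (fun=> c).
Proof. by split; exact: measurable_cst. Qed.

Lemma cmeasD f g : cmeas f -> cmeas g -> cmeas (fun x => f x + g x).
Proof.
move=> [a b] [a' b']; split; under eq_fun do rewrite !cReImE; exact: measurable_funD.
Qed.

Lemma cmeasN f : cmeas f -> cmeas (fun x => - f x).
Proof.
by move=> [a b]; split; under eq_fun do rewrite !cReImE; exact: measurableT_comp.
Qed.

Lemma cmeasM f g : cmeas f -> cmeas g -> cmeas (fun x => f x * g x).
Proof.
move=> [a b] [a' b']; split; under eq_fun do rewrite !cReImE.
  by apply: measurable_funB; exact: measurable_funM.
by apply: measurable_funD; exact: measurable_funM.
Qed.

Lemma cmeasJ f : cmeas f -> cmeas (fun x => (f x)^*%C).
Proof.
move=> [a b]; split; under eq_fun do rewrite !cReImE; first exact: a.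
exact: measurableT_comp.
Qed.

Lemma cmeas_real (f : T -> R) : measurable_fun setT f -> cmeas (fun x => (f x)%:C%C).
Proof. by move=> mf; split => //=; exact: measurable_cst. Qed.

Lemma cmeas_Complex (f g : T -> R) : measurable_fun setT f -> measurable_fun setT g ->
  cmeas (fun x => Complex (f x) (g x)).
Proof. by []. Qed.

Lemma cmeas_sum (I : Type) (s : seq I) (F : I -> T -> C) :
  (forall i, cmeas (F i)) -> cmeas (fun x => \sum_(i <- s) F i x).
Proof.
move=> mF; elim: s => [|i s IH].
  by under eq_fun do rewrite big_nil; exact: cmeas_cst.
by under eq_fun do rewrite big_cons; exact: cmeasD.
Qed.

Lemma cmeas_prod (I : Type) (s : seq I) (F : I -> T -> C) :
  (forall i, cmeas (F i)) -> cmeas (fun x => \prod_(i <- s) F i x).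
Proof.
move=> mF; elim: s => [|i s IH].
  by under eq_fun do rewrite big_nil; exact: cmeas_cst.
by under eq_fun do rewrite big_cons; exact: cmeasM.
Qed.

Lemma measurable_n1 f : cmeas f -> measurable_fun setT (fun x => n1 (f x)).
Proof. by move=> [a b]; apply: measurable_funD; exact: measurableT_comp. Qed.

Lemma cmeas_indic (A : set T) f : measurable A -> cmeas f ->
  cmeas (fun x => (\1_A x)%:C%C * f x).
Proof. by move=> mA mf; apply: cmeasM => //; apply: cmeas_real. Qed.

End complex_measurability.

Lemma cmeas_comp d d' (T : measurableType d) (T' : measurableType d') (R : realType)
    (f : T' -> R[i]) (g : T -> T') :
  cmeas f -> measurable_fun setT g -> cmeas (fun x => f (g x)).
Proof. by move=> [a b] mg; split; [exact: (measurableT_comp a mg)|exact: (measurableT_comp b mg)]. Qed.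

Lemma cmeas_cexp d (T : measurableType d) (R : realType) (f : T -> R[i]) :
  cmeas f -> cmeas (fun x => cexp (f x)).
Proof.
move=> [a b]; split => /=; apply: measurable_funM.
- by apply: measurableT_comp.
- apply: measurableT_comp => //; apply: continuous_measurable_fun; exact: continuous_cos.
- by apply: measurableT_comp.
- apply: measurableT_comp => //; apply: continuous_measurable_fun; exact: continuous_sin.
Qed.

Section complex_integral.
Context d (T : measurableType d) (R : realType).
Variable mu : {measure set T -> \bar R}.
Local Notation C := R[i].
Local Notation Re := (@complex.Re R).
Local Notation Im := (@complex.Im R).
Implicit Types f g : T -> C.

Definition cintg f :=
  mu.-integrable setT (fun x => (Re (f x))%:E) /\
  mu.-integrable setT (fun x => (Im (f x))%:E).

Definition cI f : C := Complex (\int[mu]_x Re (f x)) (\int[mu]_x Im (f x)).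

Lemma cintg_meas f : cintg f -> cmeas f.
Proof.
by move=> [a b]; split; apply/measurable_EFinP;
  [exact: measurable_int a|exact: measurable_int b].
Qed.

Lemma cintg_le f (g : T -> R) : cmeas f -> (forall x, n1 (f x) <= g x) ->
  mu.-integrable setT (EFin \o g) -> cintg f.
Proof.
move=> [a b] fg ig; split; apply: le_integrableR ig => // x;
  apply: le_trans (fg x); by rewrite /n1 ?lerDl ?lerDr.
Qed.

Lemma cintg_n1 f : cintg f -> mu.-integrable setT (fun x => (n1 (f x))%:E).
Proof.
move=> [a b].
by have := integrableD measurableT (integrable_norm a) (integrable_norm b).
Qed.

Lemma cintg_le_n1 f g : cmeas f -> cintg g -> (forall x, n1 (f x) <= n1 (g x)) -> cintg f.
Proof. by move=> mf /cintg_n1 ig fg; apply: cintg_le ig. Qed.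

Lemma cintgD f g : cintg f -> cintg g -> cintg (fun x => f x + g x).
Proof.
move=> [a b] [a' b']; split; under eq_fun do rewrite !cReImE EFinD;
  exact: integrableD.
Qed.

Lemma cintgZ c f : cintg f -> cintg (fun x => c * f x).
Proof.
move=> If; apply: (@cintg_le _ (fun x => n1 c * n1 (f x))).
- by apply: cmeasM; [exact: cmeas_cst|exact: cintg_meas].
- by move=> x; exact: n1M.
- exact: (integrableZl measurableT (n1 c) (cintg_n1 If)).
Qed.

Lemma cintgM_bounded (K : R) f g : cmeas f -> (forall x, n1 (f x) <= K) -> cintg g ->
  cintg (fun x => f x * g x).
Proof.
move=> mf fK Ig; apply: (@cintg_le _ (fun x => K * n1 (g x))).
- by apply: cmeasM => //; exact: cintg_meas.
- by move=> x; apply: le_trans (n1M _ _) _; apply: ler_wpM2r; rewrite ?n1_ge0.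
- exact: (integrableZl measurableT K (cintg_n1 Ig)).
Qed.

Lemma cintgJ f : cintg f -> cintg (fun x => (f x)^*%C).
Proof.
move=> If; apply: (cintg_le_n1 _ If); first exact: cmeasJ (cintg_meas If).
by move=> x; rewrite n1J.
Qed.

Lemma eq_cI f g : (forall x, f x = g x) -> cI f = cI g.
Proof. by move=> fg; congr Complex; apply: eq_Rintegral => x _; rewrite fg. Qed.

Lemma cID f g : cintg f -> cintg g -> cI (fun x => f x + g x) = cI f + cI g.
Proof.
move=> [a b] [a' b']; rewrite /cI; apply: complex_eq => /=.
  by under eq_Rintegral do rewrite cReD; rewrite RintegralD.
by under eq_Rintegral do rewrite cImD; rewrite RintegralD.
Qed.

Lemma cIZ c f : cintg f -> cI (fun x => c * f x) = c * cI f.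
Proof.
move=> [a b]; rewrite /cI; apply: complex_eq; rewrite /= !cReImE /=.
  under eq_Rintegral do rewrite cReM.
  rewrite RintegralB// ?RintegralZl//.
  - exact: (integrableZl measurableT (Re c) a).
  - exact: (integrableZl measurableT (Im c) b).
under eq_Rintegral do rewrite cImM.
rewrite RintegralD// ?RintegralZl//.
- exact: (integrableZl measurableT (Re c) b).
- exact: (integrableZl measurableT (Im c) a).
Qed.

Lemma cIJ f : cintg f -> cI (fun x => (f x)^*%C) = (cI f)^*%C.
Proof.
move=> [a b]; rewrite /cI; apply: complex_eq; rewrite /= ?cReImE /=.
  by apply: eq_Rintegral => x _; rewrite cReJ.
under eq_Rintegral do rewrite cImJ -mulN1r.
by rewrite RintegralZl// mulN1r.
Qed.

Lemma n1_cI f : cintg f -> n1 (cI f) <= \int[mu]_x n1 (f x).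
Proof.
move=> [a b]; rewrite {1}/n1 /cI /=.
apply: le_trans (lerD (le_normr_Rintegral measurableT a) (le_normr_Rintegral measurableT b)) _.
by rewrite -RintegralD//; [exact: integrable_norm a|exact: integrable_norm b].
Qed.

Lemma le_n1_cI f (g : T -> R) : cintg f -> mu.-integrable setT (EFin \o g) ->
  (forall x, n1 (f x) <= g x) -> n1 (cI f) <= \int[mu]_x g x.
Proof.
move=> If Ig fg; apply: le_trans (n1_cI If) _.
by apply: le_Rintegral => //; exact: cintg_n1.
Qed.

(** The majorant holds everywhere but the convergence only almost everywhere: the inner integrals of
    the Hermitian model converge off a null set. *)
Lemma cI_dominated (f_ : nat -> T -> C) f (g : T -> R) :
  (forall n, cmeas (f_ n)) -> cmeas f -> mu.-integrable setT (EFin \o g) ->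
  {ae mu, forall x, ccvg (f_ ^~ x) (f x)} -> (forall n x, n1 (f_ n x) <= g x) ->
  ccvg (fun n => cI (f_ n)) (cI f).
Proof.
move=> mf_ mf ig ff fg.
have dc (h_ : nat -> T -> R) (h : T -> R) : (forall n, measurable_fun setT (h_ n)) ->
   measurable_fun setT h -> {ae mu, forall x, h_ n x @[n --> \oo] --> h x} ->
   (forall n x, `|h_ n x| <= g x) ->
   \int[mu]_x h_ n x @[n --> \oo] --> \int[mu]_x h x.
  move=> mh_ mh hh hg.
  have [ih _ dc] : [/\ mu.-integrable setT (EFin \o h),
    [sequence \int[mu]_x (`|(h_ n x)%:E - (h x)%:E|)]_n @ \oo --> 0 &
    [sequence \int[mu]_x (h_ n x)%:E]_n @ \oo --> \int[mu]_x (h x)%:E]%E.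
    apply: (@dominated_convergence _ _ _ mu setT measurableT _ _ (EFin \o g)) => //.
    - by move=> n; apply/measurable_EFinP.
    - exact/measurable_EFinP.
    - by apply: filterS hh => x hx _; apply: cvg_EFin => //; apply: nearW.
    - by apply: aeW => x n _ /=; rewrite lee_fin.
  apply: fine_cvg; rewrite fineK//; exact: (integrable_fin_num measurableT ih).
split.
- apply: dc.
  + by move=> n; have [] := mf_ n.
  + by have [] := mf.
  + by apply: filterS ff => x [].
  + by move=> n x; apply: le_trans (fg n x); rewrite /n1 lerDl.
- apply: dc.
  + by move=> n; have [] := mf_ n.
  + by have [] := mf.
  + by apply: filterS ff => x [].
  + by move=> n x; apply: le_trans (fg n x); rewrite /n1 lerDr.
Qed.

End complex_integral.

Section complex_fubini.
Context d1 d2 (T1 : measurableType d1) (T2 : measurableType d2) (R : realType).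
Variable m1 : {sigma_finite_measure set T1 -> \bar R}.
Variable m2 : {sigma_finite_measure set T2 -> \bar R}.
Variables (a : T1 -> R) (b : T2 -> R).
Hypothesis ia : m1.-integrable setT (EFin \o a).
Hypothesis ib : m2.-integrable setT (EFin \o b).
Variable f : T1 * T2 -> R[i].
Hypothesis mf : cmeas f.
Hypothesis fab : forall x y, n1 (f (x, y)) <= a x * b y.

Let mfr := mf.1.
Let mfi := mf.2.

Let fr x y : `|complex.Re (f (x, y))| <= a x * b y.
Proof. by apply: le_trans (fab x y); rewrite lerDl. Qed.

Let fi x y : `|complex.Im (f (x, y))| <= a x * b y.
Proof. by apply: le_trans (fab x y); rewrite lerDr. Qed.

Lemma cintg_section1 x : cintg m2 (fun y => f (x, y)).
Proof.
split; first exact: (dominated_section1 ib mfr fr).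
exact: (dominated_section1 ib mfi fi).
Qed.

Lemma cintg_section2 y : cintg m1 (fun x => f (x, y)).
Proof.
split; first exact: (dominated_section2 ia mfr fr).
exact: (dominated_section2 ia mfi fi).
Qed.

Lemma cmeas_cI1 : cmeas (fun x => cI m2 (fun y => f (x, y))).
Proof.
split => /=; first exact: (measurable_Rintegral1 ia ib mfr fr).
exact: (measurable_Rintegral1 ia ib mfi fi).
Qed.

Lemma cmeas_cI2 : cmeas (fun y => cI m1 (fun x => f (x, y))).
Proof.
split => /=; first exact: (measurable_Rintegral2 ia ib mfr fr).
exact: (measurable_Rintegral2 ia ib mfi fi).
Qed.

Lemma n1_cI1 x : n1 (cI m2 (fun y => f (x, y))) <= a x * \int[m2]_y b y.
Proof.
rewrite -RintegralZl//; apply: le_n1_cI => //; first exact: cintg_section1.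
exact: (integrableZl measurableT (a x) ib).
Qed.

Lemma n1_cI2 y : n1 (cI m1 (fun x => f (x, y))) <= b y * \int[m1]_x a x.
Proof.
rewrite -RintegralZl//; apply: le_n1_cI => //; first exact: cintg_section2.
  exact: (integrableZl measurableT (b y) ia).
by move=> x; rewrite mulrC.
Qed.

Lemma cintg_cI1 : cintg m1 (fun x => cI m2 (fun y => f (x, y))).
Proof.
apply: cintg_le n1_cI1 _; first exact: cmeas_cI1.
have := integrableZl measurableT (\int[m2]_y b y) ia.
by apply: eq_integrable => // x _; rewrite /= mulrC.
Qed.

Lemma cintg_cI2 : cintg m2 (fun y => cI m1 (fun x => f (x, y))).
Proof.
apply: cintg_le n1_cI2 _; first exact: cmeas_cI2.
have := integrableZl measurableT (\int[m1]_x a x) ib.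
by apply: eq_integrable => // x _; rewrite /= mulrC.
Qed.

Lemma cFubini :
  cI m1 (fun x => cI m2 (fun y => f (x, y))) = cI m2 (fun y => cI m1 (fun x => f (x, y))).
Proof.
congr Complex; first exact: (RFubini ia ib mfr fr).
exact: (RFubini ia ib mfi fi).
Qed.

End complex_fubini.

Section lebn_complex.
Variable R : realType.
Local Notation lebn := (@lebn R).
Local Notation C := R[i].
Local Notation leb := (@lebesgue_measure R : {sigma_finite_measure set (measurableTypeR R) -> \bar R}).

(** The identity for nonnegative functions is applied to the absolute value of each part, for
    integrability, and then to positive and negative parts, for the value. *)
Lemma cI_transfer d d' (T : measurableType d) (T' : measurableType d')
    (m : {measure set T -> \bar R}) (m' : {measure set T' -> \bar R})
    (g : T -> T') (f : T' -> C) (c : R) : 0 <= c -> measurable_fun setT g ->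
  (forall h : T' -> \bar R, measurable_fun setT h -> (forall x, 0 <= h x)%E ->
    \int[m']_x h x = c%:E * \int[m]_x h (g x))%E ->
  cmeas f -> cintg m (fun x => f (g x)) ->
  cintg m' f /\ cI m' f = c%:C%C * cI m (fun x => f (g x)).
Proof.
move=> c0 mg mm' [fr fi] [ir ii].
have E (h : T' -> R) : measurable_fun setT h ->
    m.-integrable setT (fun x => (h (g x))%:E) ->
    m'.-integrable setT (EFin \o h) /\
    \int[m']_x h x = c * \int[m]_x h (g x).
  move=> mh ih; have mh' := (measurable_EFinP _ _).2 mh.
  have ihm : m'.-integrable setT (EFin \o h).
    apply/integrableP; split => //.
    rewrite mm'//; last exact: measurableT_comp.
    by move/integrableP : ih => [_ ?]; rewrite lte_mul_pinfty.
  split => //; rewrite /Rintegral integralE.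
  rewrite !mm'//; last 2 first.
  - exact: measurable_funeneg.
  - exact: measurable_funepos.
  have -> : (fun x => (fun y : T' => (h y)%:E)^\+ (g x))%E =
    (fun x => (h (g x))%:E)^\+%E by apply/funext => x; rewrite !funeposE.
  have -> : (fun x => (fun y : T' => (h y)%:E)^\- (g x))%E =
    (fun x => (h (g x))%:E)^\-%E by apply/funext => x; rewrite !funenegE.
  have fp := integrable_fin_num measurableT (integrable_funepos measurableT ih).
  have fn := integrable_fin_num measurableT (integrable_funeneg measurableT ih).
  rewrite fineB ?fin_numM// !fineM// -mulrBr -fineB//; congr (_ * fine _).
  by rewrite [RHS]integralE.
have [i1 e1] := E _ fr ir; have [i2 e2] := E _ fi ii.
split => //; rewrite /cI e1 e2.
by apply: complex_eq; rewrite /= ?mul0r ?subr0 ?addr0.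
Qed.

Lemma cI_lebnS n (f : n.+1.-tuple R -> C) (a : R -> R) (b : n.-tuple R -> R) :
  leb.-integrable setT (EFin \o a) -> (lebn n).-integrable setT (EFin \o b) ->
  cmeas f -> (forall t x, n1 (f (tcons (t, x))) <= a t * b x) ->
  cintg (lebn n.+1) f /\
  cI (lebn n.+1) f = cI leb (fun t => cI (lebn n) (fun x => f (tcons (t, x)))).
Proof.
move=> ia ib mf fab.
pose ft p := f (tcons (p : R * n.-tuple R)).
have mft : cmeas ft by apply: (cmeas_comp mf); exact: measurable_tcons.
have [mfr mfi] := mft.
pose M : {measure set _ -> \bar R} := sfproduct leb (lebn n).
have i1 : cintg M ft.
  split; apply: (integrable_dominated_product ia ib) => // t x;
   by apply: le_trans (fab t x); rewrite ?lerDl ?lerDr.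
have [|h -> ] := @cI_transfer _ _ _ _ M (lebn n.+1) (@tcons R n) f 1 ler01
    (@measurable_tcons R n) _ mf i1.
  move=> h mh h0; rewrite mul1e (ge0_integral_lebnS mh h0) fubini_tonelli1//.
    exact: sigma_finiteT.
  by apply: (measurableT_comp mh); exact: measurable_tcons.
split => //; rewrite mul1r.
congr Complex.
- rewrite /Rintegral -(integral12_prod_meas1 i1.1); congr fine.
  apply: eq_integral => t _; rewrite /fubini_F fineK//.
  by have [/(integrable_fin_num measurableT)] := cintg_section1 ib mft fab t.
- rewrite /Rintegral -(integral12_prod_meas1 i1.2); congr fine.
  apply: eq_integral => t _; rewrite /fubini_F fineK//.
  by have [_ /(integrable_fin_num measurableT)] := cintg_section1 ib mft fab t.
Qed.

Lemma cI_prod n (f : 'I_n -> R -> C) : (forall i, cintg leb (f i)) ->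
  cintg (lebn n) (fun x => \prod_(i < n) f i (tnth x i)) /\
  cI (lebn n) (fun x => \prod_(i < n) f i (tnth x i)) = \prod_(i < n) cI leb (f i).
Proof.
elim: n f => [|n IH] f If.
  have -> : (fun x => \prod_(i < 0) f i (tnth x i)) = fun=> 1.
    by apply/funext => x; rewrite big_ord0.
  rewrite big_ord0; split.
    by split => /=; [exact: finite_measure_integrable_cst|exact: integrable0].
  apply: complex_eq => /=; rewrite /Rintegral ge0_integral_lebn0//.
have [If' E'] := IH (fun i => f (lift ord0 i)) (fun i => If _).
have E t x : \prod_(i < n.+1) f i (tnth (tcons (t, x)) i) =
    f ord0 t * \prod_(i < n) f (lift ord0 i) (tnth x i).
  by rewrite big_ord_recl tnth0; congr (_ * _); apply: eq_bigr => i _; rewrite tnthS.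
have [|t x|I1 ->] := @cI_lebnS n (fun x => \prod_(i < n.+1) f i (tnth x i))
    (fun t => n1 (f ord0 t)) _ (cintg_n1 (If ord0)) (cintg_n1 If').
- apply: cmeas_prod => i; apply: cmeas_comp; first exact: cintg_meas (If i).
  exact: measurable_tnth.
- by rewrite E; exact: n1M.
- split => //; rewrite big_ord_recl -E'.
  transitivity (cI leb (fun t => cI (lebn n)
      (fun x => \prod_(i < n) f (lift ord0 i) (tnth x i)) * f ord0 t)).
    apply: eq_cI => t; under eq_cI do rewrite E.
    by rewrite cIZ// mulrC.
  by rewrite cIZ// mulrC.
Qed.

End lebn_complex.

(** * Linear changes of variables *)

Section linear_change.
Variable R : realType.
Local Notation lebn := (@lebn R).
Local Notation leb := (@lebesgue_measure R).

Definition unit_box n (x : n.-tuple R) : \bar R :=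
  (\prod_(i < n) (\1_(`[0, 1]%classic : set R) (tnth x i))%:E)%E.

Lemma unit_box_ge0 n (x : n.-tuple R) : (0 <= unit_box x)%E.
Proof. by apply: prode_ge0 => i _; rewrite lee_fin. Qed.

Let measurable_indic01 : measurable_fun setT (fun t : R => (\1_(`[0, 1]%classic : set R) t)%:E : \bar R).
Proof. by apply/measurable_EFinP; exact: measurable_indic. Qed.

Lemma measurable_unit_box n : measurable_fun setT (@unit_box n).
Proof.
apply: emeasurable_prod => i; apply: (measurableT_comp measurable_indic01).
exact: measurable_tnth.
Qed.

Lemma integral_indic_cc (a b : R) : a <= b ->
  (\int[leb]_t (\1_(`[a, b]%classic : set R) t)%:E = (b - a)%:E)%E.
Proof.
move=> ab; rewrite integral_indic// setIT.
transitivity (leb (`[a, b]%classic : set R)) => //.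
rewrite lebesgue_measure_itv/= lte_fin; case: ltP => // ba.
by rewrite (@le_anti _ _ a b) ?ab// subrr.
Qed.

Lemma integral_unit_box n : (\int[lebn n]_x unit_box x = 1)%E.
Proof.
rewrite (@ge0_integral_prod _ n (fun _ t => (\1_(`[0, 1]%classic : set R) t)%:E : \bar R))//.
by rewrite big1// => i _; rewrite integral_indic_cc// subr0.
Qed.

Definition tadditive n (f : n.-tuple R -> n.-tuple R) := {morph f : x y / tadd x y}.

(** Additivity is all that the shear argument below uses of linearity; the inverse is part of the
    data so that its measurability is at hand. *)
Definition lin_iso n (f g : n.-tuple R -> n.-tuple R) :=
  [/\ measurable_fun setT f, measurable_fun setT g, tadditive f,
      cancel f g & cancel g f].

Lemma lin_iso_sym n (f g : n.-tuple R -> n.-tuple R) : lin_iso f g -> lin_iso g f.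
Proof.
move=> [mf mg fD fK gK]; split => // x y.
by apply: (can_inj fK); rewrite fD !gK.
Qed.

Lemma lin_iso_comp n (f g f' g' : n.-tuple R -> n.-tuple R) :
  lin_iso f g -> lin_iso f' g' -> lin_iso (f \o f') (g' \o g).
Proof.
move=> [mf mg fD fK gK] [mf' mg' fD' fK' gK']; split.
- exact: measurableT_comp.
- exact: measurableT_comp.
- by move=> x y /=; rewrite fD' fD.
- by move=> x /=; rewrite fK fK'.
- by move=> x /=; rewrite gK' gK.
Qed.

(** The factor $1/|\det f|$ of a linear [f], obtained without determinants. The reflection [topp] is
    what the shears of the next proof leave behind. *)
Definition escale n (f : n.-tuple R -> n.-tuple R) : \bar R :=
  (\int[lebn n]_x unit_box (topp (f x)))%E.

(* Uniqueness of translation-invariant measures: evaluate the double integral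
   of [h (f x) * unit_box y] after shearing in [x], in [y] and again in [x]. *)
Lemma ge0_integral_escale n (f g : n.-tuple R -> n.-tuple R) (h : n.-tuple R -> \bar R) :
  lin_iso f g -> measurable_fun setT h -> (forall x, 0 <= h x)%E ->
  (\int[lebn n]_x h (f x) = escale f * \int[lebn n]_x h x)%E.
Proof.
move=> [mf mg fD fK gK] mh h0.
have f0 x y : f (tadd x (g y)) = tadd (f x) y by rewrite fD gK.
have mhf : measurable_fun setT (fun x => h (f x)) by exact: measurableT_comp.
have mb := @measurable_unit_box n; have b0 := @unit_box_ge0 n.
have hf0 x : (0 <= h (f x))%E by [].
pose F (p : n.-tuple R * n.-tuple R) := (h (tadd (f p.1) p.2) * unit_box p.2)%E.
pose G (p : n.-tuple R * n.-tuple R) := (h p.2 * unit_box (tadd p.2 (topp (f p.1))))%E.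
have mf1 : measurable_fun setT (fun p : n.-tuple R * n.-tuple R => f p.1).
  exact: (measurableT_comp mf).
have mF : measurable_fun setT F.
  apply: emeasurable_funM; last exact: (measurableT_comp mb).
  by apply: (measurableT_comp mh); exact: measurable_tadd.
have mG : measurable_fun setT G.
  apply: emeasurable_funM; first exact: (measurableT_comp mh).
  by apply: (measurableT_comp mb); apply: measurable_tadd => //; exact: measurable_topp.
have F0 p : (0 <= F p)%E by apply: mule_ge0.
have G0 p : (0 <= G p)%E by apply: mule_ge0.
transitivity (\int[lebn n]_y \int[lebn n]_x F (x, y))%E.
  transitivity (\int[lebn n]_y ((\int[lebn n]_x h (f x)) * unit_box y))%E.
    by rewrite ge0_integralZl// ?integral_unit_box ?mule1//; exact: integral_ge0.
  apply: eq_integral => y _; rewrite /F/= [RHS]ge0_integralZr//; last first.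
    by apply: (measurableT_comp mh); apply: measurable_tadd => //; exact: measurable_cst.
  congr (_ * _)%E; rewrite -(ge0_integral_tadd (g y) mhf hf0).
  by apply: eq_integral => x _; rewrite f0.
rewrite -fubini_tonelli//.
transitivity (\int[lebn n]_x \int[lebn n]_y G (x, y))%E.
  apply: eq_integral => x _.
  have mGx : measurable_fun setT (fun y => G (x, y)) by exact: measurableT_comp.
  rewrite -(ge0_integral_tadd (f x) mGx (fun y => G0 _)).
  by apply: eq_integral => y _; rewrite /F /G/= taddK taddC.
rewrite fubini_tonelli//.
have mbf : measurable_fun setT (fun x => unit_box (topp (f x))).
  by apply: (measurableT_comp mb); exact: measurable_topp.
rewrite muleC -ge0_integralZr//; last by apply: integral_ge0.
apply: eq_integral => z _.
rewrite /G/= ge0_integralZl//; last first.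
  apply: (measurableT_comp mb); apply: measurable_tadd; first exact: measurable_cst.
  exact: measurable_topp.
congr (_ * _)%E.
rewrite -(ge0_integral_tadd (g z)) => [||x] //; last first.
  apply: (measurableT_comp mb); apply: measurable_tadd; first exact: measurable_cst.
  exact: measurable_topp.
apply: eq_integral => x _; congr unit_box; rewrite f0.
by apply: eq_from_tnth => i; rewrite !(tnth_tadd, tnth_topp) opprD addrCA subrr addr0.
Qed.

Definition lscale n (f : n.-tuple R -> n.-tuple R) : R := fine (escale f).

Section properties.
Variables (n : nat) (f g : n.-tuple R -> n.-tuple R).
Hypothesis fg : lin_iso f g.

(** Substituting [f] and then its inverse gives back the integral of the unit box, which is 1. A
    product equal to 1 leaves neither factor equal to 0 or to [+oo]. *)
Let escale_mul : (escale g * escale f = 1)%E.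
Proof.
have [mf mg fD fK gK] := fg.
have h := ge0_integral_escale fg (@measurable_unit_box n) (@unit_box_ge0 n).
rewrite integral_unit_box mule1 in h; rewrite -h.
rewrite -(ge0_integral_escale (lin_iso_sym fg)) ?integral_unit_box//.
- by rewrite -[RHS](integral_unit_box n); apply: eq_integral => x _; rewrite gK.
- by apply: (measurableT_comp (@measurable_unit_box n)).
- by move=> x; exact: unit_box_ge0.
Qed.

Let escale_ge0 h : (0 <= @escale n h)%E.
Proof. by apply: integral_ge0 => x _; exact: unit_box_ge0. Qed.

Lemma lscaleE : escale f = (lscale f)%:E.
Proof.
rewrite /lscale fineK// ge0_fin_numE// ltey; apply/eqP => fy.
have := escale_ge0 g; rewrite le_eqVlt => /orP[/eqP g0|g0].
  by move/eqP: escale_mul; rewrite -g0 mul0e eq_sym onee_eq0.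
by move/eqP: escale_mul; rewrite fy gt0_muley.
Qed.

Lemma lscale_gt0 : 0 < lscale f.
Proof.
rewrite -lte_fin -lscaleE lt_neqAle escale_ge0 andbT; apply/eqP => f0.
by move/eqP: escale_mul; rewrite -f0 mule0 eq_sym onee_eq0.
Qed.

Lemma ge0_integral_lscale (h : n.-tuple R -> \bar R) :
  measurable_fun setT h -> (forall x, 0 <= h x)%E ->
  (\int[lebn n]_x h (f x) = (lscale f)%:E * \int[lebn n]_x h x)%E.
Proof. by move=> mh h0; rewrite -lscaleE; exact: (ge0_integral_escale fg). Qed.

Lemma lscale_eq (c : R) (h : n.-tuple R -> \bar R) :
  measurable_fun setT h -> (forall x, 0 <= h x)%E ->
  (0 < \int[lebn n]_x h x < +oo)%E ->
  (\int[lebn n]_x h (f x) = c%:E * \int[lebn n]_x h x)%E -> lscale f = c.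
Proof.
move=> mh h0 /andP[i0 ioo]; rewrite ge0_integral_lscale//.
have : (\int[lebn n]_x h x)%E \is a fin_num by rewrite ge0_fin_numE// ltW.
move: i0; case: (\int[lebn n]_x h x)%E => // r; rewrite lte_fin => r0 _.
by rewrite -!EFinM => -[/(mulIf (lt0r_neq0 r0))].
Qed.

End properties.

Lemma lscale_comp n (f g f' g' : n.-tuple R -> n.-tuple R) :
  lin_iso f g -> lin_iso f' g' -> lscale (f \o f') = lscale f * lscale f'.
Proof.
move=> fg fg'.
have mb := @measurable_unit_box n; have b0 := @unit_box_ge0 n.
apply: (lscale_eq (lin_iso_comp fg fg') mb b0).
  by rewrite integral_unit_box lte_fin ltr01 ltry.
rewrite [LHS](ge0_integral_lscale fg' (h := fun x => unit_box (f x)))//; last first.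
  by apply: (measurableT_comp mb); have [] := fg.
by rewrite (ge0_integral_lscale fg)// muleA -EFinM mulrC.
Qed.

Definition tscale n (t : 'I_n -> R) (x : n.-tuple R) : n.-tuple R :=
  [tuple t i * tnth x i | i < n].

Lemma lin_iso_tscale n (t : 'I_n -> R) : (forall i, 0 < t i) ->
  lin_iso (tscale t) (tscale (fun i => (t i)^-1)).
Proof.
have ms (s : 'I_n -> R) : measurable_fun setT (tscale s).
  apply: measurable_tuple_fun => i; rewrite /tscale; under eq_fun do rewrite tnth_mktuple.
  by apply: measurable_funM => //; exact: measurable_tnth.
move=> t0; split => //.
- by move=> x y; apply: eq_from_tnth => i; rewrite !(tnth_mktuple, tnth_tadd) mulrDr.
- by move=> x; apply: eq_from_tnth => i; rewrite !tnth_mktuple mulKf// gt_eqF.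
- by move=> x; apply: eq_from_tnth => i; rewrite !tnth_mktuple mulVKf// gt_eqF.
Qed.

Lemma lscale_tscale n (t : 'I_n -> R) : (forall i, 0 < t i) ->
  lscale (tscale t) = \prod_(i < n) (t i)^-1.
Proof.
move=> t0; have mb := @measurable_unit_box n; have b0 := @unit_box_ge0 n.
apply: (lscale_eq (lin_iso_tscale t0) mb b0).
  by rewrite integral_unit_box lte_fin ltr01 ltry.
rewrite integral_unit_box mule1 /unit_box.
pose A i : set R := `[0, (t i)^-1]%classic.
transitivity (\int[lebn n]_x \prod_(i < n) ((\1_(A i) (tnth x i))%:E : \bar R))%E.
  apply: eq_integral => x _; apply: eq_bigr => i _; rewrite tnth_mktuple; congr (_%:E).
  rewrite !indicE; congr (_%:R); congr (nat_of_bool _).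
  apply/idP/idP; rewrite !inE /A/= !in_itv/= => /andP[]; rewrite ?pmulr_rge0// => -> /=.
    by move=> h; rewrite -[_^-1]mul1r ler_pdivlMr// mulrC.
  by move=> h; rewrite mulrC -ler_pdivlMr// mul1r.
rewrite (@ge0_integral_prod _ n (fun i s => (\1_(A i) s)%:E : \bar R))//; last first.
  by move=> i; apply/measurable_EFinP; apply: measurable_indic; exact: measurable_itv.
rewrite -prodEFin; apply: eq_bigr => i _.
by rewrite integral_indic_cc ?subr0// invr_ge0 ltW.
Qed.

Definition gauss1 (w t : R) : \bar R := (expR (- (w * t ^+ 2)))%:E.

Lemma gauss1_ge0 w t : (0 <= gauss1 w t)%E.
Proof. by rewrite lee_fin expR_ge0. Qed.

Lemma measurable_gauss1 w : measurable_fun setT (gauss1 w).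
Proof.
apply/measurable_EFinP; apply: measurableT_comp => //; apply: measurableT_comp => //.
by apply: measurable_funM => //; exact: measurable_funX.
Qed.

Lemma integral_gauss1_gt0 w : (0 < \int[leb]_t gauss1 w t)%E.
Proof.
have m01 : measurable (`[0, 1]%classic : set R) by exact: measurable_itv.
apply: (@lt_le_trans _ _ (\int[leb]_t ((expR (- `|w|))%:E *
    (\1_(`[0, 1]%classic : set R) t)%:E))%E).
  rewrite ge0_integralZl//.
  by rewrite integral_indic_cc// subr0 mule1 lte_fin expR_gt0.
apply: ge0_le_integral => //.
- by apply: emeasurable_funM; apply/measurable_EFinP => //; exact: measurable_indic.
- exact: measurable_gauss1.
- move=> t _; rewrite indicE; have [|_] := boolP (t \in _); last by rewrite mule0 gauss1_ge0.
  rewrite inE/= in_itv/= => /andP[t0 t1]; rewrite mule1 lee_fin ler_expR lerN2.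
  apply: le_trans (ler_norm _) _; rewrite normrM (ger0_norm (sqr_ge0 t)).
  by rewrite ler_piMr// expr_le1.
Qed.

Lemma integral_gauss1_lty w : 1 <= w -> (\int[leb]_t gauss1 w t < +oo)%E.
Proof.
move=> w1; apply: (@le_lt_trans _ _ (\int[leb]_t (gauss_fun t)%:E)%E).
  apply: ge0_le_integral => //.
  - by move=> t _; exact: gauss1_ge0.
  - exact: measurable_gauss1.
  - by apply/measurable_EFinP; exact: measurable_gauss_fun.
  - by move=> t _; rewrite lee_fin ler_expR lerN2 ler_peMl// sqr_ge0.
by rewrite integralT_gauss ltry.
Qed.

Lemma integral_gauss1_oo (w : R) : w <= 0 -> (\int[leb]_t gauss1 w t = +oo)%E.
Proof.
move=> w0; apply/eqP; rewrite eq_le leey/=.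
have -> : (+oo = \int[leb]_t (1%:E : \bar R))%E.
  rewrite integral_cst// mul1e -set_itvNyy.
  have lT : leb (`]-oo, +oo[%classic : set R) = +oo%E by rewrite lebesgue_measure_itv.
  exact: esym lT.
apply: ge0_le_integral => //; first exact: measurable_gauss1.
by move=> t _; rewrite lee_fin -expR0 ler_expR oppr_ge0 mulr_le0_ge0// sqr_ge0.
Qed.

Definition gaussn n (w : 'I_n -> R) (x : n.-tuple R) : \bar R :=
  (expR (- \sum_(i < n) w i * tnth x i ^+ 2))%:E.

Lemma gaussn_prod n (w : 'I_n -> R) x :
  gaussn w x = (\prod_(i < n) gauss1 (w i) (tnth x i))%E.
Proof. by rewrite prodEFin /gaussn -sumrN expR_sum. Qed.

Lemma measurable_gaussn n (w : 'I_n -> R) : measurable_fun setT (gaussn w).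
Proof.
have -> : gaussn w = (fun x => \prod_(i < n) gauss1 (w i) (tnth x i))%E.
  by apply/funext => x; exact: gaussn_prod.
apply: emeasurable_prod => i; apply: (measurableT_comp (measurable_gauss1 _)).
exact: measurable_tnth.
Qed.

Lemma integral_gaussn n (w : 'I_n -> R) :
  (\int[lebn n]_x gaussn w x = \prod_(i < n) \int[leb]_t gauss1 (w i) t)%E.
Proof.
under eq_integral do rewrite gaussn_prod.
apply: ge0_integral_prod => i; first exact: measurable_gauss1.
by move=> t; exact: gauss1_ge0.
Qed.

Lemma integral_gaussn_gt0 n (w : 'I_n -> R) : (0 < \int[lebn n]_x gaussn w x)%E.
Proof.
rewrite integral_gaussn; elim/big_ind: _ => // [x y x0 y0|i _].
  exact: mule_gt0.
exact: integral_gauss1_gt0.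
Qed.

Lemma integral_gaussn_lty n (w : 'I_n -> R) : (forall i, 1 <= w i) ->
  (\int[lebn n]_x gaussn w x < +oo)%E.
Proof.
move=> w1; rewrite integral_gaussn.
have : (0 <= \prod_(i < n) \int[leb]_t gauss1 (w i) t < +oo)%E; last by move=> /andP[].
elim/big_ind: _ => [|x y /andP[x0 xy] /andP[y0 yy]|i _]; first by rewrite lee01 ltry.
  by rewrite mule_ge0//= lte_mul_pinfty// ge0_fin_numE.
by rewrite integral_gauss1_lty// integral_ge0// => t _; exact: gauss1_ge0.
Qed.

(** The integral factors over the coordinates: a weight that is not positive contributes an infinite
    factor, and the remaining factors are positive. Positive definiteness of the quadratic form of
    the matrix model is deduced from this. *)
Lemma integral_gaussn_lty_gt0 n (w : 'I_n -> R) i :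
  (\int[lebn n]_x gaussn w x < +oo)%E -> 0 < w i.
Proof.
move=> ilty; rewrite ltNge; apply/negP => wi; move: ilty.
rewrite integral_gaussn (bigD1 i)//= integral_gauss1_oo// gt0_mulye//.
elim/big_ind: _ => // [x y x0 y0|j _]; first exact: mule_gt0.
exact: integral_gauss1_gt0.
Qed.

(** The Gaussian of an invariant quadratic form serves as test function, which shows that unitary
    maps preserve Lebesgue measure. The bound [1 <= w i] gives finiteness by comparison with
    $e^{-t^2}$. *)
Lemma lscale_gauss_invariant n (f g : n.-tuple R -> n.-tuple R) (w : 'I_n -> R) :
  lin_iso f g -> (forall i, 1 <= w i) ->
  (forall x, \sum_(i < n) w i * tnth (f x) i ^+ 2 = \sum_(i < n) w i * tnth x i ^+ 2) ->
  lscale f = 1.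
Proof.
move=> fg w1 fw; apply: (lscale_eq fg (@measurable_gaussn n w)) => [x||].
- by rewrite lee_fin expR_ge0.
- by rewrite integral_gaussn_gt0 integral_gaussn_lty.
- by rewrite mul1e; apply: eq_integral => x _; rewrite /gaussn fw.
Qed.

End linear_change.

(** * Coordinates on complex and Hermitian matrices *)

Section matrix_coordinates.
Variable R : realType.
Local Notation C := R[i].
Local Open Scope sesquilinear_scope.

Lemma adjmxE n (M : 'M[C]_n) : adjmx M = M^t*.
Proof. by apply/matrixP => i j; rewrite !mxE. Qed.

Lemma adjmxM n (A B : 'M[C]_n) : adjmx (A *m B) = adjmx B *m adjmx A.
Proof. by rewrite !adjmxE trmx_mul map_mxM. Qed.

Lemma adjmxK n : involutive (@adjmx R n).
Proof. by move=> A; rewrite !adjmxE trmxCK. Qed.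

Lemma adjmxD n (A B : 'M[C]_n) : adjmx (A + B) = adjmx A + adjmx B.
Proof. by rewrite !adjmxE linearD/= map_mxD. Qed.

Lemma adjmx1 n : adjmx 1%:M = 1%:M :> 'M[C]_n.
Proof. by rewrite adjmxE trmx1 map_mx1. Qed.

Lemma det_adjmx n (A : 'M[C]_n) : \det (adjmx A) = (\det A)^*%C.
Proof. by rewrite adjmxE det_map_mx det_tr. Qed.

Lemma adjmx_unit n (A : 'M[C]_n) : (adjmx A \in unitmx) = (A \in unitmx).
Proof. by rewrite adjmxE map_unitmx unitmx_tr. Qed.

Definition cvec n (M : 'M[C]_n) : (n * n + n * n).-tuple R :=
  [tuple match fintype.split k with
         | inl k1 => complex.Re (mxvec M 0 k1)
         | inr k2 => complex.Im (mxvec M 0 k2) end | k < n * n + n * n].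

Lemma tnth_cvec_l n (M : 'M[C]_n) i j :
  tnth (cvec M) (lshift _ (mxvec_index i j)) = complex.Re (M i j).
Proof. by rewrite tnth_mktuple (unsplitK (inl _ _)) mxvecE. Qed.

Lemma tnth_cvec_r n (M : 'M[C]_n) i j :
  tnth (cvec M) (rshift _ (mxvec_index i j)) = complex.Im (M i j).
Proof. by rewrite tnth_mktuple (unsplitK (inr _ _)) mxvecE. Qed.

Lemma cvecK n : cancel (@cvec n) (@cmat R n).
Proof.
move=> M; apply/matrixP => i j; rewrite mxE tnth_cvec_l tnth_cvec_r.
by case: (M i j).
Qed.

Lemma cmatK n : cancel (@cmat R n) (@cvec n).
Proof.
move=> x; apply: eq_from_tnth => k.
case: (splitP k) => k' kk'.
  have -> : k = lshift _ k' by apply/val_inj.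
  by case/mxvec_indexP: k' {kk'} => i j; rewrite tnth_cvec_l mxE.
have -> : k = rshift _ k' by apply/val_inj.
by case/mxvec_indexP: k' {kk'} => i j; rewrite tnth_cvec_r mxE.
Qed.

Lemma cmatD n : {morph @cmat R n : x y / tadd x y >-> x + y}.
Proof.
move=> x y; apply/matrixP => i j; rewrite !mxE !tnth_tadd.
by apply: complex_eq.
Qed.

Lemma cvecD n : {morph @cvec n : x y / x + y >-> tadd x y}.
Proof. by move=> x y; apply: (can_inj (@cmatK n)); rewrite cmatD !cvecK. Qed.

Definition hvec n (A : 'M[C]_n) : (n * n).-tuple R :=
  [tuple mxvec (\matrix_(i, j) if i == j then complex.Re (A i i)
    else if (i < j)%N then complex.Re (A i j) else complex.Im (A j i)) 0 k | k < n * n].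

Lemma tnth_hvec n (A : 'M[C]_n) i j : tnth (hvec A) (mxvec_index i j) =
  if i == j then complex.Re (A i i)
    else if (i < j)%N then complex.Re (A i j) else complex.Im (A j i).
Proof. by rewrite tnth_mktuple mxvecE mxE. Qed.

Lemma hermmat_adj n (x : (n * n).-tuple R) : adjmx (hermmat x) = hermmat x.
Proof.
apply/matrixP => i j; rewrite !mxE /= eq_sym.
have [->|nij] := eqVneq i j; first by apply: complex_eq => /=; rewrite ?oppr0.
by case: (ltngtP i j) => [ij|ji|/val_inj eij]; first 2 last; [
  by rewrite eij eqxx in nij|apply: complex_eq => //=..]; rewrite opprK.
Qed.

Lemma hermmatK n : cancel (@hermmat R n) (@hvec n).
Proof.
move=> x; apply: eq_from_tnth => k; case/mxvec_indexP: k => i j.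
rewrite tnth_hvec !mxE eqxx/=.
have [->//|nij] := eqVneq i j.
case: (ltngtP i j) => [ij|ji|/val_inj eij] //=.
by rewrite eij eqxx in nij.
Qed.

Lemma hvecK n (A : 'M[C]_n) : adjmx A = A -> hermmat (hvec A) = A.
Proof.
move=> hA; have AJ i j : A i j = (A j i)^*%C by rewrite -{1}hA mxE.
apply/matrixP => i j; rewrite mxE/= !tnth_hvec eqxx.
have [->|nij] := eqVneq i j.
  apply: complex_eq => //=; have := congr1 (@complex.Im R) (AJ j j).
  by rewrite cImJ => h; lra.
case: (ltngtP i j) => [ij|ji|/val_inj eij] //=.
- by case: (A i j).
- by rewrite [RHS]AJ; case: (A j i).
- by rewrite eij eqxx in nij.
Qed.

Lemma hermmatD n : {morph @hermmat R n : x y / tadd x y >-> x + y}.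
Proof.
move=> x y; apply/matrixP => i j; rewrite !mxE /= !tnth_tadd.
by case: ifP => _; [|case: ifP => _]; apply: complex_eq => //=; rewrite ?addr0 ?opprD.
Qed.

Lemma hvecD n : {morph @hvec n : x y / x + y >-> tadd x y}.
Proof.
move=> A B; apply: eq_from_tnth => k; case/mxvec_indexP: k => i j.
rewrite tnth_tadd !tnth_hvec !mxE.
by case: ifP => _; [|case: ifP => _]; rewrite !cReImE.
Qed.

End matrix_coordinates.

(** * Entrywise measurability of matrix-valued maps *)

Section matrix_measurability.
Context d (T : measurableType d) (R : realType).
Local Notation C := R[i].

Definition mxmeas m n (f : T -> 'M[C]_(m, n)) := forall i j, cmeas (fun x => f x i j).

Lemma mxmeas_cst m n (A : 'M[C]_(m, n)) : mxmeas (fun=> A).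
Proof. by move=> i j; exact: cmeas_cst. Qed.

Lemma mxmeasD m n (f g : T -> 'M[C]_(m, n)) : mxmeas f -> mxmeas g ->
  mxmeas (fun x => f x + g x).
Proof. by move=> mf mg i j; under eq_fun do rewrite mxE; exact: cmeasD. Qed.

Lemma mxmeasN m n (f : T -> 'M[C]_(m, n)) : mxmeas f -> mxmeas (fun x => - f x).
Proof. by move=> mf i j; under eq_fun do rewrite mxE; exact: cmeasN. Qed.

Lemma mxmeasM m n p (f : T -> 'M[C]_(m, n)) (g : T -> 'M[C]_(n, p)) :
  mxmeas f -> mxmeas g -> mxmeas (fun x => f x *m g x).
Proof.
move=> mf mg i j; under eq_fun do rewrite mxE.
by apply: cmeas_sum => k; exact: cmeasM.
Qed.

Lemma mxmeas_adj n (f : T -> 'M[C]_n) : mxmeas f -> mxmeas (fun x => adjmx (f x)).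
Proof. by move=> mf i j; under eq_fun do rewrite mxE; exact: cmeasJ. Qed.

Lemma cmeas_tr n (f : T -> 'M[C]_n) : mxmeas f -> cmeas (fun x => \tr (f x)).
Proof. by move=> mf; apply: cmeas_sum => i; exact: mf. Qed.

Lemma cmeas_det n (f : T -> 'M[C]_n) : mxmeas f -> cmeas (fun x => \det (f x)).
Proof.
move=> mf; rewrite /determinant; apply: cmeas_sum => s.
by apply: cmeasM; [exact: cmeas_cst|apply: cmeas_prod => i; exact: mf].
Qed.

Lemma mxmeas_cmat n (f : T -> (n * n + n * n).-tuple R) : measurable_fun setT f ->
  mxmeas (fun x => cmat (f x)).
Proof.
move=> mf i j; under eq_fun do rewrite mxE.
by apply: cmeas_Complex; exact: measurable_tnth_comp.
Qed.

Lemma mxmeas_hermmat n (f : T -> (n * n).-tuple R) : measurable_fun setT f ->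
  mxmeas (fun x => hermmat (f x)).
Proof.
move=> mf i j; under eq_fun do rewrite mxE/=.
case: (i == j); first by apply: cmeas_Complex; [exact: measurable_tnth_comp|exact: measurable_cst].
case: (i < j)%N; apply: cmeas_Complex; try exact: measurable_tnth_comp.
by apply: measurableT_comp => //; exact: measurable_tnth_comp.
Qed.

Lemma measurable_cvec n (f : T -> 'M[C]_n) : mxmeas f ->
  measurable_fun setT (fun x => cvec (f x)).
Proof.
move=> mf; apply: measurable_tuple_fun => k.
case: (splitP k) => k' kk'.
  have -> : k = lshift _ k' by apply/val_inj.
  case/mxvec_indexP: k' {kk'} => i j; under eq_fun do rewrite tnth_cvec_l.
  by have [] := mf i j.
have -> : k = rshift _ k' by apply/val_inj.
case/mxvec_indexP: k' {kk'} => i j; under eq_fun do rewrite tnth_cvec_r.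
by have [] := mf i j.
Qed.

Lemma measurable_hvec n (f : T -> 'M[C]_n) : mxmeas f ->
  measurable_fun setT (fun x => hvec (f x)).
Proof.
move=> mf; apply: measurable_tuple_fun => k; case/mxvec_indexP: k => i j.
under eq_fun do rewrite tnth_hvec.
case: (i == j); first by have [] := mf i i.
by case: (i < j)%N; [have [] := mf i j|have [] := mf j i].
Qed.

End matrix_measurability.

(** * Spectral theorem, singular values and multiplicative functions of a matrix *)

Section spectral.
Variable R : realType.
Local Notation C := R[i].
Local Open Scope sesquilinear_scope.

Definition nsq (z : C) : R := complex.Re z ^+ 2 + complex.Im z ^+ 2.

Lemma nsq_ge0 z : 0 <= nsq z. Proof. by rewrite addr_ge0 ?sqr_ge0. Qed.

Lemma nsqM z w : nsq (z * w) = nsq z * nsq w.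
Proof. by rewrite /nsq !cReImE; ring. Qed.

Lemma nsq_real (x : R) : nsq x%:C%C = x ^+ 2.
Proof. by rewrite /nsq/= expr0n addr0. Qed.

Lemma nsq_eq0 z : (nsq z == 0) = (z == 0).
Proof.
apply/idP/eqP => [|->]; last by rewrite /nsq/= expr0n addr0.
rewrite paddr_eq0 ?sqr_ge0// !sqrf_eq0 => /andP[/eqP a /eqP b].
exact: complex_eq.
Qed.

Lemma mulJc z : z^*%C * z = (nsq z)%:C%C.
Proof. by apply: complex_eq; rewrite !cReImE /nsq/=; ring. Qed.

Definition rdiag n (e : 'I_n -> R) : 'M[C]_n := diag_mx (\row_i (e i)%:C%C).

Lemma rdiagE n (e : 'I_n -> R) i j : rdiag e i j = (e i)%:C%C *+ (i == j).
Proof. by rewrite !mxE. Qed.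

Lemma rdiag_adj n (e : 'I_n -> R) : adjmx (rdiag e) = rdiag e.
Proof.
apply/matrixP => i j; rewrite mxE !rdiagE eq_sym.
by have [->|_] := eqVneq i j; rewrite ?mulr1n ?mulr0n ?conjc_real ?rmorph0.
Qed.

Lemma rdiagM n (e f : 'I_n -> R) : rdiag e *m rdiag f = rdiag (fun i => e i * f i).
Proof.
rewrite /rdiag mulmx_diag; congr diag_mx; apply/rowP => i.
by rewrite !mxE rmorphM.
Qed.

Lemma rdiag1 n : rdiag (fun _ : 'I_n => 1) = 1%:M.
Proof. by apply/matrixP => i j; rewrite rdiagE mxE. Qed.

Lemma det_rdiag n (e : 'I_n -> R) : \det (rdiag e) = (\prod_i e i)%:C%C.
Proof. by rewrite det_diag rmorph_prod; apply: eq_bigr => i _; rewrite mxE. Qed.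

Definition unitary n (U : 'M[C]_n) := adjmx U *m U = 1%:M.

Lemma unitary_unit n (U : 'M[C]_n) : unitary U -> U \in unitmx.
Proof. by move=> /mulmx1_unit[]. Qed.

Lemma unitaryC n (U : 'M[C]_n) : unitary U -> U *m adjmx U = 1%:M.
Proof. exact: mulmx1C. Qed.

Lemma unitary_adj n (U : 'M[C]_n) : unitary U -> unitary (adjmx U).
Proof. by move=> UU; rewrite /unitary adjmxK unitaryC. Qed.

Lemma normal_spectral n (A : 'M[C]_n) : A *m adjmx A = adjmx A *m A ->
  exists U D, unitary U /\ A = adjmx U *m diag_mx D *m U.
Proof.
rewrite !adjmxE => AA; have /orthomx_spectralP AE : A \is normalmx by apply/normalmxP.
have /unitarymxP UU := spectral_unitarymx A.
exists (spectralmx A), (spectral_diag A); split.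
  by rewrite /unitary adjmxE mulmx1C.
by rewrite {1}AE adjmxE invmx_unitary// spectral_unitarymx.
Qed.

Lemma hermitian_spectral n (A : 'M[C]_n) : adjmx A = A ->
  exists U e, unitary U /\ A = adjmx U *m rdiag e *m U.
Proof.
move=> AJ; have [|U [D [UU AE]]] := @normal_spectral n A; first by rewrite AJ.
exists U, (fun i => complex.Re (D 0 i)); split => //.
have DE : diag_mx D = U *m A *m adjmx U.
  by rewrite AE !mulmxA unitaryC// mul1mx -mulmxA unitaryC// mulmx1.
have DJ : adjmx (diag_mx D) = diag_mx D by rewrite DE !adjmxM adjmxK AJ mulmxA.
rewrite AE; congr (_ *m _ *m _); rewrite /rdiag; congr diag_mx; apply/rowP => i.
rewrite mxE; have := congr1 (fun M : 'M[C]_n => complex.Im (M i i)) DJ.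
rewrite !mxE eqxx !mulr1n cImJ => h.
by apply: complex_eq => //=; lra.
Qed.

(** The entry is the squared norm of column [i]; if it were 0, the column would vanish and [g] would
    be singular. *)
Lemma gram_diag_gt0 n (g : 'M[C]_n) i : g \in unitmx ->
  0 < complex.Re ((adjmx g *m g) i i).
Proof.
move=> gu; rewrite mxE cRe_sum.
under eq_bigr do rewrite mxE mulJc /=.
rewrite lt_neqAle sumr_ge0 ?andbT => [|k _]; last exact: nsq_ge0.
rewrite eq_sym; apply/negP => /eqP/psumr_eq0P g0.
have gc : g *m delta_mx i (0 : 'I_1) = 0.
  apply/matrixP => k j; rewrite -colE !mxE.
  by apply/eqP; rewrite -nsq_eq0; apply/eqP; apply: g0 => // l _; exact: nsq_ge0.
have := congr1 (mulmx (invmx g)) gc; rewrite mulmxA mulVmx// mul1mx mulmx0.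
by move=> /matrixP/(_ i 0); rewrite !mxE !eqxx => /eqP; rewrite oner_eq0.
Qed.

(** Diagonalising [adjmx g *m g] by [U] makes the columns of [k = g *m adjmx U] orthogonal; dividing
    them by their norms [e i] gives the unitary left factor. *)
Lemma singular_values n (g : 'M[C]_n) : g \in unitmx ->
  exists V e U, [/\ unitary V, forall i, 0 < e i, unitary U & g = V *m rdiag e *m U].
Proof.
move=> gu; have [|U [d [UU HE]]] := @hermitian_spectral n (adjmx g *m g).
  by rewrite adjmxM adjmxK.
pose k := g *m adjmx U.
have ku : k \in unitmx by rewrite unitmx_mul gu adjmx_unit unitary_unit.
have kk : adjmx k *m k = rdiag d.
  rewrite /k adjmxM adjmxK mulmxA -(mulmxA U) HE !mulmxA unitaryC// mul1mx.
  by rewrite -mulmxA unitaryC// mulmx1.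
have d0 i : 0 < d i.
  by have := gram_diag_gt0 i ku; rewrite kk rdiagE eqxx.
pose e i := Num.sqrt (d i).
have e0 i : 0 < e i by rewrite sqrtr_gt0.
have ee i : e i * e i = d i by rewrite -expr2 sqr_sqrtr// ltW.
pose V := k *m rdiag (fun i => (e i)^-1).
exists V, e, U; split => //.
  rewrite /unitary /V adjmxM rdiag_adj mulmxA -(mulmxA (rdiag _)) kk !rdiagM -rdiag1.
  by congr rdiag; apply/funext => i; rewrite -ee; field; rewrite gt_eqF.
rewrite /V -(mulmxA k) rdiagM (_ : rdiag _ = 1%:M) ?mulmx1.
  by rewrite /k -mulmxA UU mulmx1.
by rewrite -rdiag1; congr rdiag; apply/funext => i; rewrite mulVf// gt_eqF.
Qed.

Lemma nsq_det_unitary n (U : 'M[C]_n) : unitary U -> nsq (\det U) = 1.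
Proof.
move=> /(congr1 determinant); rewrite det_mulmx det_adjmx det1 mulJc.
by move=> [].
Qed.

(* Singular values reduce a multiplicative function of an invertible matrix to
   its values on unitary and on positive diagonal matrices. *)
Lemma multiplicative_nsq_det n m (rho : 'M[C]_n -> R) :
  (forall g h, g \in unitmx -> h \in unitmx -> rho (g *m h) = rho g * rho h) ->
  (forall U, unitary U -> rho U = 1) ->
  (forall e : 'I_n -> R, (forall i, 0 < e i) -> rho (rdiag e) = (\prod_i e i) ^- (m * 2)) ->
  forall g, g \in unitmx -> rho g = (nsq (\det g)) ^- m.
Proof.
move=> rhoM rhoU rhoD g /singular_values[V [e [U [VV e0 UU ->]]]].
have eu : rdiag e \in unitmx.
  rewrite unitmxE det_rdiag unitfE fmorph_eq0 gt_eqF//.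
  by apply: prodr_gt0 => i _; exact: e0.
rewrite !rhoM ?unitmx_mul ?eu ?unitary_unit//.
rewrite (rhoU V)// (rhoU U)// mul1r mulr1 rhoD//.
rewrite !det_mulmx !nsqM (nsq_det_unitary VV) (nsq_det_unitary UU) mul1r mulr1 det_rdiag nsq_real.
by rewrite -exprM mulnC.
Qed.

End spectral.

(** * Scaling factors of left and right multiplication and of congruence *)

Section actions.
Variables (R : realType) (N : nat).
Local Notation C := R[i].
Local Notation X := ((N * N + N * N).-tuple R).
Local Notation H := ((N * N).-tuple R).

Definition onX (l : 'M[C]_N -> 'M[C]_N) (x : X) : X := cvec (l (cmat x)).

Lemma cmat_onX l x : cmat (onX l x) = l (cmat x).
Proof. exact: cvecK. Qed.

Lemma lin_iso_onX (l l' : 'M[C]_N -> 'M[C]_N) :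
  mxmeas (fun x => l (cmat x)) -> mxmeas (fun x => l' (cmat x)) ->
  {morph l : A B / A + B} -> cancel l l' -> cancel l' l ->
  lin_iso (onX l) (onX l').
Proof.
move=> ml ml' lD lK lK'; split.
- exact: measurable_cvec.
- exact: measurable_cvec.
- by move=> x y; rewrite /onX cmatD lD cvecD.
- by move=> x; rewrite /onX cvecK lK cmatK.
- by move=> x; rewrite /onX cvecK lK' cmatK.
Qed.

Lemma mxmeas_cmat_id : mxmeas (fun x : X => cmat x).
Proof. by apply: mxmeas_cmat. Qed.

Lemma mxmeas_hermmat_id : mxmeas (fun x : H => hermmat x).
Proof. by apply: mxmeas_hermmat. Qed.

Definition Lact (g : 'M[C]_N) : X -> X := onX (mulmx g).
Definition Ract (g : 'M[C]_N) : X -> X := onX (mulmx^~ g).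
Definition Hact (g : 'M[C]_N) (x : H) : H := hvec (adjmx g *m hermmat x *m g).

Lemma cmat_Lact g x : cmat (Lact g x) = g *m cmat x.
Proof. exact: cmat_onX. Qed.

Lemma cmat_Ract g x : cmat (Ract g x) = cmat x *m g.
Proof. exact: (cmat_onX (mulmx^~ g)). Qed.

Lemma hermmat_Hact g x : hermmat (Hact g x) = adjmx g *m hermmat x *m g.
Proof. by rewrite hvecK// !adjmxM adjmxK hermmat_adj mulmxA. Qed.

Lemma lin_iso_Lact g : g \in unitmx -> lin_iso (Lact g) (Lact (invmx g)).
Proof.
move=> gu; apply: lin_iso_onX.
- by apply: mxmeasM; [exact: mxmeas_cst|exact: mxmeas_cmat_id].
- by apply: mxmeasM; [exact: mxmeas_cst|exact: mxmeas_cmat_id].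
- by move=> A B; rewrite mulmxDr.
- by move=> A; rewrite mulKmx.
- by move=> A; rewrite mulKVmx.
Qed.

Lemma lin_iso_Ract g : g \in unitmx -> lin_iso (Ract g) (Ract (invmx g)).
Proof.
move=> gu; apply: lin_iso_onX.
- by apply: mxmeasM; [exact: mxmeas_cmat_id|exact: mxmeas_cst].
- by apply: mxmeasM; [exact: mxmeas_cmat_id|exact: mxmeas_cst].
- by move=> A B; rewrite mulmxDl.
- by move=> A; rewrite mulmxK.
- by move=> A; rewrite mulmxKV.
Qed.

Lemma measurable_Hact d (T : measurableType d) (g : T -> 'M[C]_N) (x : T -> H) :
  mxmeas g -> measurable_fun setT x -> measurable_fun setT (fun t => Hact (g t) (x t)).
Proof.
move=> mg mx; apply: measurable_hvec; apply: mxmeasM => //; apply: mxmeasM.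
  exact: mxmeas_adj.
exact: mxmeas_hermmat.
Qed.

Lemma lin_iso_Hact g : g \in unitmx -> lin_iso (Hact g) (Hact (invmx g)).
Proof.
move=> gu; have K g' h' : g' *m h' = 1%:M -> cancel (Hact g') (Hact h').
  move=> gh x; rewrite /Hact hermmat_Hact !mulmxA -adjmxM gh adjmx1 mul1mx.
  by rewrite -mulmxA gh mulmx1 hermmatK.
split.
- by apply: measurable_Hact; [exact: mxmeas_cst|].
- by apply: measurable_Hact; [exact: mxmeas_cst|].
- by move=> x y; rewrite /Hact hermmatD mulmxDr mulmxDl hvecD.
- by apply: K; rewrite mulmxV.
- by apply: K; rewrite mulVmx.
Qed.

Lemma sum_cvec_sqr (M : 'M[C]_N) :
  \sum_k tnth (cvec M) k ^+ 2 = \sum_i \sum_j nsq (M i j).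
Proof.
rewrite big_split_ord /= -big_split /=.
rewrite (reindex _ (curry_mxvec_bij _ _)) /= pair_bigA /=.
by apply: eq_bigr => -[i j] _ /=; rewrite tnth_cvec_l tnth_cvec_r.
Qed.

Lemma tr_adjM (M : 'M[C]_N) : \tr (adjmx M *m M) = (\sum_i \sum_j nsq (M i j))%:C%C.
Proof.
rewrite /mxtrace exchange_big/= rmorph_sum; apply: eq_bigr => j _.
rewrite mxE rmorph_sum; apply: eq_bigr => i _.
by rewrite mxE mulJc.
Qed.

Lemma sum_sqr_cmat (x : X) :
  \sum_k tnth x k ^+ 2 = complex.Re (\tr (adjmx (cmat x) *m cmat x)).
Proof. by rewrite tr_adjM /= -sum_cvec_sqr cmatK. Qed.

(* weights of the coordinates in the quadratic form Tr A^2 on Hermitian matrices *)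
Definition hweight (k : 'I_(N * N)) : R :=
  mxvec (\matrix_(i < N, j < N) if i == j then 1 else 2) 0 k.

Lemma hweightE i j : hweight (mxvec_index i j) = if i == j then 1 else 2.
Proof. by rewrite /hweight mxvecE mxE. Qed.

Lemma hweight_ge1 k : 1 <= hweight k.
Proof. by case/mxvec_indexP: k => i j; rewrite hweightE; case: ifP => // _; lra. Qed.

Lemma tr_adj (M : 'M[C]_N) : \tr (adjmx M) = (\tr M)^*%C.
Proof. by rewrite /mxtrace rmorph_sum; apply: eq_bigr => i _; rewrite mxE. Qed.

Lemma tr_hermmatM (x y : H) :
  \tr (hermmat x *m hermmat y) = (\sum_k hweight k * (tnth x k * tnth y k))%:C%C.
Proof.
apply: complex_eq; last first.
  have := tr_adj (hermmat x *m hermmat y).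
  rewrite adjmxM !hermmat_adj mxtrace_mulC => /(congr1 (@complex.Im R)).
  by rewrite cImJ /= => h; lra.
rewrite cRe_sum /=.
pose t (z : H) i j := tnth z (mxvec_index i j).
(* The coordinates at [(i, j)] and [(j, i)] are the real and imaginary part of one entry, so the
   real part of each term of the trace is [s i j + s j i]; the half on the diagonal compensates for
   the repetition there. *)
pose s (i j : 'I_N) : R := (if i == j then 2^-1 else 1) * (t x i j * t y i j).
transitivity (\sum_i \sum_j (s i j + s j i)).
  apply: eq_bigr => i _; rewrite mxE cRe_sum; apply: eq_bigr => j _.
  rewrite cReM !mxE /s /t eq_sym.
  have [->|nij] := eqVneq j i; first by rewrite /= mulr0 subr0 -mulrDl; field.
  case: (ltngtP i j) => [ij|ji|/val_inj eij] /=; try by ring.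
  by rewrite eij eqxx in nij.
have -> : \sum_i \sum_j (s i j + s j i) = \sum_i \sum_j s i j + \sum_i \sum_j s j i.
  by rewrite -big_split; apply: eq_bigr => i _; rewrite -big_split.
rewrite [X in _ + X]exchange_big /= -mulr2n -mulr_natr.
rewrite [RHS](reindex _ (curry_mxvec_bij _ _)) /= pair_bigA /= big_distrl /=.
apply: eq_bigr => -[i j] _ /=; rewrite hweightE /s /t /=.
by case: ifP => _; field.
Qed.

(** For a diagonal matrix, [e i] multiplies the $2N$ real coordinates of row [i], while [nsq] of the
    determinant is $\prod_i e_i^2$; hence the exponent $N$. *)
Lemma lscale_Lact g : g \in unitmx -> lscale (Lact g) = (nsq (\det g)) ^- N.
Proof.
move: g; apply: (@multiplicative_nsq_det R N N (fun g => lscale (Lact g))) => [h k hu ku|U UU|e e0].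
- rewrite -(lscale_comp (lin_iso_Lact hu) (lin_iso_Lact ku)); congr lscale.
  by apply/funext => x /=; rewrite /Lact /onX cvecK mulmxA.
- apply: (lscale_gauss_invariant (w := fun=> 1) (lin_iso_Lact (unitary_unit UU))) => // x.
  under eq_bigr do rewrite mul1r; under [RHS]eq_bigr do rewrite mul1r.
  by rewrite !sum_sqr_cmat cmat_Lact adjmxM -mulmxA (mulmxA _ U) UU mul1mx.
- pose t (k : 'I_(N * N + N * N)) : R := match fintype.split k with
    | inl k1 => mxvec (\matrix_(i < N, j < N) e i) 0 k1
    | inr k2 => mxvec (\matrix_(i < N, j < N) e i) 0 k2 end.
  have tl i j : t (lshift _ (mxvec_index i j)) = e i.
    by rewrite /t (unsplitK (inl _ _)) mxvecE mxE.
  have tr i j : t (rshift _ (mxvec_index i j)) = e i.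
    by rewrite /t (unsplitK (inr _ _)) mxvecE mxE.
  have -> : Lact (rdiag e) = tscale t.
    apply/funext => x; apply: (can_inj (@cmatK R N)); rewrite cmat_Lact.
    apply/matrixP => i j; rewrite mul_diag_mx !mxE !tnth_mktuple tl tr.
    by apply: complex_eq; rewrite !cReImE /=; ring.
  rewrite lscale_tscale => [|k]; last first.
    rewrite /t; case: (fintype.split k) => k'; case/mxvec_indexP: k' => i j;
    by rewrite mxvecE mxE.
  rewrite big_split_ord /= -big_split /= (reindex _ (curry_mxvec_bij _ _)) /=.
  transitivity (\prod_(p : 'I_N * 'I_N) (e p.1)^-1 ^+ 2).
    by apply: eq_bigr => -[i j] _; rewrite /= tl tr -expr2.
  rewrite -(pair_bigA _ (fun i _ => (e i)^-1 ^+ 2))/=.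
  under eq_bigr do rewrite prodr_const card_ord -exprM exprVn mulnC.
  by rewrite prodfV prodrXl.
Qed.

Lemma lscale_Ract g : g \in unitmx -> lscale (Ract g) = (nsq (\det g)) ^- N.
Proof.
move: g; apply: (@multiplicative_nsq_det R N N (fun g => lscale (Ract g))) => [h k hu ku|U UU|e e0].
- rewrite mulrC -(lscale_comp (lin_iso_Ract ku) (lin_iso_Ract hu)); congr lscale.
  by apply/funext => x /=; rewrite /Ract /onX cvecK mulmxA.
- apply: (lscale_gauss_invariant (w := fun=> 1) (lin_iso_Ract (unitary_unit UU))) => // x.
  under eq_bigr do rewrite mul1r; under [RHS]eq_bigr do rewrite mul1r.
  rewrite !sum_sqr_cmat cmat_Ract adjmxM mxtrace_mulC !mulmxA -(mulmxA _ U) unitaryC//.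
  by rewrite mulmx1 mxtrace_mulC.
- pose t (k : 'I_(N * N + N * N)) : R := match fintype.split k with
    | inl k1 => mxvec (\matrix_(i < N, j < N) e j) 0 k1
    | inr k2 => mxvec (\matrix_(i < N, j < N) e j) 0 k2 end.
  have tl i j : t (lshift _ (mxvec_index i j)) = e j.
    by rewrite /t (unsplitK (inl _ _)) mxvecE mxE.
  have tr i j : t (rshift _ (mxvec_index i j)) = e j.
    by rewrite /t (unsplitK (inr _ _)) mxvecE mxE.
  have -> : Ract (rdiag e) = tscale t.
    apply/funext => x; apply: (can_inj (@cmatK R N)); rewrite cmat_Ract.
    apply/matrixP => i j; rewrite mul_mx_diag !mxE !tnth_mktuple tl tr.
    by apply: complex_eq; rewrite !cReImE /=; ring.
  rewrite lscale_tscale => [|k]; last first.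
    rewrite /t; case: (fintype.split k) => k'; case/mxvec_indexP: k' => i j;
    by rewrite mxvecE mxE.
  rewrite big_split_ord /= -big_split /= (reindex _ (curry_mxvec_bij _ _)) /=.
  transitivity (\prod_(p : 'I_N * 'I_N) (e p.2)^-1 ^+ 2).
    by apply: eq_bigr => -[i j] _; rewrite /= tl tr -expr2.
  rewrite -(pair_bigA _ (fun _ j => (e j)^-1 ^+ 2))/= exchange_big /=.
  under eq_bigr do rewrite prodr_const card_ord -exprM exprVn mulnC.
  by rewrite prodfV prodrXl.
Qed.

(** The coordinate [(i, j)] is multiplied by [e i * e j], and the product over all pairs is again
    $\prod_i e_i^{2N}$. This agreement with left multiplication is why [gram] carries Lebesgue
    measure to a constant multiple of Lebesgue measure on the cone. *)
Lemma lscale_Hact g : g \in unitmx -> lscale (Hact g) = (nsq (\det g)) ^- N.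
Proof.
move: g; apply: (@multiplicative_nsq_det R N N (fun g => lscale (Hact g))) => [h k hu ku|U UU|e e0].
- rewrite mulrC -(lscale_comp (lin_iso_Hact ku) (lin_iso_Hact hu)); congr lscale.
  by apply/funext => x /=; rewrite /Hact hermmat_Hact adjmxM !mulmxA.
- apply: (lscale_gauss_invariant (w := hweight) (lin_iso_Hact (unitary_unit UU))) => [|x].
    exact: hweight_ge1.
  have E z : (\sum_k hweight k * tnth z k ^+ 2) = complex.Re (\tr (hermmat z *m hermmat z)).
    by rewrite tr_hermmatM.
  rewrite !E hermmat_Hact !mulmxA -(mulmxA _ U) unitaryC// mulmx1.
  by rewrite mxtrace_mulC !mulmxA unitaryC// mul1mx.
- pose t (k : 'I_(N * N)) : R := mxvec (\matrix_(i < N, j < N) (e i * e j)) 0 k.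
  have tE i j : t (mxvec_index i j) = e i * e j by rewrite /t mxvecE mxE.
  have -> : Hact (rdiag e) = tscale t.
    apply/funext => x; apply: (can_inj (@hermmatK R N)); rewrite hermmat_Hact rdiag_adj.
    apply/matrixP => i j; rewrite mul_mx_diag mxE mul_diag_mx !mxE /= !tnth_mktuple !tE.
    case: ifP => [/eqP ->|_]; first by apply: complex_eq; rewrite !cReImE /=; ring.
    by case: ifP => _; apply: complex_eq; rewrite !cReImE /=; ring.
  rewrite lscale_tscale => [|k]; last first.
    by case/mxvec_indexP: k => i j; rewrite tE mulr_gt0.
  rewrite (reindex _ (curry_mxvec_bij _ _)) /=.
  transitivity (\prod_(p : 'I_N * 'I_N) ((e p.1)^-1 * (e p.2)^-1)).
    by apply: eq_bigr => -[i j] _; rewrite /= tE invfM.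
  rewrite -(pair_bigA _ (fun i j => (e i)^-1 * (e j)^-1))/=.
  under eq_bigr => i _ do rewrite big_split /= prodr_const card_ord.
  rewrite big_split /= prodr_const card_ord prodrXl -expr2.
  by rewrite prodfV -exprM exprVn.
Qed.

End actions.

(** * Cholesky factorization *)

Lemma measurable_inv d (T : measurableType d) (R : realType) (f : T -> R) :
  measurable_fun setT f -> measurable_fun setT (fun x => (f x)^-1).
Proof.
(* Writing $x^{-1}=x\,(x^2)^{-1}$ puts a nonnegative base under the real power; at $x=0$ both sides
   are 0. *)
move=> mf; have -> : (fun x => (f x)^-1) = (fun x => f x * ((f x ^+ 2) `^ (-1))).
  apply/funext => x; rewrite powR_inv1 ?sqr_ge0//.
  have [->|fx0] := eqVneq (f x) 0; first by rewrite invr0 mul0r.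
  by rewrite expr2 invfM mulrA mulfV// mul1r.
apply: measurable_funM => //; apply: (measurableT_comp (measurable_powR _)).
exact: measurable_funX.
Qed.

Section cholesky.
Variable R : realType.
Local Notation C := R[i].
Local Open Scope sesquilinear_scope.

(** Block recursion on the Schur complement, giving an upper triangular factor. The formula is total
    and explicit in the entries, hence measurable on all matrices; it is a factorisation on positive
    definite ones. *)
Fixpoint chol n : 'M[C]_n -> 'M[C]_n :=
  match n return 'M[C]_n -> 'M[C]_n with
  | 0 => id
  | n'.+1 => fun A : 'M[C]_(1 + n') =>
    let a := complex.Re (A 0 0) in
    let b := ursubmx A in
    block_mx (Num.sqrt a)%:C%C%:M ((Num.sqrt a)^-1%:C%C *: b)
      0 (chol (drsubmx A - a^-1%:C%C *: (b^t* *m b)))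
  end.

Definition posdef n (A : 'M[C]_n) := A^t* = A /\
  forall v : 'cV[C]_n, v != 0 -> 0 < complex.Re ((v^t* *m A *m v) 0 0).

Lemma posdef_00 n (A : 'M[C]_(1 + n)) : posdef A ->
  ulsubmx A = (complex.Re (A 0 0))%:C%C%:M /\ 0 < complex.Re (A 0 0).
Proof.
move=> [AJ Apos]; split.
  apply/matrixP => i j; rewrite !ord1 !mxE eqxx mulr1n lshift0.
  apply: complex_eq => //=; have := congr1 (fun M : 'M[C]_(1 + n) => complex.Im (M 0 0)) AJ.
  by rewrite !mxE cImJ => h; lra.
have := Apos (delta_mx 0 0); rewrite (_ : _ != 0 = true).
  move=> /(_ isT); rewrite (_ : (_ *m _) = (A 0 0)%:M) ?mxE//.
  apply/matrixP => i j; rewrite !ord1.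
  rewrite -mulmxA -colE !mxE (bigD1 0)//= big1 => [|k k0]; rewrite !mxE ?eqxx /=.
    by rewrite rmorph1 mul1r addr0.
  by rewrite (negbTE k0) rmorph0 mul0r.
by apply/eqP => /matrixP/(_ 0 0)/eqP; rewrite !mxE !eqxx oner_eq0.
Qed.

(** Completing [w] by $x=-a^{-1}bw$ annihilates the first row of $A(x,w)$, so the form of $A$ at
    $(x,w)$ is the form of the Schur complement at $w$. *)
Lemma posdef_schur n (A : 'M[C]_(1 + n)) : posdef A ->
  posdef (drsubmx A - (complex.Re (A 0 0))^-1%:C%C *: ((ursubmx A)^t* *m ursubmx A)).
Proof.
move=> Apd; have [ulE a0] := posdef_00 Apd; case: Apd => AJ Apos.
set a := complex.Re (A 0 0) in ulE a0 *; set b := ursubmx A; set D := drsubmx A.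
have AE : A = block_mx a%:C%C%:M b (b^t*) D.
  rewrite -[LHS]submxK ulE; congr block_mx.
  by rewrite /b -{1}AJ -map_dlsubmx -trmx_ursub.
have DJ : D^t* = D by rewrite /D trmx_drsub map_drsubmx AJ.
split.
  rewrite linearB /= map_mxB DJ linearZ /= map_mxZ trmx_mul map_mxM trmxCK.
  congr (_ - _ *: _); exact: conjc_real.
move=> w w0; pose x : 'cV[C]_1 := - (a^-1%:C%C *: (b *m w)).
have := Apos (col_mx x w).
have aa : a%:C%C * a^-1%:C%C = 1 :> C by rewrite -rmorphM mulfV ?gt_eqF.
have ax : a%:C%C%:M *m x + b *m w = 0.
  by rewrite mul_scalar_mx /x scalerN scalerA aa scale1r addNr.
rewrite {1}AE tr_col_mx map_row_mx -mulmxA mul_block_col ax mul_row_col mulmx0 add0r.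
have -> : b^t* *m x + D *m w = (D - a^-1%:C%C *: (b^t* *m b)) *m w.
  by rewrite mulmxBl -scalemxAl -mulmxA /x mulmxN -scalemxAr addrC.
rewrite mulmxA; apply; apply: contra w0 => /eqP xw0.
by apply/eqP/matrixP => i j; have := congr1 dsubmx xw0; rewrite col_mxKd => ->; rewrite !mxE.
Qed.

Lemma cholK n (A : 'M[C]_n) : posdef A -> adjmx (chol A) *m chol A = A.
Proof.
elim: n A => [|n IH] A Apd; first by rewrite [LHS]flatmx0 [RHS]flatmx0.
move: A Apd; rewrite -[n.+1]/(1 + n)%N => A Apd.
have [ulE a0] := posdef_00 Apd; have Spd := posdef_schur Apd; have {}IH := IH _ Spd.
have [AJ _] := Apd.
rewrite adjmxE in IH; rewrite /= (@adjmxE R (1 + n)).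
set S := drsubmx A - _ in IH *.
set s := Num.sqrt (complex.Re (A 0 0)).
have s0 : 0 < s by rewrite sqrtr_gt0.
have ss : s * s = complex.Re (A 0 0) by rewrite -expr2 sqr_sqrtr// ltW.
have sJ : (s%:C%C%:M : 'M[C]_1)^t* = s%:C%C%:M.
  by rewrite tr_scalar_mx map_scalar_mx; congr _%:M; exact: conjc_real.
rewrite tr_block_mx map_block_mx mulmx_block sJ trmx0 map_mx0 !mul0mx !mulmx0 !addr0.
have -> : (s^-1%:C%C *: ursubmx A)^t* = s^-1%:C%C *: (ursubmx A)^t*.
  apply/matrixP => i j; rewrite !mxE rmorphM; congr (_ * _); exact: conjc_real.
have sV : s%:C%C * s^-1%:C%C = 1 :> C by rewrite -rmorphM mulfV ?gt_eqF.
rewrite !mul_scalar_mx mul_mx_scalar !scalerA sV !scale1r -scalemxAl -scalemxAr.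
rewrite scalerA scale_scalar_mx -!rmorphM -invfM ss IH.
rewrite -[RHS]submxK -ulE; congr block_mx; last by rewrite addrC subrK.
by rewrite trmx_ursub map_dlsubmx AJ.
Qed.

Lemma posdef_gram n (M : 'M[C]_n) : M \in unitmx -> posdef (adjmx M *m M).
Proof.
move=> Mu; split; first by rewrite -adjmxE adjmxM adjmxK.
move=> v v0; rewrite adjmxE mulmxA -mulmxA.
have -> : v^t* *m M^t* = (M *m v)^t* by rewrite trmx_mul map_mxM.
rewrite mxE cRe_sum lt_neqAle; apply/andP; split; last first.
  by apply: sumr_ge0 => i _; rewrite !mxE mulJc/= nsq_ge0.
rewrite eq_sym; apply/negP => /eqP/psumr_eq0P h.
have Mv : M *m v = 0.
  apply/matrixP => i j; rewrite ord1 [RHS]mxE; apply/eqP; rewrite -nsq_eq0; apply/eqP.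
  have : complex.Re ((((M *m v) ^t*) 0 i) * ((M *m v) i 0)) = 0.
    by apply: h => // k _; rewrite !mxE mulJc/= nsq_ge0.
  by rewrite !mxE mulJc.
by move: v0; rewrite -(mulKmx Mu v) Mv mulmx0 eqxx.
Qed.

Lemma mxmeas_chol d (T : measurableType d) n (f : T -> 'M[C]_n) :
  mxmeas f -> mxmeas (fun x => chol (f x)).
Proof.
elim: n f => [|n IH] f mf //=.
move: f mf; rewrite -[n.+1]/(1 + n)%N => f mf.
have m00 : measurable_fun setT (fun x => complex.Re (f x 0 0)) by have [] := mf 0 0.
have ms : measurable_fun setT (fun x => Num.sqrt (complex.Re (f x 0 0))).
  by apply: measurableT_comp => //; apply: continuous_measurable_fun; exact: sqrt_continuous.
have mb i j : cmeas (fun x => ursubmx (f x) i j) by under eq_fun do rewrite !mxE.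
have mS : mxmeas (fun x => drsubmx (f x) - (complex.Re (f x 0 0))^-1%:C%C *:
    ((ursubmx (f x))^t* *m ursubmx (f x))).
  apply: mxmeasD => [i j|]; first by under eq_fun do rewrite !mxE.
  apply: mxmeasN => i j; under eq_fun do rewrite mxE.
  apply: cmeasM; first by apply: cmeas_real; exact: measurable_inv.
  under eq_fun do rewrite mxE; apply: cmeas_sum => k.
  apply: cmeasM; last exact: mb.
  by under eq_fun do rewrite mxE mxE; exact: (cmeasJ (mb _ _)).
move=> i j; rewrite /block_mx.
case: (@fintype.splitP 1 n i) => i' ii'.
  have -> : i = lshift n i' by apply/val_inj.
  under eq_fun do rewrite col_mxEu.
  case: (@fintype.splitP 1 n j) => j' jj'.
    have -> : j = lshift n j' by apply/val_inj.
    under eq_fun do rewrite row_mxEl mxE.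
    rewrite !ord1 eqxx; under eq_fun do rewrite mulr1n.
    exact: cmeas_real.
  have -> : j = rshift 1 j' by apply/val_inj.
  under eq_fun do rewrite row_mxEr mxE.
  apply: cmeasM; last exact: mb.
  by apply: cmeas_real; exact: measurable_inv.
have -> : i = rshift 1 i' by apply/val_inj.
under eq_fun do rewrite col_mxEd.
case: (@fintype.splitP 1 n j) => j' jj'.
  have -> : j = lshift n j' by apply/val_inj.
  by under eq_fun do rewrite row_mxEl mxE; exact: cmeas_cst.
have -> : j = rshift 1 j' by apply/val_inj.
by under eq_fun do rewrite row_mxEr; exact: (IH _ mS).
Qed.

End cholesky.

(** * The image of Lebesgue measure under M |-> M^* M *)

Lemma ge0_integralZlT d (T : measurableType d) (R : realType)
    (mu : {measure set T -> \bar R}) (k : \bar R) (f : T -> \bar R) :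
  measurable_fun setT f -> (forall x, 0 <= f x)%E -> (0 <= k)%E ->
  (\int[mu]_x (k * f x) = k * \int[mu]_x f x)%E.
Proof. by move=> mf f0 k0; rewrite ge0_integralZl. Qed.

(** * The singular matrices form a null set *)

Section singular_matrices.
Variables (R : realType) (N : nat).
Local Notation C := R[i].
Local Notation X := ((N * N + N * N).-tuple R).
Local Notation lebX := (@lebn R (N * N + N * N)).

(** Such a [t] is an eigenvalue of [- M], hence the real part of a root of its characteristic
    polynomial. *)
Lemma finite_singular_shifts (M : 'M[C]_N) :
  finite_set [set t : R | \det (M + t%:C%C%:M) = 0].
Proof.
have [s sE] := closed_field_poly_normal (char_poly (- M)).
apply: (@sub_finite_set _ _ [set complex.Re z | z in [set` s]]); last first.
  by apply: finite_image; exact: finite_seq.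
move=> t /= Mt; exists t%:C%C => //=.
have : root (char_poly (- M)) t%:C%C.
  rewrite -eigenvalue_root_char; apply/eigenvalueP.
  have : ~~ row_free (M + t%:C%C%:M) by rewrite row_free_unit unitmxE Mt unitr0.
  rewrite -kermx_eq0 => /rowV0Pn[v /sub_kermxP vM v0]; exists v => //.
  by move/eqP: vM; rewrite mulmxDr mul_mx_scalar addr_eq0 => /eqP vM; rewrite mulmxN vM opprK.
rewrite sE (monicP (char_poly_monic _)) scale1r root_prod_XsubC; exact.
Qed.

Definition singular : set X := [set x | \det (cmat x) = 0].

Lemma measurable_singular : measurable singular.
Proof.
have [mr mi] := cmeas_det (@mxmeas_cmat_id R N).
have -> : singular = (fun x : X => complex.Re (\det (cmat x))) @^-1` [set 0] `&`
    (fun x : X => complex.Im (\det (cmat x))) @^-1` [set 0].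
  apply/seteqP; split => x /=; first by rewrite /singular/= => ->.
  by move=> [a b]; apply: complex_eq.
by apply: measurableI; rewrite -[X in measurable X]setTI; [apply: mr|apply: mi] => //;
  exact: measurable_set1.
Qed.

(* A translation argument: each line in the direction of the identity meets the
   singular matrices in a finite set. *)
Lemma lebn_singular : lebX singular = 0%E.
Proof.
have mZ := measurable_singular.
pose e (t : R) : X := cvec t%:C%C%:M.
pose Z x : \bar R := (\1_singular x)%:E.
have mZ' : measurable_fun setT Z by apply/measurable_EFinP; exact: measurable_indic.
have Z0 x : (0 <= Z x)%E by rewrite lee_fin.
pose I t : \bar R := (\1_(`[0, 1]%classic : set R) t)%:E.
have mI : measurable_fun setT I.
  by apply/measurable_EFinP; apply: measurable_indic; exact: measurable_itv.
have I0 t : (0 <= I t)%E by rewrite lee_fin.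
have me : measurable_fun setT e.
  apply: measurable_cvec => i j; under eq_fun do rewrite mxE.
  case: (i == j); last by under eq_fun do rewrite mulr0n; exact: cmeas_cst.
  by under eq_fun do rewrite mulr1n; apply: cmeas_real; exact: measurable_id.
pose F (p : R * X) := (I p.1 * Z (tadd p.2 (e p.1)))%E.
have mF : measurable_fun setT F.
  apply: emeasurable_funM; first exact: (measurableT_comp mI).
  apply: (measurableT_comp mZ'); apply: measurable_tadd => //.
  exact: (measurableT_comp me).
have F0 p : (0 <= F p)%E by exact: mule_ge0.
have -> : lebX singular = (\int[lebX]_x Z x)%E.
  by rewrite integral_indic// setIT.
transitivity (\int[@lebesgue_measure R]_t \int[lebX]_x F (t, x))%E.
  transitivity (\int[@lebesgue_measure R]_t (I t * \int[lebX]_x Z x))%E.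
    rewrite ge0_integralZr//; last exact: integral_ge0.
    by rewrite integral_indic_cc// subr0 mul1e.
  apply: eq_integral => t _.
  have mZt : measurable_fun setT (fun x => Z (tadd x (e t))).
    by apply: (measurableT_comp mZ'); apply: measurable_tadd => //; exact: measurable_cst.
  rewrite -(ge0_integral_tadd (e t) mZ' Z0); apply/esym.
  exact: (ge0_integralZlT lebX mZt (fun=> Z0 _) (I0 t)).
transitivity (\int[lebX]_x \int[@lebesgue_measure R]_t F (t, x))%E.
  exact: (@fubini_tonelli _ _ _ _ _ (@lebesgue_measure R) lebX F mF F0).
rewrite integral0_eq// => x _.
apply/eqP; rewrite eq_le integral_ge0// andbT.
pose S : set R := [set t : R | \det (cmat x + t%:C%C%:M) = 0].
have fS : finite_set S by exact: finite_singular_shifts.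
have mS : measurable S.
  by apply: countable_measurable; [exact: measurable_set1|exact: finite_set_countable].
have S0 : (@lebesgue_measure R S = 0)%E.
  by apply: countable_lebesgue_measure0; exact: finite_set_countable.
apply: (@le_trans _ _ (\int[@lebesgue_measure R]_t (\1_S t)%:E)%E); last first.
  by rewrite integral_indic// setIT; move/eqP: S0; rewrite eq_le => /andP[].
apply: ge0_le_integral => //.
- by apply: (measurableT_comp mF); exact: measurable_pair2.
- by apply/measurable_EFinP; exact: measurable_indic.
- move=> t _; rewrite /F /I /Z /= -EFinM lee_fin !indicE.
  case: (boolP (tadd x (e t) \in singular)) => [|_]; last by rewrite mulr0 ler0n.
  rewrite inE /singular /= cmatD cvecK => h.
  by rewrite (mem_set h : t \in S) mulr1 lern1 leq_b1.
Qed.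

End singular_matrices.

(** * The positive definite cone and the image measure *)

Section gram_pushforward.
Variables (R : realType) (N : nat).
Hypothesis N0 : (0 < N)%N.
Local Notation C := R[i].
Local Notation X := ((N * N + N * N).-tuple R).
Local Notation H := ((N * N).-tuple R).
Local Notation lebX := (@lebn R (N * N + N * N)).
Local Notation lebH := (@lebn R (N * N)).

Definition gram (x : X) : H := hvec (adjmx (cmat x) *m cmat x).

Lemma hermmat_gram x : hermmat (gram x) = adjmx (cmat x) *m cmat x.
Proof. by rewrite hvecK// adjmxM adjmxK. Qed.

Lemma measurable_gram : measurable_fun setT gram.
Proof.
by apply: measurable_hvec; apply: mxmeasM; [apply: mxmeas_adj|]; exact: mxmeas_cmat_id.
Qed.

(** The positive definite matrices, written as conditions on measurable functions so that the cone
    is visibly measurable; the first one says that [chol] is a section there. The usual description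
    is [pdconeP]. *)
Definition pdcone : set H := [set y |
  adjmx (chol (hermmat y)) *m chol (hermmat y) = hermmat y /\ \det (hermmat y) != 0].

Lemma measurable_mx_eq d (T : measurableType d) m n (f g : T -> 'M[C]_(m, n)) :
  mxmeas f -> mxmeas g -> measurable [set x | f x = g x].
Proof.
move=> mf mg; have mfg := mxmeasD mf (mxmeasN mg).
have -> : [set x | f x = g x] = \bigcap_(ij in [set: 'I_m * 'I_n])
    [set x | n1 ((f x - g x) ij.1 ij.2) = 0].
  apply/seteqP; split => x /=.
    by move=> fgx ij _ /=; rewrite fgx subrr mxE n10.
  move=> h; apply/eqP; rewrite -subr_eq0; apply/eqP/matrixP => i j; rewrite [RHS]mxE.
  by apply: n1_eq0; rewrite (h (i, j) I).
apply: fin_bigcap_measurable => // -[i j] _ /=.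
have := measurable_n1 (mfg i j) => mn; rewrite -[X in measurable X]setTI.
exact: (mn measurableT _ (measurable_set1 0)).
Qed.

Lemma measurable_pdcone : measurable pdcone.
Proof.
apply: measurableI.
  apply: measurable_mx_eq; last exact: mxmeas_hermmat_id.
  by apply: mxmeasM; [apply: mxmeas_adj|]; apply: mxmeas_chol; exact: mxmeas_hermmat_id.
rewrite [X in measurable X](_ : _ = ~` [set y | (\det (hermmat y))%:M = 0 :> 'M[C]_1]); last first.
  apply/seteqP; split => y /=; last by move=> h; apply/eqP => d0; apply: h; rewrite d0 raddf0.
  by move=> /eqP d0 h; apply: d0; move/matrixP: h => /(_ 0 0); rewrite !mxE mulr1n.
apply: measurableC; apply: measurable_mx_eq; last exact: mxmeas_cst.
move=> i j; rewrite !ord1; under eq_fun do rewrite mxE eqxx mulr1n.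
exact: (cmeas_det (@mxmeas_hermmat_id R N)).
Qed.

Lemma pdconeP y : pdcone y <-> exists2 s, s \in unitmx & hermmat y = adjmx s *m s.
Proof.
split=> [[yE yu]|[s su yE]].
  exists (chol (hermmat y)) => //; rewrite unitmxE unitfE; apply: contra yu => /eqP d0.
  by rewrite -yE det_mulmx d0 mulr0.
split; rewrite yE; first by rewrite cholK//; exact: posdef_gram.
by rewrite det_mulmx det_adjmx mulJc fmorph_eq0 nsq_eq0 -unitfE -unitmxE.
Qed.

Lemma pdcone_gram x : cmat x \in unitmx -> pdcone (gram x).
Proof. by move=> xu; apply/pdconeP; exists (cmat x) => //; rewrite hermmat_gram. Qed.

Lemma gram_Lact s x : s \in unitmx -> forall y, hermmat y = adjmx s *m s ->
  Hact (cmat x) y = gram (Lact s x).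
Proof. by move=> su y yE; rewrite /Hact /gram cmat_Lact adjmxM yE !mulmxA. Qed.

(** Cramer's formula, whose entries are visibly measurable; it agrees with [invmx] on invertible
    matrices. *)
Definition minv n (M : 'M[C]_n) : 'M[C]_n := (\det M)^-1 *: \adj M.

Lemma minvE n (M : 'M[C]_n) : M \in unitmx -> minv M = invmx M.
Proof. by move=> Mu; rewrite /minv /invmx Mu. Qed.

Lemma cmeasV d (T : measurableType d) (f : T -> C) : cmeas f -> cmeas (fun x => (f x)^-1).
Proof.
move=> mf; have -> : (fun x => (f x)^-1) = (fun x => (f x)^*%C * ((nsq (f x))^-1)%:C%C).
  apply/funext => x; have [->|fx0] := eqVneq (f x) 0.
    by rewrite invr0 rmorph0 mul0r.
  apply: (mulfI fx0); rewrite mulfV// mulrA (mulrC (f x)) mulJc -rmorphM mulfV ?rmorph1//.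
  by rewrite nsq_eq0.
apply: cmeasM; first exact: cmeasJ.
apply: cmeas_real; apply: measurable_inv; case: mf => a b.
by apply: measurable_funD; exact: measurable_funX.
Qed.

Lemma mxmeas_minv d (T : measurableType d) n (f : T -> 'M[C]_n) :
  mxmeas f -> mxmeas (fun x => minv (f x)).
Proof.
move=> mf i j; under eq_fun do rewrite mxE.
apply: cmeasM; first by apply: cmeasV; exact: cmeas_det.
under eq_fun do rewrite mxE /cofactor.
apply: cmeasM; first exact: cmeas_cst.
by apply: cmeas_det => k l; under eq_fun do rewrite !mxE.
Qed.

Lemma ae_unitmx : {ae lebX, forall x, cmat x \in unitmx}.
Proof.
exists (@singular R N); split; [exact: measurable_singular|exact: lebn_singular|].
by move=> x /= /negP; rewrite unitmxE unitfE negbK => /eqP.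
Qed.

(** The trace of the inverse is chosen because congruence by the inverse of $M$ turns it into a
    squared norm of $Ms^{-1}$, for $y=s^* s$: the weight becomes a Gaussian in $M$. *)
Definition hsize (y : H) : R := expR (- complex.Re (\tr (minv (hermmat y)))).
Definition hdet (y : H) : R := complex.Re (\det (hermmat y)).

(* Integrating [pdweight y * f (Hact g y)] over the pairs (y, g) in either order relates
   the integral of [f \o gram] to the integral of [f] over the cone. *)
Definition pdweight (y : H) : \bar R :=
  (\1_pdcone y * (hsize y * (hdet y)^-1 ^+ N))%:E.

Lemma hdet_gram y s : hermmat y = adjmx s *m s -> hdet y = nsq (\det s).
Proof. by move=> yE; rewrite /hdet yE det_mulmx det_adjmx mulJc. Qed.

Lemma pdweight_ge0 y : (0 <= pdweight y)%E.
Proof.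
rewrite lee_fin indicE; have [|_] := boolP (y \in pdcone); last by rewrite mul0r.
rewrite inE => /pdconeP[s su yE]; rewrite mul1r mulr_ge0 ?expR_ge0//.
by rewrite (hdet_gram yE) exprn_ge0// invr_ge0 nsq_ge0.
Qed.

Lemma pdweight_out y : ~ pdcone y -> pdweight y = 0%E.
Proof. by move=> yP; rewrite /pdweight indicE memNset// mul0r. Qed.

Lemma measurable_hdet : measurable_fun setT hdet.
Proof. by have [] := cmeas_det (@mxmeas_hermmat_id R N). Qed.

Lemma measurable_pdweight : measurable_fun setT pdweight.
Proof.
apply/measurable_EFinP; apply: measurable_funM.
  by apply: measurable_indic; exact: measurable_pdcone.
apply: measurable_funM.
  apply: measurableT_comp => //; apply: measurableT_comp => //.
  by have [] := cmeas_tr (mxmeas_minv (@mxmeas_hermmat_id R N)).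
by apply: measurable_funX; apply: measurable_inv; exact: measurable_hdet.
Qed.

Let G := (\int[lebX]_x gaussn (fun=> 1%R) x)%E.

Lemma unitmx_nsq (s : 'M[C]_N) : s \in unitmx -> 0 < nsq (\det s).
Proof. by rewrite unitmxE unitfE -nsq_eq0 lt_def nsq_ge0 andbT. Qed.

Lemma nsqV (z : C) : nsq z^-1 = (nsq z)^-1.
Proof.
have n1 : nsq (1 : C) = 1 by rewrite /nsq/= expr1n expr0n addr0.
have [->|z0] := eqVneq z 0; first by rewrite invr0 /nsq/= expr0n addr0 invr0.
apply: (@mulfI _ (nsq z)); first by rewrite nsq_eq0.
by rewrite -nsqM !mulfV// nsq_eq0.
Qed.

Lemma invmx_gram n (t t' : 'M[C]_n) : t' *m t = 1%:M ->
  invmx (adjmx t *m t) = t' *m adjmx t'.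
Proof.
move=> t't; have [t'u tu] := mulmx1_unit t't.
have zu : adjmx t *m t \in unitmx by rewrite unitmx_mul adjmx_unit tu.
apply: (can_inj (mulKmx zu)); rewrite mulmxV// mulmxA -(mulmxA (adjmx t)).
by rewrite (mulmx1C t't) mulmx1 -adjmxM t't adjmx1.
Qed.

Lemma pdweight_Hact s x y : s \in unitmx -> hermmat y = adjmx s *m s ->
  cmat x \in unitmx -> pdweight (Hact (minv (cmat x)) y) =
  (gaussn (fun=> 1%R) (Ract (invmx s) x) *
   ((nsq (\det (cmat x)) / nsq (\det s)) ^+ N)%:E)%E.
Proof.
move=> su yE xu; rewrite minvE//; set g := cmat x in xu *.
have gV : invmx g \in unitmx by rewrite unitmx_inv.
pose z := Hact (invmx g) y.
have zE : hermmat z = adjmx (s *m invmx g) *m (s *m invmx g).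
  by rewrite hermmat_Hact yE adjmxM !mulmxA.
have tu : s *m invmx g \in unitmx by rewrite unitmx_mul su.
have zpd : pdcone z by apply/pdconeP; exists (s *m invmx g).
have zu : hermmat z \in unitmx by rewrite zE unitmx_mul adjmx_unit tu.
rewrite /pdweight -/z indicE (mem_set zpd : z \in pdcone) mul1r EFinM; congr (_%:E * _%:E)%E.
  rewrite /hsize minvE//; congr (expR (- _)).
  under [RHS]eq_bigr do rewrite mul1r.
  rewrite sum_sqr_cmat cmat_Ract.
  rewrite zE (@invmx_gram _ _ (g *m invmx s)); first by rewrite mxtrace_mulC.
  by rewrite mulmxA mulmxKV// mulmxV.
rewrite (hdet_gram zE) det_mulmx nsqM det_inv nsqV; congr (_ ^+ _).
by rewrite invfM invrK mulrC.
Qed.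

Let c1 := (\int[lebH]_y (pdweight y * ((hdet y)^-1 ^+ N)%:E))%E.

Let ereal_rearrange (a b c : R) (g f : \bar R) : a * b = 1 ->
  (a%:E * ((g * (b%:E * c%:E)) * f) = f * c%:E * g)%E.
Proof.
move=> ab; transitivity ((a%:E * b%:E) * (f * c%:E * g))%E; last by rewrite -EFinM ab mul1e.
rewrite -!muleA; congr (_ * _)%E; rewrite muleCA; congr (_ * _)%E.
by rewrite muleCA muleA [RHS]muleC.
Qed.

Lemma pdcone_Hact g y : g \in unitmx -> pdcone (Hact (invmx g) y) -> pdcone y.
Proof.
move=> gu /pdconeP[s su sE]; apply/pdconeP; exists (s *m g); first by rewrite unitmx_mul su.
rewrite adjmxM mulmxA -(mulmxA _ (adjmx s)) -sE hermmat_Hact !mulmxA -adjmxM.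
by rewrite mulVmx// adjmx1 mul1mx mulmxKV.
Qed.

Lemma ae_integral_unitmx (f g : X -> \bar R) :
  measurable_fun setT f -> measurable_fun setT g ->
  (forall x, 0 <= f x)%E -> (forall x, 0 <= g x)%E ->
  (forall x, cmat x \in unitmx -> f x = g x) ->
  (\int[lebX]_x f x = \int[lebX]_x g x)%E.
Proof.
move=> mf mg f0 g0 fg; apply: ge0_ae_eq_integral => //.
by apply: filterS ae_unitmx => x xu _; exact: fg.
Qed.

(** With $y=s^* s$, congruence of $y$ by $x$ is the Gram matrix of $sx$, so integrating over $x$
    first gives $|\det s|^{-2N}$ times the integral of [f (gram x)]. In the other order, the
    Jacobian $|\det x|^{-2N}$ of the congruence cancels the determinant of $x$ in the weight, and
    the Jacobian of right multiplication by $s^{-1}$ cancels that of $s$; what remains is the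
    Gaussian mass [G] times [f y]. *)
Lemma gram_pushforward_weight (f : H -> \bar R) :
  measurable_fun setT f -> (forall y, 0 <= f y)%E ->
  ((\int[lebX]_x f (gram x)) * c1 = G * \int[lebH]_y ((\1_pdcone y)%:E * f y))%E.
Proof.
move=> mf f0.
have mw := measurable_pdweight; have w0 := pdweight_ge0.
pose Phi (p : H * X) := (pdweight p.1 * f (Hact (cmat p.2) p.1))%E.
pose Psi (p : H * X) := (((nsq (\det (cmat p.2)))^-1 ^+ N)%:E *
  (pdweight (Hact (minv (cmat p.2)) p.1) * f p.1))%E.
have mc2 : mxmeas (fun p : H * X => cmat p.2) by exact: mxmeas_cmat.
have mHc : measurable_fun setT (fun p : H * X => Hact (cmat p.2) p.1).
  exact: measurable_Hact.
have mHv : measurable_fun setT (fun p : H * X => Hact (minv (cmat p.2)) p.1).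
  by apply: measurable_Hact => //; exact: mxmeas_minv.
have mPhi : measurable_fun setT Phi.
  apply: emeasurable_funM; first exact: (measurableT_comp mw measurable_fst).
  exact: (measurableT_comp mf mHc).
have mnd : measurable_fun setT (fun p : H * X => ((nsq (\det (cmat p.2)))^-1 ^+ N)%:E).
  apply/measurable_EFinP; apply: measurable_funX; apply: measurable_inv.
  by have [a b] := cmeas_det mc2; apply: measurable_funD; exact: measurable_funX.
have mPsi : measurable_fun setT Psi.
  apply: emeasurable_funM; first exact: mnd.
  apply: emeasurable_funM; first exact: (measurableT_comp mw mHv).
  exact: (measurableT_comp mf measurable_fst).
have Phi0 p : (0 <= Phi p)%E by exact: mule_ge0.
have nd0 (z : C) : (0 <= ((nsq z)^-1 ^+ N)%:E)%E.
  by rewrite lee_fin exprn_ge0// invr_ge0 nsq_ge0.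
have Psi0 p : (0 <= Psi p)%E by rewrite mule_ge0// mule_ge0.
have wd0 y : (0 <= pdweight y * ((hdet y)^-1 ^+ N)%:E)%E.
  have [/pdconeP[s su yE]|yP] := pselect (pdcone y); last by rewrite (pdweight_out yP) mul0e.
  apply: mule_ge0; first exact: w0.
  by rewrite (hdet_gram yE); exact: nd0.
have mfg : measurable_fun setT (fun x => f (gram x)).
  exact: (measurableT_comp mf measurable_gram).
transitivity (\int[lebH]_y \int[lebX]_x Phi (y, x))%E.
  rewrite muleC /c1 -ge0_integralZr//; last 2 first.
  - apply: emeasurable_funM => //; apply/measurable_EFinP; apply: measurable_funX.
    by apply: measurable_inv; exact: measurable_hdet.
  - exact: integral_ge0.
  apply: eq_integral => y _; rewrite /Phi/=.
  have mfH : measurable_fun setT (fun x => f (Hact (cmat x) y)).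
    have mH : measurable_fun setT (fun x : X => Hact (cmat x) y).
      exact: (measurableT_comp mHc (measurable_pair1 y)).
    exact: (measurableT_comp mf mH).
  rewrite (ge0_integralZlT lebX mfH (fun=> f0 _) (w0 y)).
  rewrite -muleA; have [/pdconeP[s su yE]|yP] := pselect (pdcone y); last first.
    by rewrite (pdweight_out yP) mul0e mul0e.
  congr (_ * _)%E.
  rewrite (hdet_gram yE).
  transitivity (\int[lebX]_x f (gram (Lact s x)))%E; last first.
    apply: eq_integral => x _; exact: (esym (congr1 f (gram_Lact x su yE))).
  have E := ge0_integral_lscale (lin_iso_Lact su) mfg (fun=> f0 _).
  by rewrite (lscale_Lact su) in E; rewrite exprVn; exact: (esym E).
rewrite (fubini_tonelli Phi)//.
(* The substitution in [y] is congruence by the inverse of [cmat x], available for almost every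
   [x]. *)
transitivity (\int[lebX]_x \int[lebH]_y Psi (y, x))%E.
  apply: ae_integral_unitmx.
  - exact: (measurable_fun_fubini_tonelli_G Phi).
  - exact: (measurable_fun_fubini_tonelli_G Psi).
  - by move=> x; exact: integral_ge0.
  - by move=> x; exact: integral_ge0.
  move=> x xu; rewrite /Phi /Psi/= minvE//.
  have mq : measurable_fun setT (fun y => pdweight (Hact (invmx (cmat x)) y) * f y)%E.
    have [_ mHi _ _ _] := lin_iso_Hact xu.
    by apply: emeasurable_funM; [exact: (measurableT_comp mw mHi)|exact: mf].
  have q0 y : (0 <= pdweight (Hact (invmx (cmat x)) y) * f y)%E by exact: mule_ge0.
  rewrite (ge0_integralZlT lebH mq q0 (nd0 _)) exprVn -(lscale_Hact xu).
  rewrite -(ge0_integral_lscale (lin_iso_Hact xu) mq q0).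
  by apply: eq_integral => y _; have [_ _ _ -> _] := lin_iso_Hact xu.
rewrite -(fubini_tonelli Psi)// muleC -ge0_integralZr//; last 3 first.
- apply: emeasurable_funM => //; apply/measurable_EFinP; apply: measurable_indic.
  exact: measurable_pdcone.
- by move=> y _; apply: mule_ge0 => //; rewrite lee_fin.
- by apply: integral_ge0 => x _; rewrite lee_fin expR_ge0.
apply: eq_integral => y _.
have mPy : measurable_fun setT (fun x => Psi (y, x)) by exact: measurableT_comp.
have [yP|yP] := pselect (pdcone y).
  rewrite indicE mem_set// mul1e; have /pdconeP[s su yE] := yP.
  have sV : invmx s \in unitmx by rewrite unitmx_inv.
  have mgs : measurable_fun setT (fun x => gaussn (fun=> 1%R) (Ract (invmx s) x)).
    have [mRs _ _ _ _] := lin_iso_Ract sV.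
    exact: (measurableT_comp (measurable_gaussn (fun=> 1%R)) mRs).
  have gs0 x : (0 <= gaussn (fun=> 1%R) (Ract (invmx s) x))%E by rewrite lee_fin expR_ge0.
  transitivity (\int[lebX]_x (f y * ((nsq (\det s))^-1 ^+ N)%:E *
      gaussn (fun=> 1%R) (Ract (invmx s) x)))%E.
    apply: ae_integral_unitmx => // [|x|x xu].
    - by apply: emeasurable_funM => //; exact: measurable_cst.
    - by rewrite mule_ge0// mule_ge0.
    rewrite /Psi/= (pdweight_Hact su yE xu) exprMn EFinM.
    have xn := unitmx_nsq xu.
    rewrite exprVn; apply: ereal_rearrange; rewrite mulVf// expf_neq0// gt_eqF//.
  rewrite (ge0_integralZlT lebX mgs gs0 (mule_ge0 (f0 y) (nd0 _))).
  rewrite (ge0_integral_lscale (lin_iso_Ract sV) (@measurable_gaussn _ _ _)); last first.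
    by move=> x; rewrite lee_fin expR_ge0.
  rewrite lscale_Ract// det_inv nsqV -/G muleA -(muleA (f y)) -EFinM exprVn invrK mulVf ?mule1//.
  by rewrite expf_neq0// gt_eqF// unitmx_nsq.
rewrite indicE memNset// !mul0e -(integral0 lebX setT).
apply: ae_integral_unitmx => // x xu; rewrite /Psi/= minvE// pdweight_out ?mul0e ?mule0//.
by move=> /(pdcone_Hact xu).
Qed.

(** A multiple of the identity exceeding the sum of the moduli of the eigenvalues makes all of them
    positive; a factor of the shifted matrix is built from their square roots. *)
Lemma pdcone_shift (y : H) : exists m : nat, pdcone (tadd y (hvec m%:R%:C%C%:M)).
Proof.
have [U [e [UU yE]]] := hermitian_spectral (hermmat_adj y).
pose m := Num.truncn (\sum_i `|e i|).
have em i : 0 < e i + m.+1%:R.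
  have h1 : `|e i| <= \sum_i `|e i|.
    by rewrite (bigD1 i)//= lerDl sumr_ge0.
  have h2 : \sum_i `|e i| < m.+1%:R.
    by rewrite -truncn_le_nat ?sumr_ge0// /m.
  have := ler_norm (- e i); rewrite normrN => h3; lra.
exists m.+1; apply/pdconeP.
pose r i := Num.sqrt (e i + m.+1%:R).
exists (rdiag r *m U).
  rewrite unitmx_mul (unitary_unit UU) andbT unitmxE det_rdiag unitfE fmorph_eq0.
  by rewrite gt_eqF// prodr_gt0// => i _; rewrite sqrtr_gt0.
rewrite hermmatD hvecK; last first.
  by rewrite adjmxE tr_scalar_mx map_scalar_mx; congr _%:M; exact: conjc_real.
rewrite yE adjmxM rdiag_adj !mulmxA -(mulmxA (adjmx U) (rdiag r) (rdiag r)) rdiagM.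
have -> : m.+1%:R%:C%C%:M = adjmx U *m m.+1%:R%:C%C%:M *m U :> 'M[C]_N.
  by rewrite mul_mx_scalar -scalemxAl UU scalemx1.
rewrite -mulmxDl -mulmxDr; congr (_ *m _ *m _).
apply/matrixP => i j; rewrite mxE !rdiagE mxE -mulrnDl; congr (_ *+ _).
by rewrite -rmorphD; congr (_%:C)%C; rewrite -expr2 sqr_sqrtr// ltW.
Qed.

(** Countably many translates of the cone cover the whole space; were the cone null, the unit box
    would have integral 0. *)
Lemma lebn_pdcone_gt0 : (0 < lebH pdcone)%E.
Proof.
rewrite lt0e measure_ge0 andbT; apply/eqP => P0.
have mP := measurable_pdcone.
pose S (m : nat) : set H := [set y | pdcone (tadd y (hvec m%:R%:C%C%:M))].
have mS m : measurable (S m).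
  rewrite /S -[X in measurable X]setTI.
  exact: (measurable_tadd (@measurable_id _ _ setT) (measurable_cst _)).
have S0 m : lebH (S m) = 0%E.
  have -> : lebH (S m) = (\int[lebH]_y (\1_pdcone (tadd y (hvec m%:R%:C%C%:M)))%:E)%E.
    by rewrite -[S m]setIT -integral_indic//; apply: eq_integral.
  rewrite (@ge0_integral_tadd _ _ _ (fun y => (\1_pdcone y)%:E))//.
    by rewrite integral_indic// setIT.
  by apply/measurable_EFinP; exact: measurable_indic.
have : lebH.-negligible (\bigcup_m S m).
  apply: negligible_bigcup => m; exists (S m); split; [exact: mS|exact: S0|].
  exact: subset_refl.
have -> : \bigcup_m S m = setT.
  by apply/seteqP; split => // y _; have [m] := pdcone_shift y; exists m.
move/negligibleP => /(_ measurableT) T0.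
have : (\int[lebH]_x @unit_box R (N * N) x = 0)%E.
  apply: null_set_integral => //; first exact: measurable_unit_box.
by rewrite integral_unit_box => /eqP; rewrite onee_eq0.
Qed.

Lemma gram_pushforward : exists2 k : R, 0 < k &
  forall f : H -> \bar R, measurable_fun setT f -> (forall y, 0 <= f y)%E ->
  (\int[lebX]_x f (gram x) = k%:E * \int[lebH]_y ((\1_pdcone y)%:E * f y))%E.
Proof.
pose g := @gaussn R (N * N) (fun=> 1%R).
have mg : measurable_fun setT g by exact: measurable_gaussn.
have g0 y : (0 <= g y)%E by rewrite lee_fin expR_ge0.
have mP : measurable_fun setT (fun y => (\1_pdcone y)%:E : \bar R).
  by apply/measurable_EFinP; apply: measurable_indic; exact: measurable_pdcone.
have mPg : measurable_fun setT (fun y => (\1_pdcone y)%:E * g y)%E by exact: emeasurable_funM.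
have Pg0 y : (0 <= (\1_pdcone y)%:E * g y)%E by rewrite mule_ge0// lee_fin.
have ip : (0 < \int[lebH]_y ((\1_pdcone y)%:E * g y))%E.
  rewrite lt0e integral_ge0// andbT; apply/eqP => i0.
  have : ae_eq lebH setT (fun y => (\1_pdcone y)%:E * g y)%E (cst 0%E).
    apply/ae_eq_integral_abs => //; rewrite -[RHS]i0.
    by apply: eq_integral => y _; rewrite gee0_abs.
  move=> [S [mS S0 sub]]; have := lebn_pdcone_gt0; rewrite lt0e => /andP[/eqP + _]; apply.
  apply/eqP; rewrite -measure_le0 -[X in (_ <= X)%E]S0 le_measure ?inE//.
    exact: measurable_pdcone.
  move=> y yP; apply: sub => /= /(_ I); rewrite indicE mem_set// mul1e => -[].
  by move/eqP; rewrite expR_eq0.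
have il : (\int[lebH]_y ((\1_pdcone y)%:E * g y) < +oo)%E.
  apply: (@le_lt_trans _ _ (\int[lebH]_y g y)%E); last exact: integral_gaussn_lty.
  apply: ge0_le_integral => // y _; rewrite indicE.
  by case: (_ \in _); rewrite ?mul1e ?mul0e.
have G0 : (0 < G)%E by exact: integral_gaussn_gt0.
have Gl : (G < +oo)%E by exact: integral_gaussn_lty.
have fin (x : \bar R) : (0 < x)%E -> (x < +oo)%E -> exists2 r, 0 < r & x = r%:E.
  case: x => [r r0 _|//|//]; by exists r; rewrite -?lte_fin.
have [rG rG0 GE] := fin _ G0 Gl; have [ri ri0 iE] := fin _ ip il.
have c10 : (0 <= c1)%E.
  apply: integral_ge0 => y _.
  have [/pdconeP[s su yE]|yP] := pselect (pdcone y); last by rewrite (pdweight_out yP) mul0e.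
  apply: mule_ge0; first exact: pdweight_ge0.
  by rewrite (hdet_gram yE) lee_fin exprn_ge0// invr_ge0 nsq_ge0.
have E := gram_pushforward_weight mg g0; rewrite GE iE -EFinM in E.
have m0 : (0 <= \int[lebX]_x g (gram x))%E by exact: integral_ge0.
(* [c1] is never computed. The identity tested on a Gaussian has a positive finite right-hand side,
   which excludes the values 0 and [+oo]. *)
have [c c0 cE] : exists2 r, 0 < r & c1 = r%:E.
  apply: fin.
    rewrite lt0e c10 andbT; apply/eqP => c1E; move: E; rewrite c1E mule0 => -[] /esym/eqP.
    by rewrite mulf_eq0 !gt_eqF.
  rewrite ltey; apply/eqP => c1E; move: E; rewrite c1E.
  move: m0; rewrite le_eqVlt => /orP[/eqP <-|m0].
    by rewrite mul0e => -[] /esym/eqP; rewrite mulf_eq0 !gt_eqF.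
  by rewrite gt0_muley.
exists (rG / c); first by rewrite divr_gt0.
move=> f mf f0; have := gram_pushforward_weight mf f0; rewrite cE GE => Ef.
have cc : (c%:E * (c^-1)%:E = 1 :> \bar R)%E by rewrite -EFinM mulfV ?gt_eqF.
by rewrite -[LHS]mule1 -cc muleA Ef muleC muleA -EFinM mulrC.
Qed.

End gram_pushforward.

(** * Laplace transforms and one-dimensional Gaussians *)

Section complex_ae.
Context d (T : measurableType d) (R : realType) (mu : {measure set T -> \bar R}).
Local Notation C := R[i].

Lemma cI_ae (f g : T -> C) : cmeas g -> cintg mu f -> {ae mu, forall x, f x = g x} ->
  cintg mu g /\ cI mu g = cI mu f.
Proof.
move=> [mr mi] [ir ii] fg.
have aer : ae_eq mu setT (fun x => (complex.Re (f x))%:E) (fun x => (complex.Re (g x))%:E).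
  by apply: filterS fg => x /= ->.
have aei : ae_eq mu setT (fun x => (complex.Im (f x))%:E) (fun x => (complex.Im (g x))%:E).
  by apply: filterS fg => x /= ->.
have mr' := (measurable_EFinP _ _).2 mr; have mi' := (measurable_EFinP _ _).2 mi.
have key (u v : T -> \bar R) : measurable_fun setT v -> mu.-integrable setT u ->
    ae_eq mu setT u v -> mu.-integrable setT v.
  move=> mv /integrableP[mu' iu] uv; apply/integrableP; split => //.
  have -> : (\int[mu]_x `|v x| = \int[mu]_x `|u x|)%E; last by [].
  apply: ae_eq_integral => //; try exact: measurableT_comp.
  by apply: filterS uv => x h /h /= ->.
split; first by split; [exact: (key _ _ mr' ir aer)|exact: (key _ _ mi' ii aei)].
case/integrableP: ir => ? _; case/integrableP: ii => ? _.
rewrite /cI; congr Complex; rewrite /Rintegral; congr fine; apply: ae_eq_integral => //.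
  by apply: filterS aer => x h /h.
by apply: filterS aei => x h /h.
Qed.

End complex_ae.

Section distribution_transfer.
Context d d' (T : measurableType d) (T' : measurableType d') (R : realType).
Variables (m : {measure set T -> \bar R}) (m' : {measure set T' -> \bar R}).

Lemma Rintegral_transfer (u : T -> R) (v : T' -> R) (c : R) : 0 <= c ->
  measurable_fun setT v ->
  (forall h : \bar R -> \bar R, measurable_fun setT h -> (forall x, 0 <= h x)%E -> h 0%E = 0%E ->
    \int[m']_x h (v x)%:E = c%:E * \int[m]_x h (u x)%:E)%E ->
  m.-integrable setT (EFin \o u) ->
  m'.-integrable setT (EFin \o v) /\ \int[m']_x v x = c * \int[m]_x u x.
Proof.
move=> c0 mv E iu; have mv' := (measurable_EFinP _ _).2 mv.
have mabs : measurable_fun setT (fun x : \bar R => `|x|)%E by exact: abse_measurable.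
have mp : measurable_fun setT (fun x : \bar R => maxe x 0).
  by apply: measurable_maxe => //; exact: measurable_id.
have mn : measurable_fun setT (fun x : \bar R => maxe (- x) 0)%E.
  by apply: measurable_maxe => //; exact: oppe_measurable.
have iv : m'.-integrable setT (EFin \o v).
  apply/integrableP; split => //.
  rewrite (E _ mabs (fun=> abse_ge0 _) abse0).
  by move/integrableP : iu => [_ ?]; rewrite lte_mul_pinfty.
split => //; rewrite /Rintegral integralE.
have -> : (\int[m']_x (fun x => (v x)%:E)^\+ x = c%:E * \int[m]_x (EFin \o u)^\+ x)%E.
  transitivity (\int[m']_x maxe (v x)%:E 0)%E.
    by apply: eq_integral => x _; rewrite funeposE.
  rewrite (E _ mp) ?maxxx// => [|x]; last by rewrite le_max lexx orbT.
  by congr (_ * _)%E; apply: eq_integral => x _; rewrite funeposE.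
have -> : (\int[m']_x (fun x => (v x)%:E)^\- x = c%:E * \int[m]_x (EFin \o u)^\- x)%E.
  transitivity (\int[m']_x maxe (- (v x)%:E) 0)%E.
    by apply: eq_integral => x _; rewrite funenegE.
  rewrite (E _ mn) ?oppe0 ?maxxx// => [|x]; last by rewrite le_max lexx orbT.
  by congr (_ * _)%E; apply: eq_integral => x _; rewrite funenegE.
have fp := integrable_fin_num measurableT (integrable_funepos measurableT iu).
have fn := integrable_fin_num measurableT (integrable_funeneg measurableT iu).
rewrite fineB ?fin_numM// !fineM// -mulrBr -fineB//; congr (_ * fine _).
by rewrite [RHS]integralE.
Qed.

Lemma cI_transfer_indic (A : set T') (g : T -> T') (f : T' -> R[i]) (c : R) : 0 < c ->
  measurable A ->
  (forall h : T' -> \bar R, measurable_fun setT h -> (forall x, 0 <= h x)%E ->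
    \int[m]_x h (g x) = c%:E * \int[m']_x ((\1_A x)%:E * h x))%E ->
  cmeas f -> cintg m (fun x => f (g x)) ->
  cintg m' (fun y => (\1_A y)%:C%C * f y) /\
  cI m (fun x => f (g x)) = c%:C%C * cI m' (fun y => (\1_A y)%:C%C * f y).
Proof.
move=> c0 mA E [mr mi] [ir ii].
have key (k : T' -> R) : measurable_fun setT k -> m.-integrable setT (EFin \o (fun x => k (g x))) ->
    m'.-integrable setT (EFin \o (fun y => \1_A y * k y)) /\
    \int[m']_y (\1_A y * k y) = c^-1 * \int[m]_x k (g x).
  move=> mk ik; apply: Rintegral_transfer => //.
  - by rewrite invr_ge0 ltW.
  - by apply: measurable_funM => //; exact: measurable_indic.
  - move=> h mh h0 hz.
    have mk' := measurableT_comp mh ((measurable_EFinP _ _).2 mk).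
    rewrite (E _ mk' (fun=> h0 _)) muleA -EFinM mulVf ?gt_eqF// mul1e.
    apply: eq_integral => y _; rewrite indicE; case: (_ \in _); first by rewrite mul1e mul1r.
    by rewrite mul0e mul0r hz.
have [i1 e1] := key _ mr ir; have [i2 e2] := key _ mi ii.
have cr y : complex.Re ((\1_A y)%:C%C * f y) = \1_A y * complex.Re (f y).
  by rewrite !cReImE /= mul0r subr0.
have ci y : complex.Im ((\1_A y)%:C%C * f y) = \1_A y * complex.Im (f y).
  by rewrite !cReImE /= mul0r addr0.
split; first by split; [under eq_fun do rewrite cr|under eq_fun do rewrite ci].
rewrite /cI; apply: complex_eq; rewrite !cReImE /=.
  under [in RHS]eq_Rintegral do rewrite cr.
  by rewrite e1 mul0r subr0 mulrA mulfV ?gt_eqF// mul1r.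
under [X in _ * X + _]eq_Rintegral do rewrite ci.
by rewrite e2 mul0r addr0 mulrA mulfV ?gt_eqF// mul1r.
Qed.

End distribution_transfer.

Section laplace.
Variable R : realType.
Local Notation C := R[i].
Local Notation leb := (@lebesgue_measure R : {sigma_finite_measure set (measurableTypeR R) -> \bar R}).

(* The Borel structure of [R] and the one on which [lebesgue_measure] lives are
   distinct instances with the same measurable sets. *)
Lemma cmeas_leb (f : R -> C) : cmeas f -> @cmeas _ (measurableTypeR R) R f.
Proof. by move=> [a b]; split; [exact: a|exact: b]. Qed.

Lemma FTC_cc (f F : R -> R) (a b : R) : a <= b -> continuous f ->
  (forall x, is_derive x (1 : R) F (f x)) ->
  \int[leb]_x (\1_(`[a, b]%classic : set R) x * f x) = F b - F a.
Proof.
move=> ab cf dF.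
transitivity (\int[leb]_(x in `[a, b]) f x).
  rewrite [RHS]Rintegral_mkcond; apply: eq_Rintegral => x _.
  by rewrite patchE indicE; case: (_ \in _); rewrite ?mul1r ?mul0r.
move: ab; rewrite le_eqVlt => /orP[/eqP <-|ab]; first by rewrite set_itv1 Rintegral_set1 subrr.
have cF x : F x @[x --> x] --> F x.
  by apply: differentiable_continuous; apply/derivable1_diffP; have [] := dF x.
rewrite /Rintegral (@continuous_FTC2 _ f F)//.
- exact: continuous_subspaceT.
- split.
  + by move=> x _; have [] := dF x.
  + by apply: cvg_at_right_filter; exact: cF.
  + by apply: cvg_at_left_filter; exact: cF.
- by move=> x _; rewrite derive1E; have [_ ->] := dF x.
Qed.

(** With [is_derive_damped_sin], the two components of an antiderivative of
    $e^{-(\alpha+i\beta)x}$. *)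
Lemma is_derive_damped_cos (al be x : R) : al ^+ 2 + be ^+ 2 != 0 ->
  is_derive x (1 : R) (fun r => expR (- al * r) * (be * sin (be * r) - al * cos (be * r)) *
    (al ^+ 2 + be ^+ 2)^-1) (expR (- al * x) * cos (be * x)).
Proof.
move=> D0.
apply: is_derive_eq; rewrite /GRing.scale/=; field.
exact: D0.
Qed.

Lemma is_derive_damped_sin (al be x : R) : al ^+ 2 + be ^+ 2 != 0 ->
  is_derive x (1 : R) (fun r => expR (- al * r) * (- al * sin (be * r) - be * cos (be * r)) *
    (al ^+ 2 + be ^+ 2)^-1) (expR (- al * x) * sin (be * x)).
Proof.
move=> D0; apply: is_derive_eq; rewrite /GRing.scale/=; field.
exact: D0.
Qed.

Lemma continuous_scale_comp (g : R -> R) (c : R) : continuous g ->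
  continuous (fun x : R => g (c * x)).
Proof.
move=> cg x; apply: (@continuous_comp _ _ _ ( *%R c) g); last exact: cg.
exact: mulrl_continuous.
Qed.

Lemma n1_cexp (z : C) : n1 (cexp z) <= 2 * expR (complex.Re z).
Proof.
rewrite /n1 /= !normrM !(ger0_norm (expR_ge0 _)) -mulrDr mulrC.
apply: ler_wpM2r; first exact: expR_ge0.
have c1 : `|cos (complex.Im z)| <= 1 by rewrite ler_norml cos_geN1 cos_le1.
have s1 : `|sin (complex.Im z)| <= 1 by rewrite ler_norml sin_geN1 sin_le1.
lra.
Qed.

Lemma cexpD (z w : C) : cexp (z + w) = cexp z * cexp w.
Proof.
apply: complex_eq; rewrite !cReImE /= !cReImE expRD.
  by rewrite cosD; ring.
by rewrite sinD; ring.
Qed.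

Lemma cexp0 : cexp (0 : C) = 1.
Proof. by apply: complex_eq; rewrite /= expR0 ?cos0 ?sin0 ?mulr1 ?mulr0. Qed.

Definition hexp (a : C) (r : R) : C :=
  (\1_(`[0, +oo[%classic : set R) r)%:C%C * cexp (- a * r%:C%C).

Lemma cmeas_hexp a : cmeas (hexp a).
Proof.
apply: cmeas_indic; first exact: measurable_itv.
apply: cmeas_cexp; apply: cmeasM; first exact: cmeas_cst.
by apply: cmeas_real; exact: measurable_id.
Qed.

Lemma n1_hexp (a : C) r : 0 < complex.Re a ->
  n1 (hexp a r) <= 2 / complex.Re a * exponential_pdf (complex.Re a) r.
Proof.
move=> a0; apply: le_trans (n1M _ _) _; rewrite n1_real indicE.
have [r0|r0] := leP 0 r; last first.
  rewrite memNset /= ?in_itv/= ?andbT ?normr0 ?mul0r; last by rewrite leNgt r0.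
  apply: mulr_ge0; last by apply: exponential_pdf_ge0; exact: ltW.
  by apply: divr_ge0 => //; exact: ltW.
rewrite mem_set /= ?in_itv/= ?r0// normr1 mul1r exponential_pdfE//.
apply: le_trans (n1_cexp _) _; rewrite !cReImE /= mulr0 subr0.
rewrite le_eqVlt; apply/orP; left; apply/eqP; rewrite mulNr; field.
by rewrite gt_eqF.
Qed.

Lemma hexp_dominated (a : C) : 0 < complex.Re a ->
  leb.-integrable setT (EFin \o (fun r => 2 / complex.Re a * exponential_pdf (complex.Re a) r)).
Proof.
move=> a0; exact: (integrableZl measurableT _ (integrable_exponential_pdf a0)).
Qed.

Lemma cintg_hexp (a : C) : 0 < complex.Re a -> cintg leb (hexp a).
Proof.
move=> a0.
exact: (cintg_le (cmeas_leb (cmeas_hexp a)) (fun r => n1_hexp r a0) (hexp_dominated a0)).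
Qed.

Lemma expR_decay (al : R) : 0 < al -> expR (- al * m%:R) @[m --> \oo] --> 0.
Proof.
move=> al0; under eq_fun do rewrite mulrC expRM_natl.
apply: cvg_expr; rewrite ger0_norm ?expR_ge0//.
by rewrite -expR0 ltr_expR oppr_lt0.
Qed.

(** The antiderivative evaluates the integral over $[0,m]$; its boundary term at $m$ decays like
    $e^{-m\,\mathrm{Re}\,a}$. *)
Lemma cI_hexp (a : C) : 0 < complex.Re a -> cI leb (hexp a) = a^-1.
Proof.
case: a => al be /= a0.
pose a : C := Complex al be; rewrite -/a.
have D0 : al ^+ 2 + be ^+ 2 != 0.
  by rewrite gt_eqF// ltr_pwDl ?sqr_ge0// exprn_gt0.
pose fm (m : nat) r : C := (\1_(`[0, m%:R]%classic : set R) r)%:C%C * hexp a r.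
have cv : ccvg (fun m => cI leb (fm m)) (cI leb (hexp a)).
  apply: (cI_dominated _ (cmeas_leb (cmeas_hexp a)) (@hexp_dominated a a0)).
  - by move=> m; apply: cmeas_leb; apply: cmeas_indic; [exact: measurable_itv|exact: cmeas_hexp].
  - apply: aeW => r; have [r0|r0] := leP 0 r; last first.
      have h0 : hexp a r = 0.
        by rewrite /hexp indicE memNset /= ?in_itv/= ?andbT ?mul0r// leNgt r0.
      by rewrite /fm h0; under eq_fun do rewrite mulr0; exact: ccvg_cst.
    apply: (@ccvg_n1 _ _ _ (fun m => if (m%:R < r) then n1 (hexp a r) else 0)).
      move=> m; rewrite /fm indicE; case: ltP => mr.
        by rewrite memNset /= ?in_itv/= ?r0/= ?mul0r ?sub0r ?n1N// leNgt mr.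
      by rewrite mem_set /= ?in_itv/= ?r0//= mul1r subrr n10.
    apply/cvgrPdist_le => e e0; near=> m; rewrite ifF ?subrr ?normr0 ?ltW//.
    by apply/negbTE; rewrite -leNgt; near: m; exact: nbhs_infty_ger.
  - move=> m r; apply: le_trans (@n1_hexp a r a0).
    apply: le_trans (n1M _ _) _; rewrite n1_real indicE.
    by case: (_ \in _); rewrite ?normr1 ?mul1r// normr0 mul0r n1_ge0.
apply: (ccvg_unique cv).
pose Fc r := expR (- al * r) * (be * sin (be * r) - al * cos (be * r)) * (al ^+ 2 + be ^+ 2)^-1.
pose Fs r := expR (- al * r) * (- al * sin (be * r) - be * cos (be * r)) * (al ^+ 2 + be ^+ 2)^-1.
have cexpal : continuous (fun r : R => expR (- al * r)).
  by apply: continuous_scale_comp; exact: continuous_expR.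
have hm m r : fm m r = Complex (\1_(`[0, m%:R]%classic : set R) r * (expR (- al * r) * cos (be * r)))
    (- (\1_(`[0, m%:R]%classic : set R) r * (expR (- al * r) * sin (be * r)))).
  rewrite /fm /hexp !indicE.
  case: (boolP (r \in _)) => [|_]; last by apply: complex_eq; rewrite !cReImE /=; ring.
  rewrite inE /= in_itv/= => /andP[r0 _]; rewrite mem_set /= ?in_itv/= ?r0//.
  have ce : - a * r%:C%C = Complex (- al * r) (- (be * r)).
    by apply: complex_eq; rewrite !cReImE /=; ring.
  by rewrite ce /cexp /= cosN sinN mulrN !mul1r.
have cfc : continuous (fun r : R => expR (- al * r) * cos (be * r)).
  move=> x; apply: (cvgM (cexpal x)).
  exact: (@continuous_scale_comp _ be (@continuous_cos R) x).
have cfs : continuous (fun r : R => expR (- al * r) * sin (be * r)).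
  move=> x; apply: (cvgM (cexpal x)).
  exact: (@continuous_scale_comp _ be (@continuous_sin R) x).
have mfm m : cmeas (fm m).
  by apply: cmeas_indic; [exact: measurable_itv|exact: cmeas_hexp].
have lfm m r : n1 (fm m r) <= n1 (hexp a r).
  apply: le_trans (n1M _ _) _; rewrite n1_real indicE.
  by case: (_ \in _); rewrite ?normr1 ?mul1r// normr0 mul0r n1_ge0.
have ifm m : cintg leb (fm m).
  exact: (cintg_le_n1 (cmeas_leb (mfm m)) (@cintg_hexp a a0) (lfm m)).
have E1 m : cI leb (fm m) = Complex (Fc m%:R - Fc 0) (- (Fs m%:R - Fs 0)).
  rewrite /cI; congr Complex.
    rewrite -(FTC_cc (ler0n R m) cfc (fun x => @is_derive_damped_cos al be x D0)).
    by apply: eq_Rintegral => r _; rewrite hm.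
  rewrite -(FTC_cc (ler0n R m) cfs (fun x => @is_derive_damped_sin al be x D0)).
  rewrite -[RHS]mulN1r.
  transitivity (-1 * \int[leb]_r (-1 * complex.Im (fm m r))).
    by rewrite RintegralZl ?mulN1r ?opprK//; case: (ifm m).
  by congr (_ * _); apply: eq_Rintegral => r _; rewrite hm /= mulN1r opprK.
under eq_fun do rewrite E1.
have bnd (u v : R) (F : nat -> R) : (forall m, `|F m| <= (`|u| + `|v|) / (al ^+ 2 + be ^+ 2) * expR (- al * m%:R)) ->
    F m @[m --> \oo] --> 0.
  move=> hF; have h : (`|u| + `|v|) / (al ^+ 2 + be ^+ 2) * expR (- al * m%:R) @[m --> \oo] --> 0.
    rewrite -[X in _ --> X](mulr0 ((`|u| + `|v|) / (al ^+ 2 + be ^+ 2))).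
    exact: (cvgM (cvg_cst ((`|u| + `|v|) / (al ^+ 2 + be ^+ 2))) (expR_decay a0)).
  apply: (@squeeze_cvgr _ _ _ _
     (fun m => - ((`|u| + `|v|) / (al ^+ 2 + be ^+ 2) * expR (- al * m%:R))) _) (h) => //.
    by apply: nearW => m; rewrite -ler_norml.
  by rewrite -oppr0; exact: (cvgN h).
have trig (u v x : R) : `|u * sin x - v * cos x| <= `|u| + `|v|.
  apply: le_trans (ler_normB _ _) _; rewrite !normrM.
  have c1 : `|cos x| <= 1 by rewrite ler_norml cos_geN1 cos_le1.
  have s1 : `|sin x| <= 1 by rewrite ler_norml sin_geN1 sin_le1.
  by apply: lerD; apply: ler_piMr.
have Dp : 0 < al ^+ 2 + be ^+ 2 by rewrite ltr_pwDl ?sqr_ge0// exprn_gt0.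
have Fc0 : Fc m%:R @[m --> \oo] --> 0.
  apply: (bnd be al) => m; rewrite /Fc !normrM (ger0_norm (expR_ge0 _)) normfV (gtr0_norm Dp).
  rewrite -mulrA mulrC; apply: ler_wpM2r; first exact: expR_ge0.
  by apply: ler_wpM2r; [rewrite invr_ge0 ltW|exact: trig].
have Fs0 : Fs m%:R @[m --> \oo] --> 0.
  apply: (bnd (- al) be) => m; rewrite /Fs !normrM (ger0_norm (expR_ge0 _)) normfV (gtr0_norm Dp).
  rewrite -mulrA mulrC; apply: ler_wpM2r; first exact: expR_ge0.
  by apply: ler_wpM2r; [rewrite invr_ge0 ltW|exact: trig].
have inv : a^-1 = Complex (0 - Fc 0) (- (0 - Fs 0)).
  apply: (@mulfI _ a); first by apply/eqP => -[] al0; move: a0; rewrite al0 ltxx.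
  rewrite mulfV; last by apply/eqP => -[] al0; move: a0; rewrite al0 ltxx.
  rewrite /Fc /Fs !mulr0 expR0 sin0 cos0; apply: complex_eq; rewrite !cReImE /=; field;
  by rewrite gt_eqF.
rewrite inv; split => /=.
  by apply: cvgB => //; exact: cvg_cst.
by apply: cvgN; apply: cvgB => //; exact: cvg_cst.
Unshelve. all: by end_near.
Qed.

Lemma ae_neq0 (P : R -> Prop) : (forall x, x != 0 -> P x) -> {ae leb, forall x, P x}.
Proof.
move=> h; exists [set 0]; split; first exact: measurable_set1.
  exact: lebesgue_measure_set1.
by move=> x /= Px; apply: contrapT => x0; apply: Px; apply: h; apply/eqP.
Qed.

Definition akern (e s y : R) : C := cexp (Complex (- (e * `|y|)) (s * y)).

Lemma cmeas_akern e s : cmeas (akern e s).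
Proof.
apply: cmeas_cexp; apply: cmeas_Complex; last exact: mulrl_measurable.
apply: measurableT_comp => //; apply: measurable_funM => //.
Qed.

(** The two half-lines give the Laplace transforms $1/(e-is)$ and $1/(e+is)$, whose sum is real. The
    halves overlap only at 0, whence the equality almost everywhere. *)
Lemma cI_akern (e s : R) : 0 < e ->
  cintg leb (akern e s) /\ cI leb (akern e s) = (2 * e / (e ^+ 2 + s ^+ 2))%:C%C.
Proof.
move=> e0.
pose h1 := hexp (Complex e (- s)).
pose h2 : measurableTypeR R -> C := fun y => hexp (Complex e s) (- y).
have h2N : (fun x => h2 (- x)) = hexp (Complex e s).
  by apply/funext => x; rewrite /h2 opprK.
have mN : measurable_fun setT (-%R : measurableTypeR R -> measurableTypeR R).
  exact: (@oppr_measurable R setT).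
have mh2 : cmeas h2.
  exact: (@cmeas_leb (fun y => hexp (Complex e s) (- y)) (cmeas_comp (cmeas_hexp _) (@oppr_measurable R setT))).
have tr : forall h : measurableTypeR R -> \bar R, measurable_fun setT h -> (forall x, 0 <= h x)%E ->
    (\int[leb]_x h x = 1%:E * \int[leb]_x h (- (x : R))%R)%E.
  by move=> h mh h0; rewrite mul1e;
    rewrite -[RHS](@ge0_integral_pushforward _ _ _ _ R (-%R : measurableTypeR R -> measurableTypeR R) mN leb setT h measurableT mh (fun x _ => h0 x));
    apply: eq_measure_integral => A mA _; exact/esym/lebesgue_measureN.
have ih2N : cintg leb (fun x => h2 (- x)) by rewrite h2N; exact: cintg_hexp.
have [ih2 Eh2] := cI_transfer ler01 mN tr mh2 ih2N.
have ih1 : cintg leb h1 by exact: cintg_hexp.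
have ih := cintgD ih1 ih2.
have mh : {ae leb, forall x, h1 x + h2 x = akern e s x}.
  apply: ae_neq0 => x x0.
  have ek (y : R) : 0 <= y -> - Complex e (- s) * y%:C%C = Complex (- (e * `|y|)) (s * y).
    by move=> y0; rewrite ger0_norm//; apply: complex_eq; rewrite !cReImE /=; ring.
  have ek' (y : R) : y <= 0 -> - Complex e s * (- y)%:C%C = Complex (- (e * `|y|)) (s * y).
    by move=> y0; rewrite ler0_norm//; apply: complex_eq; rewrite !cReImE /=; ring.
  rewrite /h1 /h2 /hexp /akern !indicE.
  have [xp|xn|xE] := ltgtP x 0; last by rewrite xE eqxx in x0.
    rewrite memNset /= ?in_itv/= ?andbT ?leNgt ?xp// mul0r add0r.
    by rewrite mem_set /= ?in_itv/= ?andbT ?oppr_ge0 ?ltW// mul1r ek' ?ltW.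
  rewrite mem_set /= ?in_itv/= ?andbT ?ltW// mul1r ek ?ltW//.
  by rewrite memNset /= ?in_itv/= ?andbT ?oppr_ge0 ?leNgt ?xn// mul0r addr0.
have [ia Ea] := cI_ae (cmeas_leb (cmeas_akern e s)) ih mh; split => //.
rewrite Ea cID// Eh2 mul1r h2N !cI_hexp//.
have D0 : e ^+ 2 + s ^+ 2 != 0 by rewrite gt_eqF// ltr_pwDl ?sqr_ge0// exprn_gt0.
have E1 : (Complex e (- s))^-1 = Complex (e / (e ^+ 2 + s ^+ 2)) (s / (e ^+ 2 + s ^+ 2)).
  apply: (@mulfI _ (Complex e (- s))); first by apply/eqP => -[] al0; move: e0; rewrite al0 ltxx.
  rewrite mulfV; last by apply/eqP => -[] al0; move: e0; rewrite al0 ltxx.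
  by apply: complex_eq; rewrite !cReImE /=; field.
have E2 : (Complex e s)^-1 = Complex (e / (e ^+ 2 + s ^+ 2)) (- s / (e ^+ 2 + s ^+ 2)).
  apply: (@mulfI _ (Complex e s)); first by apply/eqP => -[] al0; move: e0; rewrite al0 ltxx.
  rewrite mulfV; last by apply/eqP => -[] al0; move: e0; rewrite al0 ltxx.
  by apply: complex_eq; rewrite !cReImE /=; field.
by rewrite E1 E2; apply: complex_eq; rewrite !cReImE /=; field.
Qed.

Definition cgauss (a : C) (t : R) : C := cexp (- a * (t ^+ 2)%:C%C).

Lemma cmeas_cgauss a : cmeas (cgauss a).
Proof.
apply: cmeas_cexp; apply: cmeasM; first exact: cmeas_cst.
by apply: cmeas_real; exact: measurable_funX.
Qed.

Lemma n1_cgauss a t : n1 (cgauss a t) <= 2 * expR (- (complex.Re a * t ^+ 2)).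
Proof.
apply: le_trans (n1_cexp _) _; rewrite !cReImE /= mulr0 subr0 mulNr.
exact: lexx.
Qed.

Lemma cintg_cgauss (a : C) : 1 <= complex.Re a -> cintg leb (cgauss a).
Proof.
move=> a1; apply: (cintg_le (cmeas_leb (cmeas_cgauss a)) (n1_cgauss a)).
have ig : leb.-integrable setT (gauss1 (complex.Re a)).
  apply/integrableP; split; first exact: (@measurable_gauss1 R (complex.Re a)).
  have := integral_gauss1_lty a1; congr (_ < _)%E; apply: eq_integral => x _.
  by rewrite gee0_abs// gauss1_ge0.
exact: (integrableZl measurableT 2 ig).
Qed.

Lemma pdcone1 (y : (1 * 1).-tuple R) : pdcone y <-> 0 < tnth y (mxvec_index ord0 ord0).
Proof.
rewrite pdconeP; split => [[s su yE]|y0].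
  have := gram_diag_gt0 ord0 su; rewrite -yE mxE eqxx /=.
  by [].
exists (Num.sqrt (tnth y (mxvec_index ord0 ord0)))%:C%C%:M.
  rewrite unitmxE det_scalar1 unitfE; apply/eqP => -[] /eqP.
  by rewrite sqrtr_eq0 leNgt y0.
apply/matrixP => i j; rewrite (ord1 i) (ord1 j) mxE eqxx /=.
rewrite mxE big_ord1 !mxE eqxx mulr1n mulJc /nsq /= sqr_sqrtr ?ltW//.
by rewrite expr0n addr0.
Qed.

(** Polar coordinates, in the form of [gram_pushforward] for $1\times1$ matrices: the cone is a
    half-line and the integral of $e^{-a|z|^2}$ becomes $c_0\int_0^\infty e^{-ar}\,dr$. Stating it
    for the square avoids a branch of $\sqrt a$, and squares are what complex coordinates
    produce. *)
Lemma cI_cgauss2 : exists2 c0 : R, 0 < c0 & forall a, 1 <= complex.Re a ->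
  cI leb (cgauss a) ^+ 2 = c0%:C%C / a.
Proof.
have [k k0 kE] := @gram_pushforward R 1; exists k => // a a1.
have a0 : 0 < complex.Re a by apply: lt_le_trans a1.
have Ia : forall i : 'I_(1 * 1 + 1 * 1), cintg leb (cgauss a) by move=> _; exact: cintg_cgauss.
have [ip ep] := cI_prod Ia.
have <- : \prod_(i < 1 * 1 + 1 * 1) cI leb (cgauss a) = cI leb (cgauss a) ^+ 2.
  by rewrite prodr_const card_ord.
rewrite -ep.
pose i0 : 'I_(1 * 1) := mxvec_index ord0 ord0.
pose f (y : (1 * 1).-tuple R) : C := cexp (- a * (tnth y i0)%:C%C).
have fE : (fun x : (1 * 1 + 1 * 1).-tuple R => \prod_(i < 1 * 1 + 1 * 1) cgauss a (tnth x i)) =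
    (fun x => f (gram x)).
  apply/funext => x.
  have -> : \prod_(i < 1 * 1 + 1 * 1) cgauss a (tnth x i) =
      cexp (- a * (\sum_(i < 1 * 1 + 1 * 1) tnth x i ^+ 2)%:C%C).
    rewrite rmorph_sum mulr_sumr.
    by elim/big_rec2: _ => [|i y z _ ->]; rewrite ?cexp0 ?cexpD.
  rewrite /f /gram tnth_hvec eqxx sum_sqr_cmat; congr (cexp (_ * _%:C%C)).
  by rewrite /mxtrace big_ord1.
have mf : cmeas f.
  apply: cmeas_cexp; apply: cmeasM; first exact: cmeas_cst.
  by apply: cmeas_real; exact: measurable_tnth_comp.
have ip' : cintg (lebn R (1 * 1 + 1 * 1)) (fun x => f (gram x)) by rewrite -fE.
have [i1 e1] := cI_transfer_indic k0 (@measurable_pdcone R 1) kE mf ip'.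
rewrite fE e1; congr (_ * _).
pose h r : C := (\1_(`]0, +oo[%classic : set R) r)%:C%C * cexp (- a * r%:C%C).
have mh : cmeas h.
  apply: cmeas_indic; first exact: measurable_itv.
  apply: cmeas_cexp; apply: cmeasM; first exact: cmeas_cst.
  by apply: cmeas_real; exact: measurable_id.
have hh : {ae leb, forall x, hexp a x = h x}.
  apply: ae_neq0 => x x0.
  rewrite /hexp /h; congr (_%:C%C * _); rewrite !indicE; congr (nat_of_bool _)%:R.
  by rewrite !mem_setE !in_itv/= !andbT le_eqVlt eq_sym (negbTE x0).
have [ih eh] := cI_ae (cmeas_leb mh) (cintg_hexp a0) hh.
have Ih : forall i : 'I_(1 * 1), cintg leb h by move=> _.
have [ip1 ep1] := cI_prod Ih.
rewrite -cI_hexp// -eh.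
transitivity (\prod_(i < 1 * 1) cI leb h); last by rewrite prodr_const card_ord.
rewrite -ep1; congr cI; apply/funext => y.
have -> : \prod_(i < 1 * 1) h (tnth y i) = h (tnth y i0).
  have u (i : 'I_(1 * 1)) : i = i0.
    by apply: val_inj; case: i => [[|?] ?]; case: (i0) => [[|?] ?].
  rewrite (bigD1 i0)//= big_pred0 ?mulr1// => i.
  by apply/negbTE; rewrite negbK; apply/eqP; exact: u.
rewrite /h /f !indicE; congr ((nat_of_bool _)%:R%:C%C * _).
have [py|py] := pselect (pdcone y); last first.
  rewrite !memNset//= in_itv/= andbT => y0; apply: py; exact/pdcone1.
by rewrite !mem_set//= in_itv/= andbT; exact/pdcone1.
Qed.

End laplace.

(** * The Gaussian integral over complex matrices *)

Section sesquilinear_form.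
Variables (R : realType) (n : nat).
Local Notation C := R[i].
Implicit Types (G L : 'M[C]_n) (v : 'rV[C]_n).

Definition hconj v : 'cV[C]_n := \col_l (v 0 l)^*%C.

Definition sform G v : C := (v *m G *m hconj v) 0 0.

Lemma hconjM v L : hconj (v *m L) = adjmx L *m hconj v.
Proof.
apply/matrixP => l z; rewrite !mxE rmorph_sum; apply: eq_bigr => k _.
by rewrite !mxE rmorphM mulrC.
Qed.

Lemma sformM G L v : sform G (v *m L) = sform (L *m G *m adjmx L) v.
Proof. by rewrite /sform hconjM !mulmxA. Qed.

Lemma sformD G G' v : sform (G + G') v = sform G v + sform G' v.
Proof. by rewrite /sform mulmxDr mulmxDl mxE. Qed.

Lemma sform_sum G v : sform G v = \sum_l \sum_k v 0 k * G k l * (v 0 l)^*%C.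
Proof.
rewrite /sform mxE; apply: eq_bigr => l _; rewrite !mxE mulr_suml.
by apply: eq_bigr.
Qed.

Lemma sform_adj G v : sform (adjmx G) v = (sform G v)^*%C.
Proof.
rewrite !sform_sum rmorph_sum exchange_big /=; apply: eq_bigr => l _.
rewrite rmorph_sum; apply: eq_bigr => k _.
rewrite mxE; change (v 0 l * (G k l)^*%C * (v 0 k)^*%C = (v 0 k * G k l * (v 0 l)^*%C)^*%C).
case: (v 0 l) => a b; case: (v 0 k) => c d; case: (G k l) => e f.
by apply: complex_eq; rewrite !cReImE /= ?cReImE /=; ring.
Qed.

Lemma sform_diag (D : 'rV[C]_n) v :
  sform (diag_mx D) v = \sum_k D 0 k * (nsq (v 0 k))%:C%C.
Proof.
rewrite /sform mxE; apply: eq_bigr => k _.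
by rewrite mul_mx_diag !mxE mulrAC mulrC (mulrC (v 0 k)) mulJc.
Qed.

Lemma hermitian_diag_real G k : adjmx G = G -> complex.Im (G k k) = 0.
Proof.
move=> /(congr1 (fun M : 'M[C]_n => complex.Im (M k k))).
by rewrite mxE cImJ => h; lra.
Qed.

Definition hermpart G : 'M[C]_n := (2^-1)%:C%C *: (G + adjmx G).

Lemma Re_sform G v : complex.Re (sform G v) = complex.Re (sform (hermpart G) v).
Proof.
have -> : sform (hermpart G) v = (2^-1)%:C%C * sform (G + adjmx G) v.
  by rewrite /sform /hermpart -scalemxAr -scalemxAl mxE.
by rewrite sformD sform_adj !cReImE /= ?cReImE /=; field.
Qed.

Lemma hermpart_adj G : adjmx (hermpart G) = hermpart G.
Proof.
rewrite /hermpart; apply/matrixP => i j; rewrite !mxE rmorphM rmorphD/= conjcK.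
rewrite addrC; congr (_ * _); apply: complex_eq => //=.
by rewrite oppr0.
Qed.

Lemma unitary_conjK U A : unitary U -> U *m (adjmx U *m A *m U) *m adjmx U = A :> 'M[C]_n.
Proof.
move=> UU; rewrite !mulmxA (unitaryC UU) mul1mx -mulmxA (unitaryC UU).
exact: mulmx1.
Qed.

(* [L0] whitens the Hermitian part; adding a skew-Hermitian matrix keeps the
   whitened matrix normal, with eigenvalues of real part 1. *)
Lemma whitening K : adjmx K = K -> (exists U e, [/\ unitary U,
    K = adjmx U *m rdiag e *m U & forall k, 0 < e k]) ->
  exists2 L0 : 'M[C]_n, L0 \in unitmx & forall A, adjmx A = A ->
  exists W (D : 'rV[C]_n), [/\ unitary W, forall k, complex.Re (D 0 k) = 1 &
    (W *m L0) *m (K + 'i *: A) *m adjmx (W *m L0) = diag_mx D].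
Proof.
move=> KJ [U [e [UU KE e0]]].
pose s k := (Num.sqrt (e k))^-1; pose L0 := rdiag s *m U.
have s0 k : 0 < s k by rewrite invr_gt0 sqrtr_gt0.
have L0u : L0 \in unitmx.
  rewrite unitmx_mul (unitary_unit UU) andbC /= unitmxE det_rdiag unitfE.
  apply/eqP => -[] /eqP; rewrite gt_eqF//.
  by elim/big_ind: _ => // *; exact: mulr_gt0.
have L0K : L0 *m K *m adjmx L0 = 1%:M.
  have -> : L0 *m K *m adjmx L0 = rdiag s *m (U *m K *m adjmx U) *m rdiag s.
    by rewrite /L0 adjmxM rdiag_adj !mulmxA.
  rewrite KE (unitary_conjK _ UU) !rdiagM -rdiag1; congr rdiag; apply/funext => k.
  by rewrite mulrAC -expr2 exprVn sqr_sqrtr ?ltW// mulVf ?gt_eqF.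
clearbody L0.
exists L0 => // A AJ; pose H := L0 *m A *m adjmx L0.
have HJ : adjmx H = H by rewrite /H !adjmxM adjmxK AJ mulmxA.
have adjZ (c : C) (B : 'M[C]_n) : adjmx (c *: B) = c^*%C *: adjmx B.
  by apply/matrixP => i j; rewrite !mxE rmorphM.
have HE : L0 *m (K + 'i *: A) *m adjmx L0 = 1%:M + 'i *: H.
  by rewrite mulmxDr mulmxDl L0K -scalemxAr -scalemxAl.
clearbody H.
have [|W [D [WW DE]]] := @normal_spectral R n (1%:M + 'i *: H).
  have e1 (B : 'M[C]_n) : (1%:M + 'i *: H) *m (1%:M + B) = 1%:M + 'i *: H + (B + 'i *: (H *m B)).
    by rewrite mulmxDr mulmx1 mulmxDl mul1mx -scalemxAl.
  have e2 (B : 'M[C]_n) : (1%:M + B) *m (1%:M + 'i *: H) = 1%:M + 'i *: H + (B + 'i *: (B *m H)).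
    by rewrite mulmxDl mul1mx mulmxDr mulmx1 -scalemxAr.
  by rewrite adjmxD adjmx1 adjZ HJ e1 e2 -scalemxAl -scalemxAr.
have DW : diag_mx D = 1%:M + 'i *: (W *m H *m adjmx W).
  by rewrite -(unitary_conjK (diag_mx D) WW) -DE mulmxDr mulmxDl mulmx1 (unitaryC WW)
    -scalemxAr -scalemxAl.
exists W, D; split => // [k|].
  have := congr1 (fun M : 'M[C]_n => complex.Re (M k k)) DW.
  have := @hermitian_diag_real (W *m H *m adjmx W) k.
  rewrite !adjmxM adjmxK HJ mulmxA => /(_ erefl).
  move: (W *m H *m adjmx W) => B B0.
  by rewrite !mxE eqxx !mulr1n => ->; rewrite cReImE /= cReImE /= B0; ring.
have -> : (W *m L0) *m (K + 'i *: A) *m adjmx (W *m L0) =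
    W *m (L0 *m (K + 'i *: A) *m adjmx L0) *m adjmx W.
  by rewrite adjmxM !mulmxA.
by rewrite HE DE (unitary_conjK _ WW).
Qed.

End sesquilinear_form.

(** * Vectorised matrices and the Gaussian integral of a sesquilinear form *)

Section row_coordinates.
Variables (R : realType) (N : nat).
Local Notation C := R[i].
Local Notation X := ((N * N + N * N).-tuple R).
Local Notation lebX := (@lebn R (N * N + N * N)).
Local Notation leb := (@lebesgue_measure R : {sigma_finite_measure set (measurableTypeR R) -> \bar R}).

(** Vectorisation through the index of [*t] rather than of [mxvec], so that $M\mapsto AMB$ becomes
    right multiplication by [A^T *t B]. *)
Definition vrow (M : 'M[C]_N) : 'rV[C]_(N * N) :=
  \row_k M (mxtens_unindex k).1 (mxtens_unindex k).2.
Definition vmat (v : 'rV[C]_(N * N)) : 'M[C]_N := \matrix_(i, j) v 0 (mxtens_index (i, j)).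

Lemma vrowK : cancel vrow vmat.
Proof. by move=> M; apply/matrixP => i j; rewrite !mxE mxtens_indexK. Qed.

Lemma vmatK : cancel vmat vrow.
Proof. by move=> v; apply/rowP => k; rewrite !mxE -surjective_pairing mxtens_unindexK. Qed.

Lemma vrowM (A M B : 'M[C]_N) : vrow (A *m M *m B) = vrow M *m (A^T *t B).
Proof.
apply/rowP => k; case: (mxtens_indexP k) => i j; rewrite !mxE mxtens_indexK /=.
transitivity (\sum_l \sum_k A i k * M k l * B l j).
  by apply: eq_bigr => l _; rewrite mxE mulr_suml.
rewrite exchange_big pair_bigA /=.
rewrite (reindex (@mxtens_unindex N N)) /=; last first.
  by exists (@mxtens_index N N) => ? _; rewrite ?mxtens_indexK ?mxtens_unindexK.
by apply: eq_bigr => l _; rewrite !mxE mxtens_indexK /= mulrCA mulrA.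
Qed.

Lemma tr_sform (A B M : 'M[C]_N) :
  \tr (adjmx M *m (A *m M *m B)) = sform (A^T *t B) (vrow M).
Proof.
rewrite /sform -vrowM mxE /mxtrace.
transitivity (\sum_i \sum_j (M j i)^*%C * (A *m M *m B) j i).
  by apply: eq_bigr => i _; rewrite mxE; apply: eq_bigr => j _; rewrite mxE.
rewrite exchange_big pair_bigA /=.
rewrite (reindex (@mxtens_unindex N N)) /=; last first.
  by exists (@mxtens_index N N) => ? _; rewrite ?mxtens_indexK ?mxtens_unindexK.
apply: eq_bigr => l _; rewrite mulrC; congr (_ * _); first by rewrite [RHS]mxE.
by rewrite !mxE.
Qed.

Definition vact (L : 'M[C]_(N * N)) : X -> X := onX (fun M => vmat (vrow M *m L)).

Lemma vrow_vact L x : vrow (cmat (vact L x)) = vrow (cmat x) *m L.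
Proof. by rewrite /vact cmat_onX vmatK. Qed.

Lemma lin_iso_vact L : L \in unitmx -> lin_iso (vact L) (vact (invmx L)).
Proof.
have mv (L' : 'M[C]_(N * N)) : mxmeas (fun x : X => vmat (vrow (cmat x) *m L')).
  move=> i j; under eq_fun do rewrite mxE.
  have : mxmeas (fun x : X => vrow (cmat x) *m L'); last by apply.
  apply: mxmeasM; last exact: mxmeas_cst.
  by move=> k l; under eq_fun do rewrite mxE; exact: mxmeas_cmat_id.
move=> Lu; apply: lin_iso_onX => //.
- move=> A B; apply: (can_inj vrowK); rewrite vmatK.
  have vD (A' B' : 'M[C]_N) : vrow (A' + B') = vrow A' + vrow B' by apply/rowP => k; rewrite !mxE.
  by rewrite !vD mulmxDl !vmatK.
- by move=> A; rewrite vmatK mulmxK// vrowK.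
- by move=> A; rewrite vmatK mulmxKV// vrowK.
Qed.

(** Gives both real coordinates of an entry the datum attached to that entry, and bridges the two
    enumerations of entries: [mxvec] for the coordinates, [mxtens_index] for the data. *)
Definition wtX (T : Type) (e : 'I_(N * N) -> T) (i : 'I_(N * N + N * N)) : T :=
  match fintype.split i with inl j | inr j =>
    mxvec (\matrix_(d, a) e (mxtens_index (d, a))) 0 j end.

Lemma big_wtX (T A : Type) (idx : A) (op : Monoid.com_law idx) (e : 'I_(N * N) -> T)
    (F : T -> R -> A) (x : X) :
  \big[op/idx]_i F (wtX e i) (tnth x i) =
  \big[op/idx]_k op (F (e k) (complex.Re (vrow (cmat x) 0 k)))
                    (F (e k) (complex.Im (vrow (cmat x) 0 k))).
Proof.
rewrite big_split_ord /= -big_split /=.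
rewrite (reindex _ (curry_mxvec_bij _ _)) /= [RHS](reindex (@mxtens_index N N)) /=; last first.
  by exists (@mxtens_unindex N N) => ? _; rewrite ?mxtens_indexK ?mxtens_unindexK.
apply: eq_bigr => -[d a] _ /=.
rewrite /wtX (unsplitK (inl _ _)) (unsplitK (inr _ _)) !mxvecE !mxE mxtens_indexK /=.
by [].
Qed.

Lemma lscale_vact_unitary U : unitary U -> lscale (vact U) = 1.
Proof.
move=> UU; apply: (@lscale_gauss_invariant _ _ _ _ (fun=> 1) (lin_iso_vact (unitary_unit UU))) => // x.
have E (z : X) : \sum_i 1 * tnth z i ^+ 2 = complex.Re (sform 1%:M (vrow (cmat z))).
  under eq_bigr do rewrite mul1r.
  rewrite (big_wtX _ (fun=> tt) (fun _ t => t ^+ 2)) -diag_const_mx sform_diag cRe_sum.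
  by apply: eq_bigr => k _; rewrite [X in X * _]mxE mul1r.
by rewrite !E vrow_vact sformM mulmx1 unitaryC.
Qed.

(** Each entry contributes a real and an imaginary Gaussian integral with the same parameter, that
    is, the square evaluated by [cI_cgauss2]. *)
Lemma gauss_diag : exists2 c0 : R, 0 < c0 & forall D : 'rV[C]_(N * N),
  (forall k, complex.Re (D 0 k) = 1) ->
  cintg lebX (fun x => cexp (- sform (diag_mx D) (vrow (cmat x)))) /\
  cI lebX (fun x => cexp (- sform (diag_mx D) (vrow (cmat x)))) = c0%:C%C / \prod_k D 0 k.
Proof.
have [c0 c00 cE] := cI_cgauss2 R; exists (c0 ^+ (N * N)); first exact: exprn_gt0.
move=> D D1.
have ID (i : 'I_(N * N + N * N)) : cintg leb (cgauss (wtX (D 0) i)).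
  apply: cintg_cgauss; rewrite /wtX.
  by case: fintype.split => j; case/mxvec_indexP: j => d a; rewrite mxvecE mxE D1.
have [i1 e1] := cI_prod ID.
have E : (fun x : X => \prod_i cgauss (wtX (D 0) i) (tnth x i)) =
    (fun x => cexp (- sform (diag_mx D) (vrow (cmat x)))).
  apply/funext => x; rewrite (big_wtX _ (D 0) (@cgauss R)) sform_diag.
  rewrite -sumrN; elim/big_rec2: _ => [|k y z _ ->]; first by rewrite cexp0.
  rewrite cexpD /=; congr (_ * _); rewrite /cgauss -cexpD; congr cexp.
  by rewrite /nsq rmorphD mulrDr !mulNr opprD.
rewrite -E; split => //; rewrite e1.
(* [big_wtX] is used with a function that ignores the coordinate values, so any point will do. *)
have x0 : X := cvec 0.
apply: (etrans (big_wtX _ (D 0) (fun d _ => cI leb (cgauss d)) x0)) => /=.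
transitivity (\prod_(k < N * N) (c0%:C%C / D 0 k)).
  by apply: eq_bigr => k _; rewrite -expr2 cE// D1.
by rewrite big_split /= prodr_const card_ord prodfV rmorphXn.
Qed.

(** $|\cos|+|\sin|\ge1$ because the squares add up to 1. *)
Lemma expR_Re_le_n1_cexp (z : C) : expR (complex.Re z) <= n1 (cexp z).
Proof.
rewrite /n1 /= !normrM !(ger0_norm (expR_ge0 _)) -mulrDr ler_peMr ?expR_ge0//.
have c1 : `|cos (complex.Im z)| <= 1 by rewrite ler_norml cos_geN1 cos_le1.
have s1 : `|sin (complex.Im z)| <= 1 by rewrite ler_norml sin_geN1 sin_le1.
have := cos2Dsin2 (complex.Im z); rewrite -(real_normK (num_real (cos _))) -(real_normK (num_real (sin _))).
have := normr_ge0 (cos (complex.Im z)); have := normr_ge0 (sin (complex.Im z)).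
by rewrite !expr2; nra.
Qed.

Lemma cmeas_sform (G : 'M[C]_(N * N)) : cmeas (fun x : X => sform G (vrow (cmat x))).
Proof.
under eq_fun do rewrite sform_sum; apply: cmeas_sum => l; apply: cmeas_sum => k.
have mv j : cmeas (fun x : X => vrow (cmat x) 0 j).
  by under eq_fun do rewrite mxE; exact: mxmeas_cmat_id.
by apply: cmeasM; [apply: cmeasM => //; exact: cmeas_cst|apply: cmeasJ].
Qed.

(** The modulus of the integrand depends only on the Hermitian part. A measure-preserving unitary
    rotation makes that part diagonal, and an integrable diagonal Gaussian has positive weights. *)
Lemma hermpart_posdef (G : 'M[C]_(N * N)) :
  cintg lebX (fun x => cexp (- sform G (vrow (cmat x)))) ->
  exists U e, [/\ unitary U, hermpart G = adjmx U *m rdiag e *m U & forall k, 0 < e k].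
Proof.
move=> iG; have [U [e [UU KE]]] := hermitian_spectral (hermpart_adj G).
exists U, e; split => // k.
pose w := wtX e.
pose i0 := lshift (N * N) (mxvec_index (mxtens_unindex k).1 (mxtens_unindex k).2).
have -> : e k = w i0.
  by rewrite /w /wtX /i0 (unsplitK (inl _ _)) mxvecE mxE -surjective_pairing mxtens_unindexK.
apply: integral_gaussn_lty_gt0.
have gE x : gaussn w (vact (adjmx U) x) = (expR (- complex.Re (sform G (vrow (cmat x)))))%:E.
  rewrite /gaussn; congr (expR (- _))%:E.
  rewrite (big_wtX _ e (fun d t => d * t ^+ 2)) Re_sform KE.
  have -> : adjmx U *m rdiag e *m U = adjmx U *m rdiag e *m adjmx (adjmx U) by rewrite adjmxK.
  rewrite -sformM -vrow_vact sform_diag cRe_sum; apply: eq_bigr => k' _.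
  apply: etrans (_ : e k' * nsq (vrow (cmat (vact (adjmx U) x)) 0 k') = _).
    exact: (esym (mulrDr _ _ _)).
  by rewrite [X in X * _%:C%C]mxE !cReImE /= mul0r subr0.
have mg : measurable_fun setT (gaussn w) by exact: measurable_gaussn.
have g0 x : (0 <= gaussn w x)%E by rewrite lee_fin expR_ge0.
have := ge0_integral_lscale (lin_iso_vact (unitary_unit (unitary_adj UU))) mg g0.
rewrite lscale_vact_unitary; last exact: unitary_adj.
rewrite mul1e => <-.
apply: le_lt_trans (_ : (\int[lebX]_x (n1 (cexp (- sform G (vrow (cmat x)))))%:E < +oo)%E).
  have mc : cmeas (fun x : X => cexp (- sform G (vrow (cmat x)))).
    by apply: cmeas_cexp; apply: cmeasN; exact: cmeas_sform.
  apply: ge0_le_integral => //.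
  - by under eq_fun do rewrite gE; apply/measurable_EFinP; apply: measurableT_comp => //;
      apply: measurableT_comp => //; case: (cmeas_sform G).
  - by apply/measurable_EFinP; exact: measurable_n1.
  - by move=> x _; rewrite gE lee_fin; apply: le_trans (expR_Re_le_n1_cexp _); rewrite !cReImE.
have /integrableP[_] := cintg_n1 iG; congr (_ < _)%E; apply: eq_integral => x _.
by rewrite gee0_abs// lee_fin n1_ge0.
Qed.

Lemma vactM (W L : 'M[C]_(N * N)) : vact (W *m L) = vact L \o vact W.
Proof.
apply/funext => x; rewrite /= {2}/vact /onX; congr (cvec (vmat _)).
by rewrite vrow_vact mulmxA.
Qed.

Lemma frac_aux (c0 l d : R) (p q : C) : l != 0 -> d != 0 -> p != 0 -> d%:C%C * q = p ->
  (l^-1)%:C%C * (c0%:C%C / p) * q = (c0 / (l * d))%:C%C.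
Proof.
move=> l0 d0 p0 pE.
have -> : (c0 / (l * d))%:C%C = c0%:C%C * (l^-1)%:C%C * (d^-1)%:C%C.
  by apply: complex_eq; rewrite !cReImE /=; field; rewrite ?l0 ?d0.
have dV : (d^-1)%:C%C * d%:C%C = 1 :> C by apply: complex_eq; rewrite !cReImE /=; field.
have -> : q = (d^-1)%:C%C * p by rewrite -pE mulrA dV mul1r.
by rewrite mulrACA (mulfVK p0) mulrC mulrA.
Qed.

(** Adding $iA$ with $A$ Hermitian leaves the Hermitian part of [G] unchanged, so one whitening
    matrix [L0] serves all [A]; the remaining unitary [W] affects neither the scaling factor nor the
    modulus of the determinant. Hence [k] does not depend on [A]. In this product form the identity
    also shows that the determinant is nonzero. *)
Lemma gauss_transform (G : 'M[C]_(N * N)) :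
  cintg lebX (fun x => cexp (- sform G (vrow (cmat x)))) ->
  exists2 k : R, 0 < k & forall A, adjmx A = A ->
    cI lebX (fun x => cexp (- sform (G + 'i *: A) (vrow (cmat x)))) * \det (G + 'i *: A) =
    k%:C%C.
Proof.
move=> iG; have [L0 L0u L0P] := whitening (hermpart_adj G) (hermpart_posdef iG).
have [c0 c00 c0E] := gauss_diag.
have l0 := lscale_gt0 (lin_iso_vact L0u).
have d0 : 0 < nsq (\det L0).
  by rewrite lt_neqAle nsq_ge0 andbT eq_sym nsq_eq0 -unitfE -unitmxE.
exists (c0 / (lscale (vact L0) * nsq (\det L0))); first by rewrite divr_gt0// mulr_gt0.
move=> A AJ.
pose S : 'M[C]_(N * N) := (- 'i) *: (G - hermpart G).
have iG' : G = hermpart G + 'i *: S.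
  by rewrite /S scalerA mulrN -expr2 sqr_i opprK scale1r addrC subrK.
have SJ : adjmx S = S.
  apply/matrixP => i j; rewrite !mxE.
  case: (G i j) => a b; case: (G j i) => c d.
  by apply: complex_eq; rewrite !cReImE /= ?cReImE /=; field.
have SAJ : adjmx (S + A) = S + A by rewrite adjmxD SJ AJ.
have [W [D [WW D1]]] := L0P _ SAJ.
have -> : G + 'i *: A = hermpart G + 'i *: (S + A) by rewrite scalerDr addrA -iG'.
move: (hermpart G + 'i *: (S + A)) => G' G'E.
have [L [Lu lL detL LE]] : exists L, [/\ L \in unitmx, lscale (vact L) = lscale (vact L0),
    nsq (\det L) = nsq (\det L0) & L *m G' *m adjmx L = diag_mx D].
  exists (W *m L0); split; last exact: G'E.
  - by rewrite unitmx_mul (unitary_unit WW).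
  - rewrite vactM (lscale_comp (lin_iso_vact L0u) (lin_iso_vact (unitary_unit WW))).
    by rewrite (lscale_vact_unitary WW) mulr1.
  - by rewrite det_mulmx nsqM (nsq_det_unitary WW) mul1r.
clear W WW G'E L0P.
have [iD eD] := c0E D D1.
have fE : (fun x : X => cexp (- sform (diag_mx D) (vrow (cmat x)))) =
    (fun x => cexp (- sform G' (vrow (cmat (vact L x))))).
  by apply/funext => x; rewrite vrow_vact sformM LE.
have tr (h : X -> \bar R) : measurable_fun setT h -> (forall x, 0 <= h x)%E ->
    (\int[lebX]_x h x = (lscale (vact L0))^-1%:E * \int[lebX]_x h (vact L x))%E.
  move=> mh h0; rewrite (ge0_integral_lscale (lin_iso_vact Lu) mh h0) lL muleA -EFinM.
  by rewrite (mulVf (lt0r_neq0 l0)) mul1e.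
have mf : cmeas (fun x : X => cexp (- sform G' (vrow (cmat x)))).
  by apply: cmeas_cexp; apply: cmeasN; exact: cmeas_sform.
have linv : 0 <= (lscale (vact L0))^-1 by rewrite invr_ge0 ltW.
have mL : measurable_fun setT (vact L) by case: (lin_iso_vact Lu).
rewrite fE in iD eD.
have [_ ->] := cI_transfer linv mL tr mf iD.
rewrite eD.
have detE : (nsq (\det L0))%:C%C * \det G' = \prod_k D 0 k.
  rewrite -det_diag -LE !det_mulmx det_adjmx -detL -mulJc.
  by move: (\det L) (\det G') (_^*%C) => u v w; ring.
have P0 : \prod_k D 0 k != 0.
  apply/prodf_neq0 => k _; apply/eqP => Dk; have := D1 k; rewrite Dk /=.
  by move/eqP; rewrite eq_sym oner_eq0.
exact: (frac_aux c0 (lt0r_neq0 l0) (lt0r_neq0 d0) P0 detE).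
Qed.

(* Only the eigenvalues of [Q] and [Y] enter: both determinants are computed on
   simultaneous lower triangular forms of the two tensor factors. *)
Lemma det_tens_spectrum (Q : 'M[C]_N) : exists t : 'I_N -> C, forall (c : C) (Y : 'M[C]_N),
  \det (1%:M - c *: (Q *t Y)) = \prod_j \det (1%:M - (c * t j) *: Y).
Proof.
have triang (A : 'M[C]_N) : exists S T, [/\ S \in unitmx, is_trig_mx T & A = invmx S *m T *m S].
  have [N0|N0] := posnP N.
    exists 1%:M, A; split; [exact: unitmx1| |by rewrite invmx1 mul1mx mulmx1].
    by apply/is_trig_mxP => i; case: (i) => k lk; exfalso; move: lk; rewrite N0.
  have [S SU ST] := Schur A N0; exists S, (S *m A *m invmx S).
  have Su := unitarymx_unit SU; split => //.
    by rewrite -conjumx.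
  by rewrite !mulmxA mulVmx// mul1mx mulmxKV.
have detc (c : C) (S T : 'M[C]_N) : S \in unitmx ->
    \det (1%:M - c *: (invmx S *m T *m S)) = \det (1%:M - c *: T).
  move=> Su; have -> : 1%:M - c *: (invmx S *m T *m S) = invmx S *m (1%:M - c *: T) *m S.
    by rewrite mulmxBr mulmxBl mulmx1 mulVmx// -scalemxAr -scalemxAl.
  by rewrite !det_mulmx mulrAC -det_mulmx mulVmx// det1 mul1r.
have [S [T [Su TT QE]]] := triang Q.
exists (fun j => T j j) => c Y; have [S' [T' [Su' TT' YE]]] := triang Y.
have tens1 : 1%:M *t 1%:M = 1%:M :> 'M[C]_(N * N).
  apply/matrixP => i j; case: (mxtens_indexP i) => a b; case: (mxtens_indexP j) => a' b'.
  rewrite tensmxE !mxE (can_eq (@mxtens_indexK N N)) xpair_eqE.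
  by case: (_ == _); case: (_ == _); rewrite ?mulr1 ?mulr0 ?mul0r.
have SSu : S *t S' \in unitmx.
  apply: (proj1 (@mulmx1_unit _ _ _ (invmx S *t invmx S') _)).
  by rewrite tensmx_mul !mulmxV.
have -> : 1%:M - c *: (Q *t Y) = invmx (S *t S') *m (1%:M - c *: (T *t T')) *m (S *t S').
  have -> : invmx (S *t S') = invmx S *t invmx S'.
    have ZS : (invmx S *t invmx S') *m (S *t S') = 1%:M by rewrite tensmx_mul !mulVmx.
    by rewrite -[LHS]mul1mx -ZS -mulmxA (mulmxV SSu) mulmx1.
  rewrite mulmxBr mulmxBl mulmx1 tensmx_mul !mulVmx// tens1 -scalemxAr -scalemxAl.
  by rewrite !tensmx_mul -QE -YE.
rewrite !det_mulmx mulrAC -det_mulmx mulVmx// det1 mul1r.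
have trig1 n (B : 'M[C]_n) (d : C) : is_trig_mx B -> \det (1%:M - d *: B) = \prod_k (1 - d * B k k).
  move=> /is_trig_mxP Bt; rewrite det_trig.
    by apply: eq_bigr => k _; rewrite !mxE eqxx.
  apply/is_trig_mxP => i j ij; rewrite !mxE Bt// mulr0 subr0.
  by case: eqP => // eij; rewrite eij ltnn in ij.
have /is_trig_mxP tT := TT; have /is_trig_mxP tT' := TT'.
rewrite trig1; last first.
  apply/is_trig_mxP => i j; case: (mxtens_indexP i) => a b; case: (mxtens_indexP j) => a' b' /= ij.
  rewrite tensmxE; have [aa|aa] := ltnP a a'; first by rewrite tT// mul0r.
  have [bb|bb] := ltnP b b'; first by rewrite (tT' _ _ bb) mulr0.
  by move: ij; rewrite ltnNge leq_add// leq_mul2r aa orbT.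
rewrite (reindex (@mxtens_index N N)) /=; last first.
  by exists (@mxtens_unindex N N) => ? _; rewrite ?mxtens_indexK ?mxtens_unindexK.
transitivity (\prod_j \prod_k (1 - c * T j j * T' k k)).
  by rewrite pair_bigA /=; apply: eq_bigr => -[j k] _; rewrite tensmxE mulrA.
apply: eq_bigr => j _.
by rewrite YE detc// trig1.
Qed.

(** Vectorisation produces $Q^T$ where the potential has $Q$. Transposing the whole matrix moves the
    transpose to [Y], where each factor of [det_tens_spectrum] is insensitive to it. *)
Lemma det_tens_tr (c : C) (Q Y : 'M[C]_N) :
  \det (1%:M - c *: (Q^T *t Y)) = \det (1%:M - c *: (Q *t Y)).
Proof.
have [t tE] := det_tens_spectrum Q.
have -> : 1%:M - c *: (Q^T *t Y) = (1%:M - c *: (Q *t Y^T))^T.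
  by apply/matrixP => i j; rewrite !mxE eq_sym.
rewrite det_tr !tE; apply: eq_bigr => j _.
by rewrite -det_tr linearB linearZ /= trmx1 trmxK.
Qed.

End row_coordinates.

(** * The principal logarithm and the trace of the logarithm of a matrix *)

Section logarithm.
Variable R : realType.
Local Notation C := R[i].

(** The default of [xget] is ruled out by a polar form $z=re^{i\vartheta}$, with
    $\vartheta=\pm\arccos(a/r)$ according to the sign of the imaginary part. *)
Lemma cexp_clog (z : C) : z != 0 -> cexp (clog z) = z.
Proof.
move=> z0; suff [w zw] : exists w, cexp w = z /\ - pi < complex.Im w <= pi.
  by have [] := @xgetPex _ 0 [set w | cexp w = z /\ - pi < complex.Im w <= pi] (ex_intro _ w zw).
have r2 : 0 < nsq z by rewrite lt_neqAle nsq_ge0 andbT eq_sym nsq_eq0.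
case: z z0 r2 => a b _; rewrite /nsq /= => r2.
pose r := Num.sqrt (a ^+ 2 + b ^+ 2).
have r0 : 0 < r by rewrite sqrtr_gt0.
have rr : r ^+ 2 = a ^+ 2 + b ^+ 2 by rewrite sqr_sqrtr// ltW.
have rN0 : r != 0 by rewrite gt_eqF.
clearbody r.
have x1 : (a / r) ^+ 2 + (b / r) ^+ 2 = 1 by rewrite !exprMn -mulrDl -rr -exprMn mulfV// expr1n.
have s2 : 0 <= (a / r) ^+ 2 by exact: sqr_ge0.
have t2 : 0 <= (b / r) ^+ 2 by exact: sqr_ge0.
have xb : -1 <= a / r <= 1 by rewrite -ler_norml -(@expr_le1 _ 2)// real_normK ?num_real//; lra.
have sE : sin (acos (a / r)) = `|b / r|.
  rewrite sin_acos// -sqrtr_sqr; congr Num.sqrt; lra.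
have p0 := pi_gt0 R.
have [b0|b0] := leP 0 b.
  exists (Complex (ln r) (acos (a / r))); split => /=; last first.
    by rewrite acos_lepi// andbT (@lt_le_trans _ _ 0)// ?oppr_lt0 ?acos_ge0.
  rewrite /cexp /= lnK ?posrE// acosK ?in_itv/= // sE ger0_norm; last by rewrite divr_ge0 ?(ltW r0).
  by congr Complex; rewrite mulrC divfK.
(* The angle must stay strictly above $-\pi$: $b\neq0$ excludes $a/r=-1$. *)
exists (Complex (ln r) (- acos (a / r))); split => /=; last first.
  rewrite ltrN2 acos_ltpi /=.
    by rewrite (@le_trans _ _ 0) ?oppr_le0 ?acos_ge0// ltW.
  case/andP: xb => xb1 ->; rewrite andbT lt_neqAle xb1 andbT; apply/eqP => xE.
  have : (b / r) ^+ 2 = 0 by move: x1; rewrite -xE sqrrN expr1n; lra.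
  by move/eqP; rewrite sqrf_eq0 mulf_eq0 invr_eq0 (negbTE rN0) orbF lt_eqF.
rewrite /cexp /= lnK ?posrE// cosN sinN acosK ?in_itv/= // sE ler0_norm; last first.
  by rewrite mulr_le0_ge0 ?invr_ge0 ?ltW.
by congr Complex; rewrite ?opprK mulrC divfK.
Qed.

Lemma cexpN (z : C) : cexp (- z) = (cexp z)^-1.
Proof.
have h : cexp z * cexp (- z) = 1 by rewrite -cexpD subrr cexp0.
have z0 : cexp z != 0 by apply/eqP => z0; move/eqP: h; rewrite z0 mul0r eq_sym oner_eq0.
by apply: (mulfI z0); rewrite h mulfV.
Qed.

Lemma char_poly_eigenvalues n (A : 'M[C]_n) :
  char_poly A = \prod_(z <- eigenvalues A) ('X - z%:P).
Proof.
have [s sE] := closed_field_poly_normal (char_poly A).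
rewrite (eqP (char_poly_monic A)) scale1r in sE.
exact: (@xgetPex _ [::] [set s | char_poly A = \prod_(z <- s) ('X - z%:P)] (ex_intro _ s sE)).
Qed.

Lemma det_eigenvalues n (A : 'M[C]_n) : \det A = \prod_(z <- eigenvalues A) z.
Proof.
have cE := char_poly_eigenvalues A; set s := eigenvalues A in cE *.
have sz : size s = n.
  by have := size_char_poly A; rewrite cE size_prod_XsubC => -[].
have := char_poly_det A; rewrite -horner_coef0 cE horner_prod.
under eq_bigr do rewrite hornerXsubC sub0r -mulN1r.
rewrite big_split /= big_const_seq count_predT sz -Monoid.iteropE => /mulfI -> //.
by rewrite signr_eq0.
Qed.

(** Exponentiation forgets the branch of the logarithm. The determinant has to be nonzero because
    [clog 0] is a default value. *)
Lemma cexpN_trln n (A : 'M[C]_n) : \det A != 0 -> cexp (- trln A) = (\det A)^-1.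
Proof.
rewrite /trln det_eigenvalues; elim: eigenvalues => [|z s IH].
  by rewrite !big_nil oppr0 cexp0 invr1.
rewrite !big_cons mulf_eq0 negb_or => /andP[z0 s0].
by rewrite opprD cexpD IH// cexpN cexp_clog// invfM.
Qed.

End logarithm.

(** * The Fourier transform of the Gaussian integrand *)

Section complex_gaussian_transform.
Variables (R : realType) (N : nat) (P Q : 'M[R[i]]_N).
Local Notation C := R[i].
Local Notation X := ((N * N + N * N).-tuple R).
Local Notation H := ((N * N).-tuple R).
Local Notation lebX := (@lebn R (N * N + N * N)).
Hypotheses (Pu : P \in unitmx) (Qu : Q \in unitmx).
Hypothesis wd0 : CM_well_defined (fun=> 0) P Q.

Let F := integrandCM (fun=> 0) P Q.
(** Cyclicity rewrites the trace as that of $M^*\,Q^{-1}MP^{-1}$, whose vectorised form this is. *)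
Let G0 : 'M[C]_(N * N) := N%:R *: ((invmx Q)^T *t invmx P).

Lemma integrandCM_sform x : F x = cexp (- sform G0 (vrow (cmat x))).
Proof.
rewrite /F /integrandCM addr0 mulNr; congr (cexp (- _)).
have -> : invmx P *m adjmx (cmat x) *m invmx Q *m cmat x =
  invmx P *m (adjmx (cmat x) *m (invmx Q *m cmat x)) by rewrite !mulmxA.
rewrite mxtrace_mulC -!mulmxA (mulmxA (invmx Q)) tr_sform.
by rewrite /sform -scalemxAr -scalemxAl [in RHS]mxE.
Qed.

Lemma cintg_integrandCM : cintg lebX (fun x => cexp (- sform G0 (vrow (cmat x)))).
Proof.
have -> : (fun x => cexp (- sform G0 (vrow (cmat x)))) = F.
  by apply/funext => x; rewrite integrandCM_sform.
exact: wd0.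
Qed.

Lemma n1_integrandCM x : n1 (F x) <= 2.
Proof.
rewrite integrandCM_sform; apply: le_trans (n1_cexp _) _; rewrite cReImE.
have [U [e [UU KE e0]]] := hermpart_posdef cintg_integrandCM.
rewrite ler_piMr// -expR0 ler_expR oppr_le0 Re_sform KE -{2}(adjmxK U) -sformM sform_diag cRe_sum.
apply: sumr_ge0 => k _; rewrite [X in X * _%:C%C]mxE !cReImE /= mul0r subr0.
by apply: mulr_ge0; [exact: ltW|exact: nsq_ge0].
Qed.

Lemma CM_fourier : exists2 k : C, k != 0 & forall y : H,
  cI lebX (fun x => F x * cexp ('i * N%:R * \tr (hermmat (gram x) *m hermmat y))) =
  k * cexp (Ypot P Q (hermmat y)).
Proof.
have [k k0 kE] := gauss_transform cintg_integrandCM.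
(* $\mathrm{Tr}(M^* MB)$ is the form of $\mathbb 1\otimes B$; the sign offsets the minus in front of
   [sform]. *)
pose A (y : H) : 'M[C]_(N * N) := (- N%:R) *: (1%:M *t hermmat y).
have AJ y : adjmx (A y) = A y.
  apply/matrixP => i j; case: (mxtens_indexP i) => a b; case: (mxtens_indexP j) => a' b'.
  have hB : (hermmat y b' b)^*%C = hermmat y b b' by rewrite -[in RHS]hermmat_adj [RHS]mxE.
  have cJ : (- N%:R : C)^*%C = - N%:R by rewrite rmorphN rmorph_nat.
  rewrite /A; move: (hermmat y) (- N%:R) hB cJ => B c hB cJ.
  have tE (p q p' q' : 'I_N) : (c *: (1%:M *t B)) (mxtens_index (p, q)) (mxtens_index (p', q')) =
      c * ((p == p')%:R * B q q') by rewrite mxE tensmxE mxE.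
  rewrite mxE !tE -hB [a' == a]eq_sym; case: (a == a'); last by rewrite !mul0r mulr0 rmorph0.
  by rewrite !mul1r -[in RHS]cJ; exact: rmorphM.
have GA y : G0 + 'i *: A y = G0 *m (1%:M - 'i *: (Q^T *t (P *m hermmat y))).
  rewrite mulmxBr mulmx1 -scalemxAr /G0 -scalemxAl tensmx_mul -trmx_mul mulmxV// trmx1 mulKmx//.
  by rewrite /A scaleNr scalerN.
have kC : k%:C%C != 0 :> C by apply/eqP => -[] h; rewrite h ltxx in k0.
have dE y := kE _ (AJ y).
(* Read off from the transform, whose product with the determinant is the nonzero constant [k]. *)
have d0 y : \det (G0 + 'i *: A y) != 0.
  by apply/eqP => d0; have := dE y; rewrite d0 mulr0 => /esym/eqP; rewrite (negbTE kC).
have dG y : \det (G0 + 'i *: A y) = \det G0 * \det (1%:M - 'i *: (Q *t (P *m hermmat y))).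
  by rewrite (GA y) det_mulmx (det_tens_tr 'i Q (P *m hermmat y)).
have nz y : \det G0 * \det (1%:M - 'i *: (Q *t (P *m hermmat y))) != 0.
  by rewrite -(dG y); exact: (d0 y).
have y0 : H := hvec 0.
have g0 : \det G0 != 0 by apply: contraNneq (nz y0) => ->; rewrite mul0r.
exists (k%:C%C / \det G0); first by rewrite mulf_neq0// invr_neq0.
move=> y; have q0 : \det (1%:M - 'i *: (Q *t (P *m hermmat y))) != 0.
  by apply: contraNneq (nz y) => ->; rewrite mulr0.
rewrite /Ypot (cexpN_trln q0) -mulrA -invfM -(dG y).
apply: (mulIf (d0 y)); rewrite (divfK (d0 y)) -(dE y); congr (_ * _); congr cI; apply/funext => x.
rewrite integrandCM_sform -cexpD; congr cexp; rewrite sformD opprD; congr (_ + _).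
rewrite hermmat_gram -mulmxA -[cmat x *m _]mul1mx [1%:M *m _]mulmxA tr_sform trmx1 /A scaleNr scalerN.
rewrite /sform mulmxN mulNmx [in RHS]mxE opprK -!scalemxAr -!scalemxAl.
by rewrite 2![in RHS]mxE mulrA.
Qed.

End complex_gaussian_transform.

(** * Fourier transforms and Abel summation *)

Section integral_bounds.
Context d (T : measurableType d) (R : realType) (mu : {measure set T -> \bar R}).

Lemma integral_lim_le (f_ : nat -> T -> R) (f : T -> R) (M : R) :
  (forall m, measurable_fun setT (f_ m)) -> (forall m x, 0 <= f_ m x) ->
  (forall x, nondecreasing_seq (f_ ^~ x)) -> (forall x, f_ m x @[m --> \oo] --> f x) ->
  (forall m, \int[mu]_x (f_ m x)%:E <= M%:E)%E -> (\int[mu]_x (f x)%:E <= M%:E)%E.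
Proof.
move=> mf_ f0 nd cf fM.
have -> : (fun x => (f x)%:E) = (fun x => limn (fun m => (f_ m x)%:E)).
  apply/funext => x; apply/esym/cvg_lim => //; apply: cvg_EFin; first exact: nearW.
  exact: cf.
rewrite monotone_convergence//.
- apply: lime_le; last exact: nearW.
  apply: ereal_nondecreasing_is_cvgn => a b ab; apply: ge0_le_integral => //.
  + by move=> x _; rewrite lee_fin.
  + exact/measurable_EFinP.
  + exact/measurable_EFinP.
  + by move=> x _; rewrite lee_fin; exact: nd.
- by move=> m; exact/measurable_EFinP.
- by move=> m x _; rewrite lee_fin.
- by move=> x _ a b ab; rewrite lee_fin; exact: nd.
Qed.

Lemma n1_cI_le (f : T -> R[i]) (h : T -> R) (M : R) : cintg mu f ->
  measurable_fun setT h -> (forall x, n1 (f x) <= h x) ->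
  (\int[mu]_x (h x)%:E <= M%:E)%E -> n1 (cI mu f) <= M.
Proof.
move=> If mh fh hM; apply: le_trans (n1_cI If) _.
have mn : measurable_fun setT (fun x => (n1 (f x))%:E).
  by apply/measurable_EFinP; exact: measurable_n1 (cintg_meas If).
have le : (\int[mu]_x (n1 (f x))%:E <= M%:E)%E.
  apply: le_trans hM; apply: ge0_le_integral => //.
  - by move=> x _; rewrite lee_fin n1_ge0.
  - exact/measurable_EFinP.
  - by move=> x _; rewrite lee_fin.
rewrite /Rintegral -lee_fin fineK//.
rewrite ge0_fin_numE; first exact: le_lt_trans le (ltry _).
by apply: integral_ge0 => x _; rewrite lee_fin n1_ge0.
Qed.

Lemma cI_real (f : T -> R) : cI mu (fun x => (f x)%:C%C) = (\int[mu]_x f x)%:C%C.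
Proof. by rewrite /cI /= /Rintegral integral0. Qed.

End integral_bounds.

(** * The one-dimensional Poisson kernel *)

Section poisson_kernel.
Variable R : realType.
Local Notation C := R[i].
Local Notation leb := (@lebesgue_measure R : {sigma_finite_measure set (measurableTypeR R) -> \bar R}).

(** The value of the integral of [akern e (w * s)], left unnormalised: its mass in [s] is $2\pi/w$
    for every [e]. *)
Definition pois1 (w e s : R) : R := 2 * e / (e ^+ 2 + (w * s) ^+ 2).

Lemma pois1_den_gt0 (w e s : R) : 0 < e -> 0 < e ^+ 2 + (w * s) ^+ 2.
Proof. by move=> e0; rewrite ltr_pwDl ?sqr_ge0// exprn_gt0. Qed.

Lemma pois1_ge0 (w e s : R) : 0 < e -> 0 <= pois1 w e s.
Proof.
by move=> e0; rewrite divr_ge0 ?mulr_ge0// ?(ltW e0)// ltW// pois1_den_gt0.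
Qed.

Lemma pois1_le (w e s : R) : 0 < e -> pois1 w e s <= 2 / e.
Proof.
move=> e0; rewrite /pois1 ler_pdivrMr ?pois1_den_gt0//.
have -> : 2 / e * (e ^+ 2 + (w * s) ^+ 2) = 2 * e + 2 / e * (w * s) ^+ 2.
  by field; rewrite gt_eqF.
by rewrite lerDl mulr_ge0 ?sqr_ge0// divr_ge0// ltW.
Qed.

Lemma is_derive_pois1 (w e b x : R) : 0 < w -> 0 < e ->
  is_derive x (1 : R) (fun t => 2 / w * atan (w / e * (t - b))) (pois1 w e (b - x)).
Proof.
move=> w0 e0; have h : is_derive x (1 : R) (fun t => w / e * (t - b)) (w / e).
  by apply: is_derive_eq; rewrite /GRing.scale /=; ring.
have h2 := @is_derive1_comp _ (@atan R) (fun t => w / e * (t - b)) x _ _ (is_derive1_atan _) h.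
apply: is_derive_eq; rewrite /GRing.scale /= /pois1.
have -> : 1 + (w / e * (x - b)) ^+ 2 = (e ^+ 2 + (w * (b - x)) ^+ 2) / e ^+ 2.
  by field; rewrite gt_eqF.
have := pois1_den_gt0 w (b - x) e0; move: (e ^+ 2 + (w * (b - x)) ^+ 2) => D D0.
by field; rewrite !gt_eqF.
Qed.

Lemma continuous_pois1 (w e b : R) : 0 < e -> continuous (fun t : R => pois1 w e (b - t)).
Proof.
move=> e0 t; apply: cvgM; first exact: cvg_cst.
apply: cvgV; first by rewrite gt_eqF// pois1_den_gt0.
apply: cvgD; first exact: cvg_cst.
apply: (@cvgM _ _ _ _ (fun t => w * (b - t)) (fun t => w * (b - t))).
  apply: cvgM; first exact: cvg_cst.
  by apply: cvgB; [exact: cvg_cst|exact: cvg_id].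
apply: cvgM; first exact: cvg_cst.
by apply: cvgB; [exact: cvg_cst|exact: cvg_id].
Qed.

Lemma measurable_pois1 (w e b : R) : 0 < e -> measurable_fun setT (fun t : R => pois1 w e (b - t)).
Proof. by move=> e0; apply: continuous_measurable_fun; exact: continuous_pois1. Qed.

Lemma Rintegral_pois1_itv (w e b l u : R) : 0 < w -> 0 < e -> l <= u ->
  \int[leb]_t (\1_(`[l, u]%classic : set R) t * pois1 w e (b - t)) =
  2 / w * atan (w / e * (u - b)) - 2 / w * atan (w / e * (l - b)).
Proof.
move=> w0 e0 lu.
apply: (@FTC_cc R (fun t => pois1 w e (b - t)) (fun t => 2 / w * atan (w / e * (t - b))) l u lu).
  exact: continuous_pois1.
by move=> x; exact: is_derive_pois1.
Qed.

Lemma integral_pois1_itv_le (w e b l u : R) : 0 < w -> 0 < e -> l <= u ->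
  (\int[leb]_t (\1_(`[l, u]%classic : set R) t * pois1 w e (b - t))%:E <= (2 * pi / w)%:E)%E.
Proof.
move=> w0 e0 lu.
have mi : measurable (`[l, u]%classic : set R) by exact: measurable_itv.
have f0 t : 0 <= \1_(`[l, u]%classic : set R) t * pois1 w e (b - t).
  by rewrite mulr_ge0// pois1_ge0.
have mf : measurable_fun setT (fun t => \1_(`[l, u]%classic : set R) t * pois1 w e (b - t)).
  by apply: measurable_funM; [exact: measurable_indic|exact: measurable_pois1].
rewrite -[leLHS]fineK.
  rewrite lee_fin; have := Rintegral_pois1_itv b w0 e0 lu; rewrite /Rintegral => ->.
  have -> : 2 * pi / w = 2 / w * (pi / 2) - 2 / w * - (pi / 2) :> R by field; rewrite gt_eqF.
  by apply: lerB; apply: ler_wpM2l; rewrite ?divr_ge0 ?(ltW w0)// ltW// ?atan_ltpi2// atan_gtNpi2.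
rewrite ge0_fin_numE; last by apply: integral_ge0 => t _; rewrite lee_fin.
apply: (@le_lt_trans _ _ (\int[leb]_t ((2 / e)%:E * (\1_(`[l, u]%classic : set R) t)%:E))%E).
  apply: ge0_le_integral => //.
  - by move=> t _; rewrite lee_fin.
  - exact/measurable_EFinP.
  - by apply: measurable_funeM; apply/measurable_EFinP; exact: measurable_indic.
  - by move=> t _; rewrite -EFinM lee_fin mulrC ler_wpM2r// pois1_le.
rewrite ge0_integralZl//; last 2 first.
- by apply/measurable_EFinP; exact: (measurable_indic mi).
- by rewrite lee_fin divr_ge0// ltW.
rewrite integral_indic// setIT.
have -> : (leb (`[l, u]%classic : set R) = (u - l)%:E)%E.
  rewrite /= lebesgue_measure_itv /= lte_fin; move: lu; rewrite le_eqVlt => /orP[/eqP ->|->] //.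
  by rewrite ltxx subrr.
by rewrite -EFinM ltry.
Qed.

Lemma integral_pois1_le (w e b : R) : 0 < w -> 0 < e ->
  (\int[leb]_t (pois1 w e (b - t))%:E <= (2 * pi / w)%:E)%E.
Proof.
move=> w0 e0.
have mf (m : nat) : measurable_fun setT
    (fun t : R => \1_(`[- m%:R, m%:R]%classic : set R) t * pois1 w e (b - t)).
  apply: measurable_funM; last exact: measurable_pois1.
  by apply: measurable_indic; exact: measurable_itv.
apply: (@integral_lim_le _ (measurableTypeR R) R leb
  (fun m t => \1_(`[- m%:R, m%:R]%classic : set R) t * pois1 w e (b - t)) _ _ mf).
- by move=> m x; rewrite mulr_ge0// pois1_ge0.
- move=> x a c ac; apply: ler_wpM2r; first by rewrite pois1_ge0.
  rewrite !indicE ler_nat; have [xa|] := boolP (x \in _) => //.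
  rewrite mem_set//=; move: xa; rewrite inE /= !in_itv /= => /andP[h1 h2].
  have : (a%:R : R) <= c%:R by rewrite ler_nat.
  by move=> ?; apply/andP; split; lra.
- move=> x; apply/cvgrPdist_le => eps eps0; near=> m.
  rewrite indicE mem_set ?mul1r ?subrr ?normr0 ?ltW//= in_itv/= -ler_norml.
  by near: m; exact: nbhs_infty_ger.
- by move=> m; apply: integral_pois1_itv_le => //; rewrite ge0_cp// lerNl oppr0.
Unshelve. all: by end_near.
Qed.

(** The arctangents tend to $\pm\pi/2$ according to the side of [b]. At an endpoint only half of the
    mass would be seen; those points are excluded here and form null sets later. *)
Lemma cvg_pois1_itv (w b l u : R) (e : nat -> R) : 0 < w -> (forall m, 0 < e m) ->
  e m @[m --> \oo] --> 0 -> l <= u -> b != l -> b != u ->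
  \int[leb]_t (\1_(`[l, u]%classic : set R) t * pois1 w (e m) (b - t)) @[m --> \oo] -->
    \1_(`[l, u]%classic : set R) b * (2 * pi / w).
Proof.
move=> w0 e0 ecv lu bl bu.
have einf (c : R) : 0 < c -> w / e m * c @[m --> \oo] --> +oo.
  move=> c0; have wc : 0 < w * c by exact: mulr_gt0.
  apply/cvgryPge => A; have [A0|A0] := leP A 0.
    by apply: nearW => m; apply: (le_trans A0); rewrite mulrAC divr_ge0// ltW.
  near=> m; rewrite mulrAC ler_pdivlMr// mulrC -ler_pdivlMr//.
  apply: le_trans (ler_norm _) _; rewrite -[e m]subr0 distrC; near: m.
  by move/cvgrPdist_le : ecv; apply; rewrite divr_gt0.
have at1 (c : R) : 0 < c -> atan (w / e m * c) @[m --> \oo] --> (pi / 2 : R).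
  by move=> c0; apply: cvg_comp (einf c c0) _; exact: cvgy_atan.
have at2 (c : R) : c != 0 -> atan (w / e m * c) @[m --> \oo] --> (if 0 < c then pi / 2 else - (pi / 2) : R).
  move=> c0; case: ifPn => [|]; first exact: at1.
  rewrite -leNgt le_eqVlt (negbTE c0) /= => c1.
  have -> : (fun m => atan (w / e m * c)) = (fun m => - atan (w / e m * - c)).
    by apply/funext => m; rewrite mulrN atanN opprK.
  by apply: cvgN; apply: at1; rewrite oppr_gt0.
under eq_fun do rewrite Rintegral_pois1_itv//.
have bl' : l - b != 0 by rewrite subr_eq0 eq_sym.
have bu' : u - b != 0 by rewrite subr_eq0 eq_sym.
have h := cvgB (cvgM (cvg_cst (2 / w)) (at2 _ bu')) (cvgM (cvg_cst (2 / w)) (at2 _ bl')).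
have -> : \1_(`[l, u]%classic : set R) b * (2 * pi / w) =
  2 / w * (if 0 < u - b then pi / 2 else - (pi / 2)) - 2 / w * (if 0 < l - b then pi / 2 else - (pi / 2)).
  rewrite !subr_gt0 indicE; case: ltP => ub; case: ltP => lb.
  - by rewrite memNset /= ?in_itv/= ?subrr ?mul0r// leNgt lb.
  - by rewrite mem_set /= ?in_itv/= ?lb ?(ltW ub)//; field; rewrite gt_eqF.
  - by have := lt_le_trans lb (le_trans lu ub); rewrite ltxx.
  - rewrite memNset /= ?in_itv/= ?subrr ?mul0r//; apply/negP; rewrite lb /= -ltNge.
    by rewrite lt_neqAle eq_sym bu ub.
exact: h.
Unshelve. all: by end_near.
Qed.

End poisson_kernel.

(** * Abel-damped Fourier transforms, Parseval and square integrability *)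

Section fourier_transform.
Variables (R : realType) (n : nat) (w : 'I_n -> R).
Hypothesis w0 : forall k, 0 < w k.
Local Notation C := R[i].
Local Notation H := (n.-tuple R).
Local Notation lebH := (@lebn R n).

Definition theta (a y : H) : R := \sum_k w k * (tnth a k * tnth y k).
Definition cis (t : R) : C := cexp (Complex 0 t).
(** The Abel factor, a product over the coordinates, so that its transform is the product [pois] of
    nonnegative Poisson kernels. *)
Definition rho (e : R) (y : H) : R := expR (- (e * \sum_k `|tnth y k|)).
Definition pois (e : R) (c : H) : R := \prod_k pois1 (w k) e (tnth c k).

Lemma n1_cis t : n1 (cis t) <= 2.
Proof. by apply: le_trans (n1_cexp _) _; rewrite /= expR0 mulr1. Qed.

Lemma cisD s t : cis (s + t) = cis s * cis t.
Proof. by rewrite /cis -cexpD; congr cexp; apply: complex_eq; rewrite !cReImE /= ?addr0. Qed.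

Lemma cisN t : cis (- t) = (cis t)^*%C.
Proof. by apply: complex_eq; rewrite /= ?cosN ?sinN ?mulrN. Qed.

Lemma thetaB a b y : theta (tadd a (topp b)) y = theta a y - theta b y.
Proof.
rewrite /theta -sumrB; apply: eq_bigr => k _; rewrite tnth_tadd tnth_topp.
by ring.
Qed.

Lemma measurable_theta d (T : measurableType d) (f g : T -> H) :
  measurable_fun setT f -> measurable_fun setT g ->
  measurable_fun setT (fun x => theta (f x) (g x)).
Proof.
move=> mf mg; apply: measurable_sum => k; apply: measurable_funM => //.
by apply: measurable_funM; exact: measurable_tnth_comp.
Qed.

Lemma cmeas_cis d (T : measurableType d) (f : T -> R) :
  measurable_fun setT f -> cmeas (fun x => cis (f x)).
Proof. by move=> mf; apply: cmeas_cexp; apply: cmeas_Complex. Qed.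

Lemma rho_gt0 e y : 0 < rho e y. Proof. exact: expR_gt0. Qed.

Lemma rho_le1 e y : 0 < e -> rho e y <= 1.
Proof.
move=> e0; rewrite /rho -expR0 ler_expR oppr_le0 mulr_ge0 ?(ltW e0)//.
by apply: sumr_ge0.
Qed.

Lemma measurable_rho e : measurable_fun setT (rho e).
Proof.
apply: measurableT_comp => //; apply: measurableT_comp => //; apply: measurable_funM => //.
apply: measurable_sum => k; apply: measurableT_comp => //.
by exact: measurable_tnth_comp.
Qed.

Lemma pois_ge0 e c : 0 < e -> 0 <= pois e c.
Proof. by move=> e0; apply: prodr_ge0 => k _; exact: pois1_ge0. Qed.

Lemma pois_le e c : 0 < e -> pois e c <= (2 / e) ^+ n.
Proof.
move=> e0; have -> : (2 / e) ^+ n = \prod_(k < n) (2 / e) by rewrite prodr_const card_ord.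
by apply: ler_prod => k _; rewrite pois1_ge0// pois1_le.
Qed.

Lemma measurable_pois d (T : measurableType d) e (f g : T -> H) : 0 < e ->
  measurable_fun setT f -> measurable_fun setT g ->
  measurable_fun setT (fun x => pois e (tadd (f x) (topp (g x)))).
Proof.
move=> e0 mf mg; apply: measurable_prod => k _.
under eq_fun do rewrite tnth_tadd tnth_topp -[_ - _]opprB -[- _]sub0r.
apply: (measurableT_comp (measurable_pois1 (w k) 0 e0)).
by apply: measurable_funB; exact: measurable_tnth_comp.
Qed.

Lemma cI_rho_cis e c : 0 < e ->
  cintg lebH (fun y => (rho e y)%:C%C * cis (theta c y)) /\
  cI lebH (fun y => (rho e y)%:C%C * cis (theta c y)) = (pois e c)%:C%C.
Proof.
move=> e0.
have ak k := @cI_akern R e (w k * tnth c k) e0.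
have [i1 e1] := cI_prod (fun k => (ak k).1).
have E : (fun y : H => \prod_k akern e (w k * tnth c k) (tnth y k)) =
    (fun y => (rho e y)%:C%C * cis (theta c y)).
  apply/funext => y.
  have -> : (rho e y)%:C%C * cis (theta c y) =
      cexp (Complex (- (e * \sum_k `|tnth y k|)) (theta c y)).
    by apply: complex_eq; rewrite /rho /cis !cReImE /= expR0; ring.
  have -> : Complex (- (e * \sum_k `|tnth y k|)) (theta c y) =
      \sum_k Complex (- (e * `|tnth y k|)) (w k * tnth c k * tnth y k).
    apply: complex_eq; rewrite ?cRe_sum ?cIm_sum /=; first by rewrite mulr_sumr sumrN.
    by apply: eq_bigr => k _; rewrite mulrA.
  by elim/big_rec2: _ => [|k a b _ ->]; rewrite ?cexp0// cexpD.
rewrite -E; split => //; rewrite e1 /pois rmorph_prod; apply: eq_bigr => k _.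
exact: (ak k).2.
Qed.

Lemma integrable_rho e : 0 < e -> lebH.-integrable setT (EFin \o rho e).
Proof.
move=> e0; have [[ir _] _] := @cI_rho_cis e [tuple 0 | _ < n] e0.
move: ir; apply: eq_integrable => // y _ /=.
have -> : theta [tuple 0 | _ < n] y = 0.
  by rewrite /theta big1// => k _; rewrite tnth_mktuple mul0r mulr0.
by rewrite expR0 cos0 !mulr1 mul0r subr0.
Qed.

(** The mass of the product kernel and therefore the constant in Parseval's identity for the pairing
    [theta]. *)
Definition poisC : R := \prod_k (2 * pi / w k).

Lemma integral_pois_le e c : 0 < e ->
  (\int[lebH]_a (pois e (tadd c (topp a)))%:E <= poisC%:E)%E.
Proof.
move=> e0.
have -> : (fun a : H => (pois e (tadd c (topp a)))%:E) =
    (fun a => \prod_k (pois1 (w k) e (tnth c k - tnth a k))%:E)%E.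
  apply/funext => a; rewrite prodEFin; congr EFin; apply: eq_bigr => k _.
  by rewrite tnth_tadd tnth_topp.
rewrite (@ge0_integral_prod R n (fun k t => (pois1 (w k) e (tnth c k - t))%:E)); last 2 first.
- by move=> k; apply/measurable_EFinP; exact: measurable_pois1.
- by move=> k x; rewrite lee_fin pois1_ge0.
rewrite /poisC -prodEFin.
pose f k := (\int[@lebesgue_measure R]_t (pois1 (w k) e (tnth c k - t))%:E)%E.
have fl k : (f k <= (2 * pi / w k)%:E)%E by exact: integral_pois1_le.
have f0 k : (0 <= f k)%E by apply: integral_ge0 => t _; rewrite lee_fin pois1_ge0.
suff : (0 <= \prod_(k < n) f k <= \prod_(k < n) (2 * pi / w k)%:E)%E by case/andP.
elim/big_ind2: _ => [|x y x' y' /andP[x0 xy] /andP[x0' xy']|k _]; first by rewrite lee01 lexx.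
  by rewrite mule_ge0//= lee_pmul.
by rewrite f0 fl.
Qed.

Section transform.
Context d (T : measurableType d) (m : {sigma_finite_measure set T -> \bar R}).
Variables (F : T -> C) (p : T -> H).
Hypotheses (IF : cintg m F) (mp : measurable_fun setT p).

(** The Fourier transform of the image under [p] of the complex measure [F] times [m]. One
    definition covers matrices ([p] the Gram map), functions on Hermitian coordinates ([p] the
    identity) and the inverse transform ([p] the reflection [topp]). *)
Definition ft (y : H) : C := cI m (fun x => F x * cis (theta (p x) y)).

Let iF := cintg_n1 IF.

Lemma cmeas_ft_kernel : cmeas (fun xy : T * H => F xy.1 * cis (theta (p xy.1) xy.2)).
Proof.
apply: cmeasM; first exact: cmeas_comp (cintg_meas IF) measurable_fst.
by apply: cmeas_cis; apply: measurable_theta => //; exact: (measurableT_comp mp measurable_fst).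
Qed.

Lemma n1_ft_kernel x y : n1 (F x * cis (theta (p x) y)) <= 2 * n1 (F x).
Proof.
apply: le_trans (n1M _ _) _; rewrite mulrC; apply: ler_wpM2r; first exact: n1_ge0.
exact: n1_cis.
Qed.

Lemma cintg_ft_kernel y : cintg m (fun x => F x * cis (theta (p x) y)).
Proof.
apply: (cintg_le _ (fun x => n1_ft_kernel x y)).
  apply: cmeasM; first exact: cintg_meas IF.
  by apply: cmeas_cis; apply: measurable_theta.
exact: (integrableZl measurableT 2 iF).
Qed.

Definition ftM : R := \int[m]_x (2 * n1 (F x)).

Lemma n1_ft y : n1 (ft y) <= ftM.
Proof.
apply: le_n1_cI; [exact: cintg_ft_kernel| |by move=> x; exact: n1_ft_kernel].
exact: (integrableZl measurableT 2 iF).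
Qed.

Let f1 (g : H -> C) (xy : T * H) : C := F xy.1 * cis (theta (p xy.1) xy.2) * g xy.2.

Lemma ft_fubini (g : H -> C) (b : H -> R) : cmeas g -> lebH.-integrable setT (EFin \o b) ->
  (forall y, n1 (g y) <= b y) ->
  [/\ cmeas (fun y => ft y * g y), cintg lebH (fun y => ft y * g y),
    cintg m (fun x => F x * cI lebH (fun y => cis (theta (p x) y) * g y)) &
    cI lebH (fun y => ft y * g y) = cI m (fun x => F x * cI lebH (fun y => cis (theta (p x) y) * g y))].
Proof.
move=> mg ib gb.
have ia : m.-integrable setT (EFin \o (fun x => 2 * n1 (F x))).
  exact: (integrableZl measurableT 2 iF).
have mf1 : cmeas (f1 g).
  by apply: cmeasM; [exact: cmeas_ft_kernel|exact: cmeas_comp mg measurable_snd].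
have f1b x y : n1 (f1 g (x, y)) <= 2 * n1 (F x) * b y.
  apply: le_trans (n1M _ _) _; apply: ler_pM; rewrite ?n1_ge0//.
  exact: n1_ft_kernel.
have E y : cI m (fun x => f1 g (x, y)) = ft y * g y.
  rewrite mulrC /ft -cIZ; last exact: cintg_ft_kernel.
  by apply: eq_cI => x; rewrite /f1 mulrC.
have Ef : (fun y => cI m (fun x => f1 g (x, y))) = (fun y => ft y * g y) by apply/funext.
have Ex : (fun x => cI lebH (fun y => f1 g (x, y))) =
    (fun x => F x * cI lebH (fun y => cis (theta (p x) y) * g y)).
  apply/funext => x; rewrite -cIZ; last first.
    apply: (@cintg_le _ _ _ _ _ (fun y => 2 * b y)).
    + apply: cmeasM => //; apply: cmeas_cis; apply: measurable_theta => //.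
    + move=> y; apply: le_trans (n1M _ _) _; apply: ler_pM; rewrite ?n1_ge0//.
      exact: n1_cis.
    + exact: (integrableZl measurableT 2 ib).
  by apply: eq_cI => y; rewrite /f1 mulrA.
rewrite -Ef -Ex; split.
- exact: (cmeas_cI2 ia ib mf1 f1b).
- exact: (cintg_cI2 ia ib mf1 f1b).
- exact: (cintg_cI1 ia ib mf1 f1b).
- by rewrite (cFubini ia ib mf1 f1b).
Qed.

(** Fubini needs an integrable factor in [y], so it yields measurability of the transform times
    [rho 1]; this positive factor is then divided out. *)
Lemma cmeas_ft : cmeas ft.
Proof.
have mr : cmeas (fun y => (rho 1 y)%:C%C) by apply: cmeas_real; exact: measurable_rho.
have b1 y : n1 ((rho 1 y)%:C%C) <= rho 1 y by rewrite n1_real ger0_norm// ltW// rho_gt0.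
have [mfr _ _ _] := ft_fubini mr (integrable_rho ltr01) b1.
have -> : ft = (fun y => ft y * (rho 1 y)%:C%C * ((rho 1 y)^-1)%:C%C).
  apply/funext => y; rewrite -mulrA -rmorphM mulfV ?mulr1//.
  by rewrite gt_eqF// rho_gt0.
apply: cmeasM => //; apply: cmeas_real.
have -> : (fun y => (rho 1 y)^-1) = (fun y : H => expR (1 * \sum_k `|tnth y k|)).
  by apply/funext => y; rewrite /rho expRN invrK.
apply: measurableT_comp => //; apply: measurable_funM => //.
apply: measurable_sum => k; apply: measurableT_comp => //.
by exact: measurable_tnth_comp.
Qed.

End transform.

(** The image measure has density at most [k] and [F] is bounded by [B], so the image of the complex
    measure is both integrable and bounded, hence square integrable. *)
Definition bounded_density d (T : measurableType d) (m : {measure set T -> \bar R})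
    (F : T -> C) (p : T -> H) (B k : R) :=
  [/\ 0 <= B, 0 <= k, forall x, n1 (F x) <= B & forall h : H -> \bar R, measurable_fun setT h ->
    (forall y, 0 <= h y)%E -> (\int[m]_x h (p x) <= k%:E * \int[lebH]_y h y)%E].

Section parseval.
Context d1 d2 (T1 : measurableType d1) (T2 : measurableType d2).
Variables (m1 : {sigma_finite_measure set T1 -> \bar R})
  (m2 : {sigma_finite_measure set T2 -> \bar R}).
Variables (F1 : T1 -> C) (p1 : T1 -> H) (F2 : T2 -> C) (p2 : T2 -> H).
Hypotheses (I1 : cintg m1 F1) (mp1 : measurable_fun setT p1).
Hypotheses (I2 : cintg m2 F2) (mp2 : measurable_fun setT p2).

(** The Poisson smoothing, evaluated at [c], of the image of the conjugate measure. *)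
Definition poisI (e : R) (c : H) : C :=
  cI m2 (fun x => (F2 x)^*%C * (pois e (tadd c (topp (p2 x))))%:C%C).

Lemma cintg_poisI e c : 0 < e ->
  cintg m2 (fun x => (F2 x)^*%C * (pois e (tadd c (topp (p2 x))))%:C%C).
Proof.
move=> e0; under eq_fun do rewrite mulrC.
apply: (@cintgM_bounded _ _ _ _ ((2 / e) ^+ n)).
- by apply: cmeas_real; apply: measurable_pois.
- by move=> x; rewrite n1_real ger0_norm ?pois_ge0// pois_le.
- exact: cintgJ.
Qed.

(** Fubini is used twice, once to pull [F1] out of its transform and once for [F2]; what is left is
    the damped integral of $e^{i\theta(c,y)}$ with $c=p_1(x)-p_2(z)$, which is the Poisson
    kernel. *)
Lemma abel_parseval e : 0 < e ->
  cintg m1 (fun x => F1 x * poisI e (p1 x)) /\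
  cI lebH (fun y => (rho e y)%:C%C * (ft m1 F1 p1 y * (ft m2 F2 p2 y)^*%C)) =
  cI m1 (fun x => F1 x * poisI e (p1 x)).
Proof.
move=> e0; have ir := integrable_rho e0.
have mr : cmeas (fun y : H => (rho e y)%:C%C) by apply: cmeas_real; exact: measurable_rho.
have nr y : n1 ((rho e y)%:C%C) = rho e y by rewrite n1_real ger0_norm// ltW// rho_gt0.
pose g y := (ft m2 F2 p2 y)^*%C * (rho e y)%:C%C.
have mg : cmeas g by apply: cmeasM => //; apply: cmeasJ; exact: cmeas_ft.
have gb y : n1 (g y) <= ftM m2 F2 * rho e y.
  apply: le_trans (n1M _ _) _; rewrite nr n1J; apply: ler_wpM2r; first by rewrite ltW// rho_gt0.
  exact: n1_ft.
have ib : lebH.-integrable setT (EFin \o (fun y => ftM m2 F2 * rho e y)).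
  exact: (integrableZl measurableT _ ir).
have [_ _ I E] := ft_fubini I1 mp1 mg ib gb.
suff Ex : (fun x => F1 x * cI lebH (fun y => cis (theta (p1 x) y) * g y)) =
    (fun x => F1 x * poisI e (p1 x)).
  rewrite -Ex; split => //; rewrite -E.
  by apply: eq_cI => y; rewrite /g mulrC mulrA.
apply/funext => x; congr (_ * _).
(* The inner integral is the conjugate of a transform of [F2] against [g'], to which the same Fubini
   lemma applies. *)
pose g' y := cis (- theta (p1 x) y) * (rho e y)%:C%C.
have mg' : cmeas g'.
  apply: cmeasM => //; apply: cmeas_cis; apply: measurableT_comp => //.
  by apply: measurable_theta => //; exact: measurable_cst.
have gb' y : n1 (g' y) <= 2 * rho e y.
  apply: le_trans (n1M _ _) _; rewrite nr; apply: ler_wpM2r; first by rewrite ltW// rho_gt0.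
  exact: n1_cis.
have ib' : lebH.-integrable setT (EFin \o (fun y => 2 * rho e y)).
  exact: (integrableZl measurableT _ ir).
have [_ I' J' E'] := ft_fubini I2 mp2 mg' ib' gb'.
transitivity (cI lebH (fun y => (ft m2 F2 p2 y * g' y)^*%C)).
  apply: eq_cI => y; rewrite /g /g' cisN; case: (ft _ _ _ _) => a b; case: (cis _) => u v.
  by apply: complex_eq; rewrite !cReImE /= ?cReImE /=; ring.
have Ez z : cI lebH (fun y => cis (theta (p2 z) y) * g' y) =
    (pois e (tadd (p1 x) (topp (p2 z))))%:C%C.
  have [iz ez] := @cI_rho_cis e (tadd (p1 x) (topp (p2 z))) e0.
  transitivity (cI lebH (fun y => ((rho e y)%:C%C * cis (theta (tadd (p1 x) (topp (p2 z))) y))^*%C)).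
    apply: eq_cI => y; rewrite /g' thetaB cisD !cisN.
    case: (cis (theta (p1 x) y)) => a b; case: (cis _) => u v.
    by apply: complex_eq; rewrite !cReImE /= ?cReImE /=; ring.
  by rewrite cIJ// ez; apply: complex_eq; rewrite /= ?oppr0.
rewrite cIJ// E' /poisI -cIJ//; apply: eq_cI => z; rewrite Ez.
case: (F2 z) => a b.
by apply: complex_eq; rewrite !cReImE /= ?cReImE /=; ring.
Qed.

(** The bound is uniform in [e]: bounded density replaces the image measure by Lebesgue measure,
    under which the kernel has mass at most [poisC]. *)
Lemma n1_poisI (B k e : R) c : bounded_density m2 F2 p2 B k -> 0 < e ->
  n1 (poisI e c) <= B * (k * poisC).
Proof.
move=> [B0 k0 FB dens] e0.
have mpo : measurable_fun setT (fun y : H => pois e (tadd c (topp y))).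
  by apply: measurable_pois => //; exact: measurable_cst.
have mpo2 : measurable_fun setT (fun x => pois e (tadd c (topp (p2 x)))).
  exact: (measurableT_comp mpo mp2).
apply: (@n1_cI_le _ _ _ _ _ (fun x => B * pois e (tadd c (topp (p2 x))))).
- exact: cintg_poisI.
- by apply: measurable_funM => //; exact: measurable_cst.
- move=> x; apply: le_trans (n1M _ _) _; rewrite n1J n1_real ger0_norm ?pois_ge0//.
  by apply: ler_wpM2r; rewrite ?pois_ge0.
under eq_integral do rewrite EFinM.
have mE := (measurable_EFinP _ _).2 mpo; have mE2 := (measurable_EFinP _ _).2 mpo2.
have pg0 x : (0 <= (EFin \o (fun x => pois e (tadd c (topp (p2 x))))) x)%E.
  by rewrite lee_fin pois_ge0.
have BE : (0 <= B%:E)%E by rewrite lee_fin.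
have -> : (\int[m2]_x (B%:E * (pois e (tadd c (topp (p2 x))))%:E) =
    B%:E * \int[m2]_x (pois e (tadd c (topp (p2 x))))%:E)%E.
  exact: (ge0_integralZlT m2 mE2 pg0 BE).
rewrite EFinM; apply: lee_wpmul2l; first by rewrite lee_fin.
apply: le_trans (dens _ mE _) _; first by move=> y; rewrite lee_fin pois_ge0.
by rewrite EFinM; apply: lee_wpmul2l; [rewrite lee_fin|exact: integral_pois_le].
Qed.

Lemma abel_bound (B k e : R) : bounded_density m2 F2 p2 B k -> 0 < e ->
  n1 (cI lebH (fun y => (rho e y)%:C%C * (ft m1 F1 p1 y * (ft m2 F2 p2 y)^*%C))) <=
  \int[m1]_x (B * (k * poisC) * n1 (F1 x)).
Proof.
move=> bd e0; have [I ->] := abel_parseval e0.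
apply: le_n1_cI => //.
  exact: (integrableZl measurableT _ (cintg_n1 I1)).
move=> x; apply: le_trans (n1M _ _) _; rewrite mulrC.
by apply: ler_wpM2r; [exact: n1_ge0|exact: n1_poisI].
Qed.

End parseval.

Section square_integrability.
Context d (T : measurableType d) (m : {sigma_finite_measure set T -> \bar R}).
Variables (F : T -> C) (p : T -> H) (B k : R).
Hypotheses (IF : cintg m F) (mp : measurable_fun setT p) (bd : bounded_density m F p B k).

Definition abel_seq (j : nat) : R := j.+1%:R^-1.

Lemma abel_seq_gt0 j : 0 < abel_seq j. Proof. by rewrite invr_gt0. Qed.

Lemma cvg_abel_seq : abel_seq j @[j --> \oo] --> (0 : R).
Proof. exact: cvg_harmonic. Qed.

Lemma cvg_rho y : rho (abel_seq j) y @[j --> \oo] --> (1 : R).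
Proof.
pose S := \sum_k `|tnth y k|.
have h : - (abel_seq j * S) @[j --> \oo] --> (- (0 * S) : R).
  exact: (cvgN (cvgM cvg_abel_seq (cvg_cst S))).
rewrite mul0r oppr0 in h; rewrite -expR0.
exact: (cvg_comp _ _ h (@continuous_expR R 0)).
Qed.

(** Pairing the transform with itself in [abel_parseval] makes the damped integrand nonnegative. It
    increases as the damping is removed while its integrals stay bounded, so monotone convergence
    applies. *)
Lemma integrable_nsq_ft : lebH.-integrable setT (EFin \o (fun y => nsq (ft m F p y))).
Proof.
have mf := cmeas_ft IF mp.
have mn : measurable_fun setT (fun y => nsq (ft m F p y)).
  by apply: measurable_funD; apply: measurable_funX; case: mf.
apply/integrableP; split; first exact/measurable_EFinP.
have -> : (\int[lebH]_y `|(EFin \o (fun y => nsq (ft m F p y))) y| =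
    \int[lebH]_y (nsq (ft m F p y))%:E)%E.
  by apply: eq_integral => y _; rewrite gee0_abs// lee_fin nsq_ge0.
apply: le_lt_trans (ltry (\int[m]_x (B * (k * poisC) * n1 (F x)))).
have mrn e : measurable_fun setT (fun y => rho e y * nsq (ft m F p y)).
  by apply: measurable_funM => //; exact: measurable_rho.
apply: (@integral_lim_le _ _ _ _ (fun j y => rho (abel_seq j) y * nsq (ft m F p y))) => //.
- by move=> j y; rewrite mulr_ge0 ?nsq_ge0// ltW// rho_gt0.
- move=> y i j ij; apply: ler_wpM2r; first exact: nsq_ge0.
  rewrite ler_expR lerN2; apply: ler_wpM2r; first by apply: sumr_ge0.
  by rewrite lef_pV2 ?posrE// ler_nat.
- move=> y; rewrite -[X in _ --> X]mul1r; apply: cvgM; last exact: cvg_cst.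
  exact: cvg_rho.
move=> j; have e0 := abel_seq_gt0 j.
have := abel_bound IF mp IF mp bd e0.
have -> : (fun y => (rho (abel_seq j) y)%:C%C * (ft m F p y * (ft m F p y)^*%C)) =
    (fun y => (rho (abel_seq j) y * nsq (ft m F p y))%:C%C).
  by apply/funext => y; rewrite [ft _ _ _ _ * _]mulrC mulJc rmorphM.
rewrite cI_real n1_real => h.
have ir : lebH.-integrable setT (EFin \o (fun y => rho (abel_seq j) y * nsq (ft m F p y))).
  have iM : lebH.-integrable setT (EFin \o (fun y => ftM m F ^+ 2 * rho (abel_seq j) y)).
    exact: (integrableZl measurableT (ftM m F ^+ 2) (integrable_rho e0)).
  apply: (le_integrableR (mrn (abel_seq j)) _ iM) => y.
  rewrite ger0_norm ?mulr_ge0 ?nsq_ge0 ?(ltW (rho_gt0 _ _))// mulrC.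
  apply: ler_wpM2r; first by rewrite ltW// rho_gt0.
  have := n1_ft IF mp y; rewrite /n1 /nsq.
  move: (complex.Re _) (complex.Im _) => a b ab.
  rewrite -(real_normK (num_real a)) -(real_normK (num_real b)).
  apply: (@le_trans _ _ ((`|a| + `|b|) ^+ 2)); last by rewrite ler_pXn2r ?nnegrE ?addr_ge0// (le_trans _ ab)// addr_ge0.
  by rewrite sqrrD; have : 0 <= `|a| * `|b| by []; nra.
have := le_trans (ler_norm _) h; rewrite /Rintegral -lee_fin fineK//.
exact: (integrable_fin_num measurableT ir).
Qed.

End square_integrability.

Section parseval_limit.
Context d1 d2 (T1 : measurableType d1) (T2 : measurableType d2).
Variables (m1 : {sigma_finite_measure set T1 -> \bar R})
  (m2 : {sigma_finite_measure set T2 -> \bar R}).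
Variables (F1 : T1 -> C) (p1 : T1 -> H) (F2 : T2 -> C) (p2 : T2 -> H) (B1 k1 B2 k2 : R).
Hypotheses (I1 : cintg m1 F1) (mp1 : measurable_fun setT p1).
Hypotheses (I2 : cintg m2 F2) (mp2 : measurable_fun setT p2).
Hypotheses (bd1 : bounded_density m1 F1 p1 B1 k1) (bd2 : bounded_density m2 F2 p2 B2 k2).

Lemma n1_sqr_le (z : C) : n1 z ^+ 2 <= 2 * nsq z.
Proof.
rewrite /n1 /nsq -(real_normK (num_real (complex.Re z))) -(real_normK (num_real (complex.Im z))).
have := sqr_ge0 (`|complex.Re z| - `|complex.Im z|); nra.
Qed.

Lemma n1M_le_nsq (z u : C) : n1 (z * u) <= nsq z + nsq u.
Proof.
apply: le_trans (n1M _ _) _; have := n1_sqr_le z; have := n1_sqr_le u.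
have := sqr_ge0 (n1 z - n1 u); nra.
Qed.

Lemma integrable_nsq_sum : lebH.-integrable setT
  (EFin \o (fun y => nsq (ft m1 F1 p1 y) + nsq (ft m2 F2 p2 y))).
Proof.
exact: (integrableD measurableT (integrable_nsq_ft I1 mp1 bd1) (integrable_nsq_ft I2 mp2 bd2)).
Qed.

Lemma n1_ftM_le y : n1 (ft m1 F1 p1 y * (ft m2 F2 p2 y)^*%C) <=
  nsq (ft m1 F1 p1 y) + nsq (ft m2 F2 p2 y).
Proof.
apply: le_trans (n1M_le_nsq _ _) _.
by rewrite lerD2l /nsq !cReImE sqrrN.
Qed.

Lemma cmeas_ftM : cmeas (fun y => ft m1 F1 p1 y * (ft m2 F2 p2 y)^*%C).
Proof. by apply: cmeasM; [|apply: cmeasJ]; exact: cmeas_ft. Qed.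

Lemma cintg_ftM : cintg lebH (fun y => ft m1 F1 p1 y * (ft m2 F2 p2 y)^*%C).
Proof. exact: (cintg_le cmeas_ftM n1_ftM_le integrable_nsq_sum). Qed.

(** The damping may be removed because the product of two square integrable transforms is dominated
    by the sum of their squared moduli. *)
Lemma parseval_limit : ccvg (fun j => cI m1 (fun x => F1 x * poisI m2 F2 p2 (abel_seq j) (p1 x)))
  (cI lebH (fun y => ft m1 F1 p1 y * (ft m2 F2 p2 y)^*%C)).
Proof.
have -> : (fun j => cI m1 (fun x => F1 x * poisI m2 F2 p2 (abel_seq j) (p1 x))) =
   (fun j => cI lebH (fun y => (rho (abel_seq j) y)%:C%C * (ft m1 F1 p1 y * (ft m2 F2 p2 y)^*%C))).
  by apply/funext => j; have [_ ->] := abel_parseval I1 mp1 I2 mp2 (abel_seq_gt0 j).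
apply: (cI_dominated _ cmeas_ftM integrable_nsq_sum).
- move=> j; apply: cmeasM; last exact: cmeas_ftM.
  by apply: cmeas_real; exact: measurable_rho.
- apply: aeW => y; rewrite -[X in ccvg _ X]mul1r; apply: ccvgM; last exact: ccvg_cst.
  by split; [exact: (cvg_rho y)|exact: cvg_cst].
- move=> j y; apply: le_trans (n1M _ _) _; rewrite n1_real ger0_norm ?(ltW (rho_gt0 _ _))//.
  apply: le_trans (n1_ftM_le y); rewrite ler_piMl ?n1_ge0// rho_le1//.
  exact: abel_seq_gt0.
Qed.

(** Asymmetric by design: only the $L^1$ norm of [F1] enters, together with the density bound of
    [F2]. With the test function in the first place, this gives continuity of the pairing in
    $L^1$. *)
Lemma n1_parseval_le : n1 (cI lebH (fun y => ft m1 F1 p1 y * (ft m2 F2 p2 y)^*%C)) <=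
  \int[m1]_x (B2 * (k2 * poisC) * n1 (F1 x)).
Proof.
apply: (n1_lim_le parseval_limit) => j.
have [_ <-] := abel_parseval I1 mp1 I2 mp2 (abel_seq_gt0 j).
exact: (abel_bound I1 mp1 I2 mp2 bd2 (abel_seq_gt0 j)).
Qed.

End parseval_limit.

End fourier_transform.

(** * Parseval's identity against indicators *)

Section boxes.
Variables (R : realType) (n : nat).
Local Notation C := R[i].
Local Notation H := (n.-tuple R).
Local Notation lebH := (@lebn R n).
Local Notation leb := (@lebesgue_measure R : {sigma_finite_measure set (measurableTypeR R) -> \bar R}).

Definition box (l u : 'I_n -> R) : set H := [set a | forall k, l k <= tnth a k <= u k].
Definition orthant (b : 'I_n -> R) : set H := [set a | forall k, tnth a k <= b k].

Lemma measurable_tnth_set k (A : set R) : measurable A -> measurable [set a : H | A (tnth a k)].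
Proof.
move=> mA; have := @measurable_tnth_comp R _ _ n id k (@measurable_id _ _ setT) measurableT A mA.
by rewrite setTI.
Qed.

Lemma measurable_box l u : measurable (box l u).
Proof.
have -> : box l u = \bigcap_(k in [set: 'I_n]) [set a : H | `[l k, u k]%classic (tnth a k)].
  apply/seteqP; split=> [a ab k _|a ab k]; rewrite /= ?in_itv/=; first exact: ab.
  by have := ab k I; rewrite /= in_itv.
by apply: fin_bigcap_measurable => [|k _]; [exact: finite_finset|apply: measurable_tnth_set; exact: measurable_itv].
Qed.

Lemma indic_box l u a : \1_(box l u) a = \prod_k \1_(`[l k, u k]%classic : set R) (tnth a k) :> R.
Proof.
have [ab|ab] := pselect (box l u a).
  rewrite indicE mem_set// big1// => k _; rewrite indicE mem_set//= in_itv/=.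
  exact: ab.
rewrite indicE memNset//; have [k /negP kab] : exists k, ~ (l k <= tnth a k <= u k) by apply/existsNP.
rewrite (bigD1 k)//= indicE memNset ?mul0r//= in_itv/=.
exact/negP.
Qed.

Lemma lebn_box_lty l u : (lebH (box l u) < +oo)%E.
Proof.
have mb := measurable_box l u.
rewrite -[box l u]setIT -integral_indic//.
have -> : (\int[lebH]_x (\1_(box l u) x)%:E =
    \int[lebH]_x \prod_k (\1_(`[l k, u k]%classic : set R) (tnth x k))%:E)%E.
  by apply: eq_integral => x _; rewrite prodEFin indic_box.
rewrite (@ge0_integral_prod R n (fun k t => (\1_(`[l k, u k]%classic : set R) t)%:E)); last 2 first.
- by move=> k; apply/measurable_EFinP; apply: measurable_indic; exact: measurable_itv.
- by move=> k x; rewrite lee_fin.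
suff : (0 <= \prod_(k < n) \int[@lebesgue_measure R]_t (\1_(`[l k, u k]%classic : set R) t)%:E < +oo)%E.
  by case/andP.
elim/big_ind: _ => [|x y /andP[x0 xy] /andP[y0 yy]|k _]; first by rewrite lee01 ltry.
  by rewrite mule_ge0//= lte_mul_pinfty// ge0_fin_numE.
rewrite integral_indic//.
rewrite setIT measure_ge0 /= lebesgue_measure_itv /=.
by case: ifP => _; rewrite ltry.
Qed.

Lemma hyperplane_null k (c : R) : lebH [set a | tnth a k = c] = 0.
Proof.
have mb : measurable [set a : H | tnth a k = c].
  by apply: (@measurable_tnth_set k [set c]); exact: measurable_set1.
rewrite -[X in lebH X]setIT -integral_indic//.
pose f j (t : R) : \bar R := if j == k then (\1_([set c] : set R) t)%:E else 1%E.
have -> : (\int[lebH]_x (\1_[set a : H | tnth a k = c] x)%:E =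
    \int[lebH]_x \prod_j f j (tnth x j))%E.
  apply: eq_integral => x _; rewrite (bigD1 k)//= big1 => [|j jk]; last by rewrite /f (negbTE jk).
  by rewrite /f eqxx mule1 !indicE; congr ((nat_of_bool _)%:R%:E).
rewrite (@ge0_integral_prod R n f); last 2 first.
- move=> j; rewrite /f; case: (j == k); last exact: measurable_cst.
  by apply/measurable_EFinP; apply: measurable_indic; exact: measurable_set1.
- by move=> j x; rewrite /f; case: (j == k); rewrite ?lee_fin// lee01.
rewrite (bigD1 k)//= {1}/f eqxx integral_indic//.
by rewrite setIT /= lebesgue_measure_set1 mul0e.
Qed.

(** The half-space [tnth a k <= x] is the union of the orthants whose bound is [x] at [k] and an
    integer [m] elsewhere. Orthants are preferred to boxes since they are stable under intersection
    with no case of emptiness. *)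
Lemma orthant_generate (S : set H) : measurable S -> <<s [set O | exists b, O = orthant b] >> S.
Proof.
pose G := [set O : set H | exists b, O = orthant b].
pose T' := g_sigma_algebraType G.
have mG (O : set T') : <<s G >> O -> measurable O by [].
suff : measurable_fun setT (fun x : T' => x : H).
  by move=> /(_ measurableT S) h mS; have := h mS; rewrite setTI.
apply: (@measurable_tuple_fun R _ T' n (fun x : T' => x : H)) => k.
apply: (measurability _ (@RGenOInfty.measurableE R)) => _ [_ [x ->]] <-.
rewrite setTI.
have -> : (fun z : T' => tnth (z : H) k) @^-1` `]x, +oo[%classic =
    ~` (\bigcup_(m : nat) (orthant (fun j => if j == k then x else m%:R) : set T')).
  apply/seteqP; split => [z /=|z /= zn].
    rewrite in_itv/= andbT => xz [m _ /(_ k)]; rewrite eqxx leNgt xz.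
    by [].
  rewrite in_itv/= andbT ltNge; apply/negP => zx; apply: zn.
  exists (Num.bound (\sum_j `|tnth (z : H) j|)) => // j; case: eqP => [->//|_].
  apply: (le_trans (ler_norm _)).
  apply: le_trans (ltW (archi_boundP _)); last by apply: sumr_ge0.
  by rewrite (bigD1 j)//= lerDl sumr_ge0.
apply: measurableC; apply: bigcup_measurable => m _; apply: mG.
by apply: sub_sigma_algebra; eexists.
Qed.

End boxes.

(** * The Parseval pairing as a functional of the test function *)

Section pairing.
Variables (R : realType) (n : nat) (w : 'I_n -> R).
Hypothesis w0 : forall k, 0 < w k.
Local Notation C := R[i].
Local Notation H := (n.-tuple R).
Local Notation lebH := (@lebn R n).
Local Notation leb := (@lebesgue_measure R : {sigma_finite_measure set (measurableTypeR R) -> \bar R}).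
Context d (T : measurableType d) (m : {sigma_finite_measure set T -> \bar R}).
Variables (F : T -> C) (p : T -> H) (B k : R).
Hypotheses (IF : cintg m F) (mp : measurable_fun setT p) (bd : bounded_density m F p B k).

Definition pairing (G : H -> C) : C :=
  cI lebH (fun y => ft w m F p y * (ft w lebH G id y)^*%C).

Let mid : measurable_fun setT (@id H) := @measurable_id _ _ setT.

Lemma bounded_density_id (G : H -> C) (b : R) : 0 <= b -> (forall y, n1 (G y) <= b) ->
  bounded_density lebH G id b 1.
Proof. by move=> b0 Gb; split => // h mh h0; rewrite mul1e. Qed.

Lemma pairingB G G' b : 0 <= b -> cintg lebH G -> cintg lebH G' ->
  (forall y, n1 (G y) <= b) -> (forall y, n1 (G' y) <= b) ->
  pairing (fun y => G y - G' y) = pairing G - pairing G'.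
Proof.
move=> b0 iG iG' Gb Gb'.
have i1 := cintg_ftM w0 IF mp iG mid bd (bounded_density_id b0 Gb).
have i2 := cintg_ftM w0 IF mp iG' mid bd (bounded_density_id b0 Gb').
rewrite /pairing -[X in _ - X]mul1r -mulNr -cIZ// -cID//; last exact: cintgZ.
apply: eq_cI => y.
have -> : ft w lebH (fun y => G y - G' y) id y = ft w lebH G id y - ft w lebH G' id y.
  have j1 := cintg_ft_kernel w iG mid y; have j2 := cintg_ft_kernel w iG' mid y.
  rewrite /ft -[X in _ - X]mul1r -mulNr -cIZ// -cID//; last exact: cintgZ.
  by apply: eq_cI => z; ring.
by rewrite rmorphB mulrBr mulN1r.
Qed.

(** Conjugation exchanges the two transforms, which puts [G] in the slot measured by its $L^1$
    norm. *)
Lemma n1_pairing G b : 0 <= b -> cintg lebH G -> (forall y, n1 (G y) <= b) ->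
  n1 (pairing G) <= B * (k * poisC w) * \int[lebH]_y n1 (G y).
Proof.
move=> b0 iG Gb.
have := n1_parseval_le w0 iG mid IF mp (bounded_density_id b0 Gb) bd.
rewrite RintegralZl//; last exact: cintg_n1.
have -> : pairing G = (cI lebH (fun y => ft w lebH G id y * (ft w m F p y)^*%C))^*%C.
  rewrite -cIJ; last exact: (cintg_ftM w0 iG mid IF mp (bounded_density_id b0 Gb) bd).
  apply: eq_cI => y; case: (ft _ _ _ _ _) => a1 b1; case: (ft _ _ _ _ _) => a2 b2.
  by apply: complex_eq; rewrite !cReImE /= ?cReImE /=; ring.
by rewrite n1J.
Qed.

Lemma cintg_comp_p (G : H -> C) b : cmeas G -> (forall y, n1 (G y) <= b) ->
  cintg m (fun x => F x * G (p x)).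
Proof.
move=> mG Gb; under eq_fun do rewrite mulrC.
by apply: (cintgM_bounded (cmeas_comp mG mp) (fun x => Gb (p x)) IF).
Qed.

(** The left side passes to the limit by $L^1$ continuity of the pairing, the right side by
    domination with [b * n1 (F x)]. *)
Lemma pairing_lim (G_ : nat -> H -> C) (G : H -> C) (g : H -> R) b : 0 <= b ->
  lebH.-integrable setT (EFin \o g) -> (forall j, cmeas (G_ j)) -> cmeas G ->
  (forall j y, n1 (G_ j y) <= g y) -> (forall y, n1 (G y) <= g y) -> (forall y, g y <= b) ->
  (forall y, ccvg (G_ ^~ y) (G y)) ->
  (forall j, pairing (G_ j) = (poisC w)%:C%C * cI m (fun x => F x * G_ j (p x))) ->
  pairing G = (poisC w)%:C%C * cI m (fun x => F x * G (p x)).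
Proof.
move=> b0 ig mG_ mG Gg_ Gg gb cG PG.
have iG_ j : cintg lebH (G_ j) := cintg_le (mG_ j) (Gg_ j) ig.
have iG : cintg lebH G := cintg_le mG Gg ig.
have Gb_ j y : n1 (G_ j y) <= b := le_trans (Gg_ j y) (gb y).
have Gb y : n1 (G y) <= b := le_trans (Gg y) (gb y).
have dm j : cmeas (fun y => G_ j y - G y) := cmeasD (mG_ j) (cmeasN mG).
have dle j y : n1 (G_ j y - G y) <= 2 * g y.
  apply: le_trans (n1D _ _) _; rewrite n1N; have := Gg_ j y; have := Gg y; lra.
have i2g : lebH.-integrable setT (EFin \o (fun y => 2 * g y)).
  exact: (integrableZl measurableT 2 ig).
have id_ j : cintg lebH (fun y => G_ j y - G y) := cintg_le (dm j) (dle j) i2g.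
have c0 : \int[lebH]_y n1 (G_ j y - G y) @[j --> \oo] --> 0.
  have : ccvg (fun j => cI lebH (fun y => (n1 (G_ j y - G y))%:C%C)) (cI lebH (fun y => 0)).
    apply: (cI_dominated _ _ i2g); last first.
    - by move=> j y; rewrite n1_real ger0_norm ?n1_ge0.
    - apply: aeW => y; split; last by rewrite /=; exact: cvg_cst.
      have := n1_cvg (ccvgD (cG y) (ccvg_cst (- G y))); rewrite subrr n10.
      exact.
    - exact: cmeas_cst.
    - by move=> j; apply: cmeas_real; exact: measurable_n1.
  by case; rewrite /cI /= /Rintegral integral0.
have lim1 : ccvg (fun j => pairing (G_ j)) (pairing G).
  apply: (@ccvg_n1 _ _ _ (fun j => B * (k * poisC w) * \int[lebH]_y n1 (G_ j y - G y))).
    move=> j; rewrite -(pairingB b0 (iG_ j) iG (Gb_ j) Gb).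
    apply: (@n1_pairing _ (b + b)) => // [|y]; first exact: addr_ge0.
    by apply: le_trans (n1D _ _) _; rewrite n1N lerD.
  by rewrite -(mulr0 (B * (k * poisC w))); apply: cvgM; [exact: cvg_cst|exact: c0].
apply: (ccvg_unique lim1).
have -> : (fun j => pairing (G_ j)) = (fun j => (poisC w)%:C%C * cI m (fun x => F x * G_ j (p x))).
  by apply/funext.
apply: ccvgM; first exact: ccvg_cst.
have ibF : m.-integrable setT (EFin \o (fun x => b * n1 (F x))).
  exact: (integrableZl measurableT b (cintg_n1 IF)).
apply: (cI_dominated _ _ ibF).
- by move=> j; apply: cmeasM; [exact: cintg_meas IF|exact: (cmeas_comp (mG_ j) mp)].
- by apply: cmeasM; [exact: cintg_meas IF|exact: (cmeas_comp mG mp)].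
- by apply: aeW => x; apply: ccvgM; [exact: ccvg_cst|exact: cG].
- move=> j x; apply: le_trans (n1M _ _) _; rewrite mulrC.
  by apply: ler_wpM2r; rewrite ?n1_ge0.
Qed.

Definition cindic (S : set H) (y : H) : C := (\1_S y)%:C%C.

Lemma n1_cindic S y : n1 (cindic S y) <= 1.
Proof. by rewrite n1_real indicE; case: (_ \in _); rewrite ?normr1 ?normr0. Qed.

Lemma cmeas_cindic S : measurable S -> cmeas (cindic S).
Proof. by move=> mS; apply: cmeas_real; exact: measurable_indic. Qed.

Lemma n1_cindic_le S S' y : S `<=` S' -> n1 (cindic S y) <= \1_S' y.
Proof.
move=> SS'; rewrite n1_real !indicE; have [yS|yS] := boolP (y \in S); last by rewrite normr0.
by rewrite (mem_set (SS' _ (set_mem yS))) normr1.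
Qed.

Lemma integrable_indic_box l u : lebH.-integrable setT (EFin \o \1_(@box R n l u)).
Proof.
have mb := measurable_box l u.
apply/integrableP; split; first by apply/measurable_EFinP; exact: measurable_indic.
have -> : (\int[lebH]_x `|(EFin \o \1_(box l u)) x| = \int[lebH]_x (\1_(box l u) x)%:E)%E.
  by apply: eq_integral => x _; rewrite gee0_abs// lee_fin.
by rewrite integral_indic// setIT; exact: lebn_box_lty.
Qed.

Lemma cintg_cindic S l u : measurable S -> S `<=` box l u -> cintg lebH (cindic S).
Proof.
move=> mS Su; exact: (cintg_le (cmeas_cindic mS) (fun y => n1_cindic_le y Su) (integrable_indic_box l u)).
Qed.

Lemma Rintegral_pois1_box l u e c : 0 < e -> (forall j, l j <= u j) ->
  poisI w lebH (cindic (box l u)) id e c =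
  (\prod_j \int[leb]_t (\1_(`[l j, u j]%classic : set R) t * pois1 (w j) e (tnth c j - t)))%:C%C.
Proof.
move=> e0 lu.
pose f (j : 'I_n) (t : R) : C := (\1_(`[l j, u j]%classic : set R) t * pois1 (w j) e (tnth c j - t))%:C%C.
have mi j : measurable (`[l j, u j]%classic : set R) by exact: measurable_itv.
have If j : cintg leb (f j).
  have mf : cmeas (f j).
    apply: cmeas_real; apply: measurable_funM; first exact: measurable_indic.
    exact: measurable_pois1.
  have fl t : n1 (f j t) <= pois1 (w j) e (tnth c j - t).
    have pg : 0 <= pois1 (w j) e (tnth c j - t) by exact: pois1_ge0.
    rewrite /f n1_real indicE; case: (_ \in _); first by rewrite mul1r ger0_norm.
    by rewrite mul0r normr0.
  have ip : leb.-integrable setT (EFin \o (fun t => pois1 (w j) e (tnth c j - t))).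
    apply/integrableP; split; first by apply/measurable_EFinP; exact: measurable_pois1.
    apply: le_lt_trans (ltry (2 * pi / w j)).
    apply: le_trans (integral_pois1_le (tnth c j) (w0 j) e0).
    rewrite le_eqVlt; apply/orP; left; apply/eqP; apply: eq_integral => t _.
    by rewrite gee0_abs// lee_fin pois1_ge0.
  exact: (cintg_le (cmeas_leb mf) fl ip).
have [_ E] := cI_prod If.
transitivity (\prod_j cI leb (f j)); last first.
  by rewrite rmorph_prod; apply: eq_bigr => j _; rewrite cI_real.
rewrite -E /poisI; apply: eq_cI => a.
rewrite /cindic conjc_real indic_box /pois -rmorphM -big_split /= rmorph_prod.
by apply: eq_bigr => j _; rewrite /f tnth_tadd tnth_topp.
Qed.

(** Smoothing the indicator of a box by the Poisson kernel factors into one-dimensional integrals,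
    which converge off the faces of the box. Faces lie in hyperplanes, null for Lebesgue measure and
    hence, by bounded density, for the image measure. *)
Lemma pairing_box l u : (forall j, l j <= u j) ->
  pairing (cindic (box l u)) = (poisC w)%:C%C * cI m (fun x => F x * cindic (box l u) (p x)).
Proof.
move=> lu; have mb := measurable_box l u.
have iG := cintg_cindic mb (@subset_refl _ _).
have bG := bounded_density_id ler01 (n1_cindic (box l u)).
have pl := parseval_limit w0 IF mp iG mid bd bG.
apply: (ccvg_unique pl).
rewrite -cIZ; last exact: (cintg_comp_p (cmeas_cindic mb) (n1_cindic _)).
have [B0 k0 FB dens] := bd.
have iM : m.-integrable setT (EFin \o (fun x => 1 * (1 * poisC w) * n1 (F x))).
  exact: (integrableZl measurableT _ (cintg_n1 IF)).
apply: (cI_dominated _ _ iM).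
- move=> j; have [I _] := abel_parseval w IF mp iG mid (abel_seq_gt0 R j).
  exact: cintg_meas I.
- apply: cmeasM; first exact: cmeas_cst.
  by apply: cmeasM; [exact: cintg_meas IF|exact: (cmeas_comp (cmeas_cindic mb) mp)].
- have null (j : 'I_n) (c : R) : {ae m, forall x, tnth (p x) j != c}.
    pose S := [set a : H | tnth a j = c].
    have mS : measurable S by apply: (@measurable_tnth_set R n j [set c]); exact: measurable_set1.
    exists (p @^-1` S); split.
    + by rewrite -[X in measurable X]setTI; exact: mp.
    + apply/eqP; rewrite eq_le measure_ge0 andbT.
      have mpS : measurable (p @^-1` S) by rewrite -[X in measurable X]setTI; exact: mp.
      rewrite -[X in m X]setIT -integral_indic//.
      have mI : measurable_fun setT (EFin \o \1_S : H -> \bar R).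
        by apply/measurable_EFinP; exact: measurable_indic.
      have h := dens _ mI (fun y => _).
      apply: le_trans (h _) _; first by move=> y; rewrite lee_fin.
      have -> : (\int[lebH]_y (EFin \o \1_S) y = 0)%E; last by rewrite mule0.
      transitivity (\int[lebH]_y (\1_S y)%:E)%E => //.
      by rewrite integral_indic// setIT; exact: hyperplane_null.
    + by move=> x /= /negP; rewrite negbK => /eqP.
  have : {ae m, forall x, forall j, tnth (p x) j != l j /\ tnth (p x) j != u j}.
    have ae_all (Q : 'I_n -> T -> Prop) : (forall j, {ae m, forall x, Q j x}) ->
        {ae m, forall x, forall j, Q j x}.
      move=> hQ; have : \forall x \near (almost_everywhere m), forall j, j \in enum 'I_n -> Q j x.
        elim: (enum 'I_n) => [|i s IH]; first by apply: nearW.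
        apply: filterS2 (hQ i) IH => x qi qs j'; rewrite inE => /orP[/eqP->//|]; exact: qs.
      by apply: filterS => x h j'; apply: h; rewrite mem_enum.
    by apply: ae_all => j; apply: filterS2 (null j (l j)) (null j (u j)) => x.
  apply: filterS => x hx.
  have -> : (poisC w)%:C%C * (F x * cindic (box l u) (p x)) =
      F x * (\prod_j (\1_(`[l j, u j]%classic : set R) (tnth (p x) j) * (2 * pi / w j)))%:C%C.
    rewrite /cindic indic_box big_split /= -/(poisC w) rmorphM.
    by rewrite mulrC -mulrA.
  apply: ccvgM; first exact: ccvg_cst.
  under eq_fun do rewrite Rintegral_pois1_box ?abel_seq_gt0//.
  split => /=; last exact: cvg_cst.
  have cvgp (I : Type) (s : seq I) (f : nat -> I -> R) (g : I -> R) :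
      (forall i, f j i @[j --> \oo] --> g i) -> \prod_(i <- s) f j i @[j --> \oo] --> \prod_(i <- s) g i.
    move=> fg; elim: s => [|i s IH].
      by rewrite big_nil; under eq_fun do rewrite big_nil; exact: cvg_cst.
    rewrite big_cons; under eq_fun do rewrite big_cons.
    exact: (cvgM (fg i) IH).
  apply: cvgp => j; have [h1 h2] := hx j.
  exact: (cvg_pois1_itv (w0 j) (abel_seq_gt0 R) (@cvg_abel_seq R) (lu j) h1 h2).
- move=> j x; apply: le_trans (n1M _ _) _; rewrite mulrC.
  apply: ler_wpM2r; first exact: n1_ge0.
  exact: (n1_poisI w0 iG mid _ bG (abel_seq_gt0 R j)).
Qed.

(** The Dynkin class is taken relative to the cube, because an indicator must be integrable to have
    a transform. Differences use linearity of the pairing, increasing unions use [pairing_lim], and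
    an orthant meets the cube in a box. *)
Lemma pairing_cindic (S : set H) (N : nat) : measurable S -> S `<=` cube N%:R ->
  pairing (cindic S) = (poisC w)%:C%C * cI m (fun x => F x * cindic S (p x)).
Proof.
move=> mS SN.
pose Q := cube N%:R : set H.
have mQ : measurable Q := measurable_box _ _.
pose P (A : set H) := pairing (cindic A) = (poisC w)%:C%C * cI m (fun x => F x * cindic A (p x)).
pose L := [set A : set H | measurable A /\ P (A `&` Q)].
have PB A A' : measurable A -> measurable A' -> A `<=` Q -> A' `<=` A -> P A -> P A' -> P (A `\` A').
  move=> mA mA' AQ AA' PA PA'.
  have E : cindic (A `\` A') = (fun y => cindic A y - cindic A' y).
    apply/funext => y; rewrite /cindic -rmorphB; congr (_%:C%C); rewrite !indicE.
    have [yA'|yA'] := pselect (A' y).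
      by rewrite memNset ?mem_set ?subrr//; [exact: AA'|case].
    have [yA|yA] := pselect (A y); first by rewrite (@mem_set _ (A `\` A') y)// (mem_set yA) (memNset yA') subr0.
    by rewrite !memNset ?subr0//; case.
  have iA := cintg_cindic mA AQ; have iA' := cintg_cindic mA' (subset_trans AA' AQ).
  rewrite /P E (pairingB ler01 iA iA' (n1_cindic A) (n1_cindic A')) PA PA' -mulrBr.
  congr (_ * _).
  have jA := cintg_comp_p (cmeas_cindic mA) (n1_cindic A).
  have jA' := cintg_comp_p (cmeas_cindic mA') (n1_cindic A').
  rewrite -[X in _ - X]mul1r -mulNr -cIZ// -cID//; last exact: cintgZ.
  by apply: eq_cI => x; ring.
have N0 : - N%:R <= N%:R :> R by rewrite ge0_cp// lerNl oppr0.
have Lsys : lambda_system setT L.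
  split => //.
  - by split => //; rewrite setTI; exact: pairing_box.
  - move=> A A' A'A [mA PA] [mA' PA']; split; first exact: measurableD.
    have -> : (A `\` A') `&` Q = (A `&` Q) `\` (A' `&` Q).
      by apply/seteqP; split => y /=; tauto.
    apply: (PB _ _ (measurableI _ _ mA mQ) (measurableI _ _ mA' mQ) _ _ PA PA').
    + by move=> y [].
    + by move=> y [/A'A].
  - move=> A_ nA LA.
    have mA j : measurable (A_ j) by case: (LA j).
    have mU : measurable (\bigcup_j A_ j) by exact: bigcup_measurable.
    split => //.
    apply: (@pairing_lim (fun j => cindic (A_ j `&` Q)) _ (\1_Q) 1 ler01).
    + exact: integrable_indic_box.
    + by move=> j; apply: cmeas_cindic; exact: measurableI.
    + by apply: cmeas_cindic; exact: measurableI.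
    + by move=> j y; apply: n1_cindic_le => z [].
    + by move=> y; apply: n1_cindic_le => z [].
    + by move=> y; rewrite indicE; case: (_ \in _).
    + move=> y; split => /=; last exact: cvg_cst.
      have [[[i _ Ai] Qy]|yU] := pselect (((\bigcup_j A_ j) `&` Q) y); last first.
        have -> : (fun j => \1_(A_ j `&` Q) y) = (fun=> \1_(\bigcup_j A_ j `&` Q) y) :> (nat -> R).
          apply/funext => j; rewrite !indicE !memNset// => -[Aj Qy]; apply: yU; split => //.
          by exists j.
        exact: cvg_cst.
      apply/cvgrPdist_le => eps eps0; exists i => // j /= ij.
      rewrite !indicE !mem_set; first by rewrite subrr normr0 ltW.
        by split => //; have /subsetPset := nA _ _ ij; apply.
      by split => //; exists i.
    + by move=> j; case: (LA j).
have GL : [set O | exists b, O = @orthant R n b] `<=` L.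
  move=> _ [b ->].
  have mO : measurable (orthant b).
    have -> : orthant b = \bigcap_(j in [set: 'I_n]) [set a : H | `]-oo, b j]%classic (tnth a j)].
      apply/seteqP; split=> [a ab j _|a ab j]; rewrite /= ?in_itv/=; first exact: ab.
      by have := ab j I; rewrite /= in_itv.
    by apply: fin_bigcap_measurable => [|j _]; [exact: finite_finset|apply: measurable_tnth_set; exact: measurable_itv].
  split => //.
  have OE : orthant b `&` Q = box (fun=> - N%:R) (fun j => Num.min N%:R (b j)).
    apply/seteqP; split => [y [yO yQ] j|y yb].
      by have /andP[-> ?] := yQ j; rewrite /= le_min; apply/andP; split => //; exact: yO.
    by split => j; have := yb j; rewrite le_min => /andP[? /andP[? ?]]; rewrite ?H//; apply/andP.
  rewrite OE.
  (* If some bound lies below the cube the box is empty, and [pairing_box] does not apply; the zero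
     function is then written as a difference of two equal indicators. *)
  have [hb|hb] := pselect (forall j, - N%:R <= Num.min N%:R (b j) :> R); first exact: pairing_box.
  have -> : box (fun=> - N%:R) (fun j => Num.min N%:R (b j)) = set0.
    apply/seteqP; split => // y yb; apply: hb => j.
    by have /andP[] := yb j; exact: le_trans.
  have iQ := cintg_cindic mQ (@subset_refl _ Q).
  rewrite /P; have -> : cindic set0 = (fun y => cindic Q y - cindic Q y).
    by apply/funext => y; rewrite /cindic indic0 subrr.
  rewrite (pairingB ler01 iQ iQ (n1_cindic Q) (n1_cindic Q)) subrr.
  have -> : (fun x => F x * (cindic Q (p x) - cindic Q (p x))) = (fun x => (0 * F x)).
    by apply/funext => x; rewrite subrr mulr0 mul0r.
  by rewrite cIZ// mul0r mulr0.
have IG : setI_closed [set O | exists b, O = @orthant R n b].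
  move=> _ _ [b ->] [b' ->]; exists (fun j => Num.min (b j) (b' j)).
  apply/seteqP; split => [y [yb yb'] j|y yb].
    by rewrite le_min; apply/andP; split; [exact: yb|exact: yb'].
  by split => j; have := yb j; rewrite le_min => /andP[].
have sub := lambda_system_subset IG Lsys GL (fun X _ => @subsetT _ X).
have [_] := sub S (orthant_generate mS).
by rewrite (setIidl SN).
Qed.

End pairing.

(** * Identification of the two integrals *)

Section layer_cake.
Context d (T : measurableType d) (R : realType) (m : {sigma_finite_measure set T -> \bar R}).
Local Notation C := R[i].
Local Notation leb := (@lebesgue_measure R : {sigma_finite_measure set (measurableTypeR R) -> \bar R}).
Variables (F : T -> C) (h : T -> R) (K : R).
Hypotheses (IF : cintg m F) (mh : measurable_fun setT h) (h0 : forall x, 0 <= h x <= K).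

(** $h(x)=\int_0^K 1_{t<h(x)}\,dt$. The upper bound [K] provides the integrable majorant
    $|F|\,1_{[0,K]}$ for Fubini. *)
Lemma layer_cake :
  cintg leb (fun t => (\1_(`[0, K]%classic : set R) t)%:C%C *
    cI m (fun x => F x * (\1_[set z | t < h z] x)%:C%C)) /\
  cI m (fun x => F x * (h x)%:C%C) =
  cI leb (fun t => (\1_(`[0, K]%classic : set R) t)%:C%C *
    cI m (fun x => F x * (\1_[set z | t < h z] x)%:C%C)).
Proof.
pose chi (z : T * measurableTypeR R) : R :=
  \1_(`[0, K]%classic : set R) (z.2 : R) * \1_(`]0, +oo[%classic : set R) (h z.1 - (z.2 : R)).
pose f (z : T * measurableTypeR R) : C := F z.1 * (chi z)%:C%C.
have m2 : measurable_fun setT (fun z : T * measurableTypeR R => z.2 : R) by exact: measurable_snd.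
have mchi : measurable_fun setT chi.
  apply: measurable_funM.
    apply: (measurableT_comp _ m2); apply: measurable_indic; exact: measurable_itv.
  apply: (@measurableT_comp _ _ _ _ _ _ (\1_(`]0, +oo[%classic : set R) : R -> R) _
     (fun z : T * measurableTypeR R => h z.1 - (z.2 : R))).
    by apply: measurable_indic; exact: measurable_itv.
  by apply: measurable_funB => //; exact: (measurableT_comp mh measurable_fst).
have mf : cmeas f.
  apply: cmeasM; last exact: cmeas_real.
  exact: cmeas_comp (cintg_meas IF) measurable_fst.
have ia := cintg_n1 IF.
have ib : leb.-integrable setT (EFin \o (fun t => \1_(`[0, K]%classic : set R) t)).
  have mi : measurable (`[0, K]%classic : set R) by exact: measurable_itv.
  apply/integrableP; split; first by apply/measurable_EFinP; exact: measurable_indic.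
  pose IK : set R := `[0, K]%classic.
  have -> : (\int[leb]_t `|(EFin \o \1_IK) t| = \int[leb]_t (\1_IK t)%:E)%E.
    by apply: eq_integral => t _; rewrite gee0_abs// lee_fin.
  rewrite integral_indic// setIT /= lebesgue_measure_itv /=.
  by case: ifP => _; rewrite ltry.
have fab x t : n1 (f (x, t)) <= n1 (F x) * \1_(`[0, K]%classic : set R) t.
  apply: le_trans (n1M _ _) _; apply: ler_wpM2l; first exact: n1_ge0.
  rewrite n1_real ger0_norm ?mulr_ge0//= ler_piMr//.
have inner x : cI leb (fun t => f (x, t)) = F x * (h x)%:C%C.
  have ich : cintg leb (fun t => (chi (x, t))%:C%C).
    have mcx : cmeas (fun t : measurableTypeR R => (chi (x, t))%:C%C).
      by apply: cmeas_real; exact: (measurableT_comp mchi (measurable_pair1 x)).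
    apply: (cintg_le mcx _ ib) => t; rewrite n1_real ger0_norm ?mulr_ge0//= ler_piMr//.
  rewrite /f /= cIZ//; congr (_ * _); rewrite cI_real; congr (_%:C%C).
  have -> : (fun t => chi (x, t)) = \1_(`[0, h x[%classic : set R).
    apply/funext => t; rewrite /chi /= !indicE !mem_setE !in_itv /= andbT subr_gt0.
    have /andP[hx0 hxK] := h0 x.
    have [th|th] := ltP t (h x); last by rewrite andbF mulr0.
    by rewrite andbT mulr1 (le_trans (ltW th) hxK) andbT.
  rewrite /Rintegral integral_indic//.
  rewrite setIT /= lebesgue_measure_itv /= lte_fin.
  have /andP[hx0 hxK] := h0 x; case: ltP => [_|hx].
    by rewrite /= subr0.
  by apply/eqP; rewrite eq_le hx hx0.
suff Et : (fun t => cI m (fun x => f (x, t))) = (fun t => (\1_(`[0, K]%classic : set R) t)%:C%C *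
    cI m (fun x => F x * (\1_[set z | t < h z] x)%:C%C)).
  rewrite -Et; split.
    have ii := @cintg_cI2 _ _ _ _ _ m leb _ _ ia ib f mf fab.
    exact: ii.
  by rewrite -(@cFubini _ _ _ _ _ m leb _ _ ia ib f mf fab); apply: eq_cI => x; rewrite inner.
apply/funext => t; rewrite -cIZ; last first.
  have mS : measurable [set z | t < h z].
    have := mh measurableT (measurable_itv `]t, +oo[); rewrite setTI.
    by congr measurable; apply/seteqP; split => z /=; rewrite in_itv/= andbT.
  apply: (cintg_le_n1 _ IF).
    by apply: cmeasM; [exact: cintg_meas IF|apply: cmeas_real; exact: measurable_indic].
  move=> x; apply: le_trans (n1M _ _) _; rewrite n1_real ger0_norm//.
  by apply: ler_piMr; rewrite ?n1_ge0// indicE; case: (_ \in _).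
apply: eq_cI => x; rewrite /f /chi /= rmorphM mulrCA; congr (_ * (_ * _%:C%C)).
rewrite !indicE; congr ((nat_of_bool _)%:R).
by rewrite mem_setE in_itv/= andbT subr_gt0; apply/idP/idP => [th|]; [exact: mem_set|rewrite inE].
Qed.

End layer_cake.

(** * The limit of the partial integrals as a density of the image measure *)

Section identification.
Variables (R : realType) (n : nat) (w : 'I_n -> R).
Hypothesis w0 : forall k, 0 < w k.
Local Notation C := R[i].
Local Notation H := (n.-tuple R).
Local Notation lebH := (@lebn R n).
Context d (T : measurableType d) (m : {sigma_finite_measure set T -> \bar R}).
Variables (F : T -> C) (p : T -> H) (B k : R).
Hypotheses (IF : cintg m F) (mp : measurable_fun setT p) (bd : bounded_density m F p B k).
Variables (eY : H -> C) (kappa : C).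
Hypotheses (kappa0 : kappa != 0) (ftE : forall y, ft w m F p y = kappa * eY y).

(** The integral over the cube of size [j]; the reflection [topp] produces the phase
    $e^{-i\theta(a,y)}$. *)
Definition gs (j : nat) : H -> C :=
  ft w lebH (fun y => eY y * cindic (cube j%:R) y) (@topp R n).

Variable g0 : H -> C.
Hypotheses (Ig0 : cintg lebH g0) (gs_cvg : {ae lebH, forall a, ccvg (gs ^~ a) (g0 a)}).

Let mid : measurable_fun setT (@id H) := @measurable_id _ _ setT.
Let mtopp : measurable_fun setT (@topp R n).
Proof. by apply: measurable_topp. Qed.

Lemma eY_E y : eY y = kappa^-1 * ft w m F p y.
Proof. by rewrite ftE mulKf. Qed.

Lemma cmeas_eY : cmeas eY.
Proof.
have -> : eY = (fun y => kappa^-1 * ft w m F p y) by apply/funext => y; rewrite eY_E.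
by apply: cmeasM; [exact: cmeas_cst|exact: (cmeas_ft w IF mp)].
Qed.

Lemma cintg_eY_cube (r : R) : cintg lebH (fun y => eY y * cindic (cube r) y).
Proof.
have mc := measurable_box (fun=> - r) (fun=> r) : measurable (cube r : set H).
have ic := cintg_cindic mc (@subset_refl _ _).
apply: (cintgM_bounded cmeas_eY _ ic) => y.
rewrite eY_E; apply: le_trans (n1M _ _) _.
by apply: ler_wpM2l; [exact: n1_ge0|exact: n1_ft].
Qed.

Lemma cmeas_gs j : cmeas (gs j).
Proof. exact: (cmeas_ft w (cintg_eY_cube j%:R) mtopp). Qed.

Lemma theta_topp (a y : H) : theta w (topp y) a = - theta w a y.
Proof.
rewrite /theta -sumrN; apply: eq_bigr => i _; rewrite tnth_topp.
by ring.
Qed.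

Definition kappa' : C := kappa^-1 * (poisC w)%:C%C.

(** Square integrability is spent here. Fubini turns the integral of [gs j] over [S] into the
    integral over a cube of the product of the transforms of [F] and of the indicator; that product
    is integrable, so the cubes can grow. *)
Lemma gs_pairing (S : set H) (M : nat) : measurable S -> S `<=` cube M%:R ->
  (forall j, cintg lebH (fun a => gs j a * cindic S a)) /\
  ccvg (fun j => cI lebH (fun a => gs j a * cindic S a))
    (kappa' * cI m (fun x => F x * cindic S (p x))).
Proof.
move=> mS SM; have iS := cintg_cindic mS SM.
have ff j := ft_fubini w (cintg_eY_cube j%:R) mtopp (cmeas_cindic mS)
  (integrable_indic_box (fun=> - M%:R) (fun=> M%:R)) (fun y => n1_cindic_le y SM).
split; first by move=> j; have [_ i _ _] := ff j.
have bS := bounded_density_id ler01 (n1_cindic S).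
have Ipair := cintg_ftM w0 IF mp iS mid bd bS.
have E j : cI lebH (fun a => gs j a * cindic S a) = kappa^-1 *
    cI lebH (fun y => cindic (cube j%:R) y * (ft w m F p y * (ft w lebH (cindic S) id y)^*%C)).
  have [_ _ _ ->] := ff j; rewrite -cIZ; last first.
    apply: (cintgM_bounded _ (n1_cindic _) Ipair).
    by apply: cmeas_cindic; exact: measurable_box.
  apply: eq_cI => y; rewrite eY_E -!mulrA; congr (_ * _); rewrite [RHS]mulrCA; congr (_ * (_ * _)).
  rewrite /ft -cIJ; last exact: (cintg_ft_kernel w iS mid).
  apply: eq_cI => a; rewrite theta_topp cisN; case: (cis _) => u v; rewrite /cindic.
  by apply: complex_eq; rewrite !cReImE /= ?cReImE /=; ring.
under eq_fun do rewrite E.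
rewrite /kappa' -mulrA; apply: ccvgM; first exact: ccvg_cst.
rewrite -(pairing_cindic w0 IF mp bd mS SM).
apply: (cI_dominated _ (cintg_meas Ipair) (cintg_n1 Ipair)).
- move=> j; apply: cmeasM; last exact: cintg_meas Ipair.
  by apply: cmeas_cindic; exact: measurable_box.
- apply: aeW => y; rewrite -[X in ccvg _ X]mul1r; apply: ccvgM; last exact: ccvg_cst.
  split => /=; last exact: cvg_cst.
  apply/cvgrPdist_le => eps eps0; near=> j.
  rewrite indicE mem_set; first by rewrite subrr normr0 ltW.
  move=> i; rewrite -ler_norml; apply: (@le_trans _ _ (\sum_i `|tnth y i|)).
    by rewrite (bigD1 i)//= lerDl sumr_ge0.
  by near: j; exact: nbhs_infty_ger.
- move=> j y; apply: le_trans (n1M _ _) _; apply: ler_piMl; first exact: n1_ge0.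
  exact: n1_cindic.
Unshelve. all: by end_near.
Qed.

(** Bounded density pulls Lebesgue-null sets back to null sets, so exceptional points of the limit
    stay invisible on the matrix side. *)
Lemma ae_density (U : set H) : measurable U -> {ae lebH, forall a, U a} ->
  {ae m, forall x, U (p x)}.
Proof.
move=> mU aeU; have [B0 k0 FB dens] := bd.
have mpU : measurable (p @^-1` (~` U)).
  by rewrite -[X in measurable X]setTI; apply: mp => //; exact: measurableC.
exists (p @^-1` (~` U)); split => //.
apply/eqP; rewrite eq_le measure_ge0 andbT.
rewrite -[X in m X]setIT -integral_indic//.
have mI : measurable_fun setT (EFin \o \1_(~` U) : H -> \bar R).
  by apply/measurable_EFinP; apply: measurable_indic; exact: measurableC.
have h := dens _ mI (fun y => _).
apply: le_trans (h _) _; first by move=> y; rewrite lee_fin.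
have -> : (\int[lebH]_y (EFin \o \1_(~` U)) y = 0)%E; last by rewrite mule0.
transitivity (\int[lebH]_y (\1_(~` U) y)%:E)%E => //.
rewrite integral_indic//; last exact: measurableC.
rewrite setIT; apply/negligibleP; first exact: measurableC.
by apply: negligibleS aeU => a.
Qed.

(** Pointwise convergence comes without a majorant; on this set the constant [i] is one, and the
    cube makes it integrable. Since convergent sequences are bounded, almost every point belongs to
    all these sets from some index on. *)
Let E_ (i : nat) : set H := [set a | (forall j, n1 (gs j a) <= i%:R) /\ cube i%:R a].

Let mE_ i : measurable (E_ i).
Proof.
have -> : E_ i = (\bigcap_j [set a | `]-oo, i%:R]%classic (n1 (gs j a))]) `&` cube i%:R.
  apply/seteqP; split => [a [h1 h2]|a [h1 h2]]; split => // j; rewrite /= ?in_itv/=.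
    by move=> _; exact: h1.
  by have := h1 j I; rewrite /= in_itv.
apply: measurableI; last exact: measurable_box.
apply: bigcap_measurable; [by exists 0%N|move=> j _].
have := measurable_n1 (cmeas_gs j) measurableT (measurable_itv `]-oo, i%:R]).
by rewrite setTI.
Qed.

Let E_event a : ccvg (gs ^~ a) (g0 a) -> exists i0, forall i, (i0 <= i)%N -> E_ i a.
Proof.
move=> cv; have bnd : bounded_fun (fun j => n1 (gs j a)).
  by apply: cvg_seq_bounded; apply/cvg_ex; eexists; exact: n1_cvg cv.
have [M MP] : exists M, forall j, n1 (gs j a) <= M.
  have [M0 [_ MP]] := bnd; exists (M0 + 1) => j.
  have lt1 : M0 < M0 + 1 by rewrite ltrDl.
  have := MP (M0 + 1) lt1 j I.
  by rewrite /= ger0_norm ?n1_ge0.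
pose S := \sum_j `|tnth a j|.
exists (Num.bound (`|M| + S)) => i ii.
have S0 : 0 <= S by apply: sumr_ge0.
have hi : `|M| + S <= i%:R.
  apply: le_trans (ltW (archi_boundP _)) _; first by rewrite addr_ge0.
  by rewrite ler_nat.
split => [j|j].
  by apply: le_trans (MP j) _; have := ler_norm M; lra.
rewrite -ler_norml; apply: le_trans hi; apply: (@le_trans _ _ S); last by rewrite lerDr.
by rewrite /S (bigD1 j)//= lerDl sumr_ge0.
Qed.

(** On [S_ i] the integrals of [gs j] have two limits, one by dominated convergence and one by
    [gs_pairing]; they agree by uniqueness. Then [i] tends to infinity, with majorant [n1 (g0 a)] on
    one side and [n1 (F x)] on the other. *)
Lemma set_identity (S : set H) : measurable S ->
  cI lebH (fun a => g0 a * cindic S a) = kappa' * cI m (fun x => F x * cindic S (p x)).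
Proof.
move=> mS; pose S_ i := S `&` E_ i.
have mS_ i : measurable (S_ i) by exact: measurableI.
have step1 i : cI lebH (fun a => g0 a * cindic (S_ i) a) =
    kappa' * cI m (fun x => F x * cindic (S_ i) (p x)).
  have SM : S_ i `<=` cube i%:R by move=> a [_ []].
  have [ij cv] := gs_pairing (mS_ i) SM.
  apply: (ccvg_unique _ cv).
  have idom : lebH.-integrable setT (EFin \o (fun y => i%:R * \1_(cube i%:R : set H) y)).
    exact: (integrableZl measurableT i%:R (integrable_indic_box (fun=> - i%:R) (fun=> i%:R))).
  apply: (cI_dominated _ _ idom).
  - by move=> j; exact: cintg_meas (ij j).
  - by apply: cmeasM; [exact: cintg_meas Ig0|exact: cmeas_cindic].
  - by apply: filterS gs_cvg => a ca; apply: ccvgM => //; exact: ccvg_cst.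
  - move=> j a; have [aS|aS] := pselect (S_ i a).
      rewrite /cindic !indicE (mem_set aS) (mem_set (SM _ aS)) !mulr1.
      by case: aS => _ [].
    by rewrite /cindic indicE (memNset aS) mulr0 n10 mulr_ge0.
have aeE : {ae lebH, forall a, exists i0, forall i, (i0 <= i)%N -> E_ i a}.
  by apply: filterS gs_cvg => a; exact: E_event.
pose U : set H := \bigcup_i0 \bigcap_(i in [set i | (i0 <= i)%N]) E_ i.
have UE a : U a <-> exists i0, forall i, (i0 <= i)%N -> E_ i a.
  by split => [[i0 _ h]|[i0 h]]; exists i0.
have mU : measurable U.
  by apply: bigcup_measurable => i0 _; apply: bigcap_measurable => //; exists i0 => /=.
have aeU : {ae lebH, forall a, U a} by apply: filterS aeE => a /UE.
have ci a : U a -> ccvg (fun i => cindic (S_ i) a) (cindic S a).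
  move=> /UE[i0 h]; split => /=; last exact: cvg_cst.
  apply/cvgrPdist_le => eps eps0; exists i0 => // i /= ii.
  have -> : \1_(S_ i) a = \1_S a :> R; last by rewrite subrr normr0 ltW.
  rewrite !indicE; congr ((nat_of_bool _)%:R); apply/idP/idP; rewrite !inE; first by case.
  by move=> Sa; split => //; exact: h.
have l1 : ccvg (fun i => cI lebH (fun a => g0 a * cindic (S_ i) a)) (cI lebH (fun a => g0 a * cindic S a)).
  apply: (cI_dominated _ _ (cintg_n1 Ig0)).
  - by move=> i; apply: cmeasM; [exact: cintg_meas Ig0|exact: cmeas_cindic].
  - by apply: cmeasM; [exact: cintg_meas Ig0|exact: cmeas_cindic].
  - by apply: filterS aeU => a /ci ca; apply: ccvgM => //; exact: ccvg_cst.
  - by move=> i a; apply: le_trans (n1M _ _) _; apply: ler_piMr; [exact: n1_ge0|exact: n1_cindic].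
apply: (ccvg_unique l1); under eq_fun do rewrite step1.
apply: ccvgM; first exact: ccvg_cst.
apply: (cI_dominated _ _ (cintg_n1 IF)).
- by move=> i; apply: cmeasM; [exact: cintg_meas IF|exact: (cmeas_comp (cmeas_cindic (mS_ i)) mp)].
- by apply: cmeasM; [exact: cintg_meas IF|exact: (cmeas_comp (cmeas_cindic mS) mp)].
- by apply: filterS (ae_density mU aeU) => x /ci ca; apply: ccvgM => //; exact: ccvg_cst.
- by move=> i x; apply: le_trans (n1M _ _) _; apply: ler_piMr; [exact: n1_ge0|exact: n1_cindic].
Qed.

Lemma nonneg_identity (h : H -> R) (K : R) : measurable_fun setT h -> (forall a, 0 <= h a <= K) ->
  cI lebH (fun a => g0 a * (h a)%:C%C) = kappa' * cI m (fun x => F x * (h (p x))%:C%C).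
Proof.
move=> mh h0.
have [i1 ->] := layer_cake Ig0 mh h0.
have [i2 ->] := layer_cake IF (measurableT_comp mh mp) (fun x => h0 (p x)).
rewrite -cIZ//; apply: eq_cI => t; rewrite [RHS]mulrCA; congr (_ * _).
have mS : measurable [set z | t < h z].
  have := mh measurableT _ (measurable_itv `](t : R), +oo[); rewrite setTI.
  by congr measurable; apply/seteqP; split => z /=; rewrite in_itv/= andbT.
exact: (set_identity mS).
Qed.

(** Adding [K] makes the function nonnegative, and the constant is subtracted again by linearity. *)
Lemma real_identity (u : H -> R) (K : R) : measurable_fun setT u -> (forall a, `|u a| <= K) ->
  cI lebH (fun a => g0 a * (u a)%:C%C) = kappa' * cI m (fun x => F x * (u (p x))%:C%C).
Proof.
move=> mu uK.
have K0 : 0 <= K by apply: le_trans (uK [tuple 0 | _ < n]); exact: normr_ge0.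
pose h a := u a + K.
have mh : measurable_fun setT h by apply: measurable_funD => //; exact: measurable_cst.
have h0 a : 0 <= h a <= K + K.
  by have := uK a; rewrite ler_norml /h => /andP[? ?]; apply/andP; split; lra.
have eh := nonneg_identity mh h0.
have mK : measurable_fun setT (fun _ : H => K) by exact: measurable_cst.
have K1 (a : H) : 0 <= K <= K by rewrite K0 lexx.
have eK := nonneg_identity mK K1.
have ig (v : H -> R) M : measurable_fun setT v -> (forall a, 0 <= v a <= M) ->
    cintg lebH (fun a => g0 a * (v a)%:C%C) /\ cintg m (fun x => F x * (v (p x))%:C%C).
  move=> mv vM; split.
    under eq_fun do rewrite mulrC; apply: (@cintgM_bounded _ _ _ _ M _ _ _ _ Ig0).
      exact: cmeas_real.
    by move=> a; rewrite n1_real ger0_norm; have /andP[] := vM a.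
  under eq_fun do rewrite mulrC; apply: (@cintgM_bounded _ _ _ _ M _ _ _ _ IF).
    by apply: cmeas_real; exact: (measurableT_comp mv mp).
  by move=> x; rewrite n1_real ger0_norm; have /andP[] := vM (p x).
have [ih ih'] := ig _ _ mh h0; have [iK iK'] := ig _ _ mK K1.
have E (z : C) (r : R) : z * r%:C%C = z * (r + K)%:C%C + - 1 * (z * K%:C%C).
  by rewrite rmorphD mulrDr mulN1r addrK.
under eq_fun do rewrite E.
rewrite cID//; last exact: cintgZ.
rewrite cIZ// eh eK.
under [in RHS]eq_fun do rewrite E.
rewrite [in RHS]cID//; last exact: cintgZ.
by rewrite [in RHS]cIZ//; ring.
Qed.

Lemma bounded_identity (W : H -> C) (K : R) : cmeas W -> (forall a, n1 (W a) <= K) ->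
  cI lebH (fun a => g0 a * W a) = kappa' * cI m (fun x => F x * W (p x)).
Proof.
move=> [mr mi] WK.
have rK a : `|complex.Re (W a)| <= K by apply: le_trans (WK a); rewrite lerDl.
have iK a : `|complex.Im (W a)| <= K by apply: le_trans (WK a); rewrite lerDr.
have er := real_identity mr rK; have ei := real_identity mi iK.
have ig (v : H -> R) : measurable_fun setT v -> (forall a, `|v a| <= K) ->
    cintg lebH (fun a => g0 a * (v a)%:C%C) /\ cintg m (fun x => F x * (v (p x))%:C%C).
  move=> mv vM; split.
    under eq_fun do rewrite mulrC; apply: (@cintgM_bounded _ _ _ _ K _ _ _ _ Ig0).
      exact: cmeas_real.
    by move=> a; rewrite n1_real.
  under eq_fun do rewrite mulrC; apply: (@cintgM_bounded _ _ _ _ K _ _ _ _ IF).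
    by apply: cmeas_real; exact: (measurableT_comp mv mp).
  by move=> x; rewrite n1_real.
have [ir ir'] := ig _ mr rK; have [ii ii'] := ig _ mi iK.
have E (z u : C) : z * u = z * (complex.Re u)%:C%C + Complex 0 1 * (z * (complex.Im u)%:C%C).
  by case: z => a b; case: u => c e; apply: complex_eq; rewrite !cReImE /= ?cReImE /=; ring.
under eq_fun do rewrite E.
rewrite cID//; last exact: cintgZ.
rewrite cIZ// er ei.
under [in RHS]eq_fun do rewrite E.
rewrite [in RHS]cID//; last exact: cintgZ.
by rewrite [in RHS]cIZ// mulrDr [in RHS]mulrCA.
Qed.

(** [W] is cut off where it exceeds [i]; integrability of both products supplies the majorants. *)
Lemma integrable_identity (W : H -> C) : cmeas W ->
  cintg lebH (fun a => g0 a * W a) -> cintg m (fun x => F x * W (p x)) ->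
  cI lebH (fun a => g0 a * W a) = kappa' * cI m (fun x => F x * W (p x)).
Proof.
move=> mW i1 i2.
pose S_ (i : nat) : set H := [set a | n1 (W a) <= i%:R].
have mS_ i : measurable (S_ i).
  have := measurable_n1 mW measurableT (measurable_itv `]-oo, i%:R]); rewrite setTI.
  by congr measurable; apply/seteqP; split => z /=; rewrite in_itv.
pose W_ i a := W a * cindic (S_ i) a.
have mW_ i : cmeas (W_ i) by apply: cmeasM => //; exact: cmeas_cindic.
have WK i a : n1 (W_ i a) <= i%:R.
  rewrite /W_ /cindic indicE; have [aS|aS] := pselect (S_ i a).
    by rewrite (mem_set aS) mulr1.
  by rewrite (memNset aS) mulr0 n10.
have cW a : ccvg (W_ ^~ a) (W a).
  rewrite -[X in ccvg _ X]mulr1; apply: ccvgM; first exact: ccvg_cst.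
  split => /=; last exact: cvg_cst.
  apply/cvgrPdist_le => eps eps0; near=> i.
  rewrite indicE mem_set ?subrr ?normr0 ?ltW//.
  by near: i; exact: nbhs_infty_ger.
have l1 : ccvg (fun i => cI lebH (fun a => g0 a * W_ i a)) (cI lebH (fun a => g0 a * W a)).
  apply: (cI_dominated _ (cintg_meas i1) (cintg_n1 i1)).
  - by move=> i; apply: cmeasM => //; exact: cintg_meas Ig0.
  - by apply: aeW => a; apply: ccvgM => //; exact: ccvg_cst.
  - move=> i a; rewrite /W_ mulrA; apply: le_trans (n1M _ _) _.
    by apply: ler_piMr; [exact: n1_ge0|exact: n1_cindic].
apply: (ccvg_unique l1).
have -> : (fun i => cI lebH (fun a => g0 a * W_ i a)) =
    (fun i => kappa' * cI m (fun x => F x * W_ i (p x))).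
  by apply/funext => i; exact: (bounded_identity (mW_ i) (WK i)).
apply: ccvgM; first exact: ccvg_cst.
apply: (cI_dominated _ (cintg_meas i2) (cintg_n1 i2)).
- by move=> i; apply: cmeasM; [exact: cintg_meas IF|exact: (cmeas_comp (mW_ i) mp)].
- by apply: aeW => a; apply: ccvgM => //; exact: ccvg_cst.
- move=> i a; rewrite /W_ mulrA; apply: le_trans (n1M _ _) _.
  by apply: ler_piMr; [exact: n1_ge0|exact: n1_cindic].
Unshelve. all: by end_near.
Qed.

(** The test function is the conjugate of [g0] on the part of the complement of [A] where [g0] is
    bounded by [i]. The matrix side is then 0, so the integral of $|g_0|^2$ over that part
    vanishes. *)
Lemma ae_zero_off (A : set H) : measurable A -> {ae m, forall x, A (p x)} ->
  {ae lebH, forall a, ~ A a -> g0 a = 0}.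
Proof.
move=> mA aeA.
have mg0 := cintg_meas Ig0.
pose S_ (i : nat) : set H := [set a | n1 (g0 a) <= i%:R] `&` ~` A.
have mS_ i : measurable (S_ i).
  apply: measurableI; last exact: measurableC.
  have := measurable_n1 mg0 measurableT (measurable_itv `]-oo, i%:R]); rewrite setTI.
  by congr measurable; apply/seteqP; split => z /=; rewrite in_itv.
have z i : {ae lebH, forall a, \1_(S_ i) a * nsq (g0 a) = 0}.
  pose W a := (g0 a)^*%C * cindic (S_ i) a.
  have mW : cmeas W by apply: cmeasM; [exact: cmeasJ|exact: cmeas_cindic].
  have WK a : n1 (W a) <= i%:R.
    rewrite /W /cindic indicE; have [aS|aS] := pselect (S_ i a).
      by rewrite (mem_set aS) mulr1 n1J; case: aS.
    by rewrite (memNset aS) mulr0 n10.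
  have := bounded_identity mW WK.
  have W0 : {ae m, forall x, F x * W (p x) = 0}.
    by apply: filterS aeA => x Ax; rewrite /W /cindic indicE memNset ?mulr0// => -[].
  have i0 : cintg m (fun x => F x * W (p x)).
    under eq_fun do rewrite mulrC.
    exact: (cintgM_bounded (cmeas_comp mW mp) (fun x => WK (p x)) IF).
  have [_ <-] := cI_ae (@cmeas_cst _ T R 0) i0 W0.
  rewrite (_ : cI m (fun=> 0) = 0) ?mulr0; last by rewrite /cI /= /Rintegral integral0.
  have iW : cintg lebH (fun a => g0 a * W a).
    under eq_fun do rewrite mulrC.
    exact: (cintgM_bounded mW WK Ig0).
  have E : (fun a => g0 a * W a) = (fun a => (\1_(S_ i) a * nsq (g0 a))%:C%C).
    by apply/funext => a; rewrite /W /cindic mulrA [g0 a * _]mulrC mulJc -rmorphM mulrC.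
  rewrite E in iW *; rewrite cI_real => -[].
  have ir : lebH.-integrable setT (fun a => (\1_(S_ i) a * nsq (g0 a))%:E) by case: iW.
  have p0 a : 0 <= \1_(S_ i) a * nsq (g0 a) by rewrite mulr_ge0// nsq_ge0.
  rewrite /Rintegral => h0.
  have h1 : (\int[lebH]_a (\1_(S_ i) a * nsq (g0 a))%:E = 0)%E.
    by rewrite -(fineK (integrable_fin_num measurableT ir)) h0.
  have mr : measurable_fun setT (fun a => (\1_(S_ i) a * nsq (g0 a))%:E).
    exact: measurable_int ir.
  have := (ae_eq_integral_abs lebH measurableT mr).1.
  have -> : (\int[lebH]_a `|(\1_(S_ i) a * nsq (g0 a))%:E| = 0)%E.
    by rewrite -h1; apply: eq_integral => a _; rewrite gee0_abs// lee_fin.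
  move=> /(_ erefl); apply: filterS => a /(_ I) /= [].
  by [].
have : {ae lebH, forall a, forall i, \1_(S_ i) a * nsq (g0 a) = 0} by apply/ae_foralln.
apply: filterS => a h nA.
have := h (Num.bound (n1 (g0 a))); rewrite indicE mem_set; last first.
  by split => //; apply: ltW; apply: archi_boundP; exact: n1_ge0.
by rewrite mul1r => /eqP; rewrite nsq_eq0 => /eqP.
Qed.

End identification.

(** * Return to the two matrix integrals *)

Section transfer.
Variables (R : realType) (N : nat) (P Q : 'M[R[i]]_N).
Local Notation C := R[i].
Local Notation X := ((N * N + N * N).-tuple R).
Local Notation H := ((N * N).-tuple R).
Local Notation lebX := (@lebn R (N * N + N * N)).
Local Notation lebH := (@lebn R (N * N)).
Hypothesis N0 : (0 < N)%N.
Hypotheses (Pu : P \in unitmx) (Qu : Q \in unitmx).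
Hypothesis wd0 : CM_well_defined (fun=> 0) P Q.
Hypothesis hm0 : HM_well_defined (fun=> 0) (Ypot P Q).

(** The weights for which [theta w] is $N\,\mathrm{Tr}(AB)$ in Hermitian coordinates; [N] must be
    positive for the weights to be so. *)
Let w (k : 'I_(N * N)) : R := N%:R * hweight R k.
Let F := integrandCM (fun=> 0) P Q.
Let eY (y : H) : C := cexp (Ypot P Q (hermmat y)).

Let w0 k : 0 < w k.
Proof. by rewrite mulr_gt0 ?ltr0n// (lt_le_trans ltr01)// hweight_ge1. Qed.

Let IF : cintg lebX F. Proof. exact: wd0. Qed.

Lemma theta_tr (a y : H) : 'i * N%:R * \tr (hermmat a *m hermmat y) = Complex 0 (theta w a y).
Proof.
rewrite tr_hermmatM.
have -> : theta w a y = N%:R * \sum_k hweight R k * (tnth a k * tnth y k).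
  by rewrite /theta mulr_sumr; apply: eq_bigr => k _; exact: (esym (mulrA _ _ _)).
have -> : (N%:R : C) = (N%:R : R)%:C%C by rewrite rmorph_nat.
by apply: complex_eq; rewrite !cReImE /= ?cReImE /=; ring.
Qed.

Lemma ft_integrandCM : exists2 kappa : C, kappa != 0 &
  forall y, ft w lebX F (@gram R N) y = kappa * eY y.
Proof.
have [kappa k0 kE] := CM_fourier Pu Qu wd0; exists kappa => // y.
by rewrite -kE; apply: eq_cI => x; rewrite theta_tr.
Qed.

Lemma bounded_density_gram : exists k, bounded_density lebX F (@gram R N) 2 k.
Proof.
have [k k0 kE] := @gram_pushforward R N; exists k; split => //.
- exact: ltW.
- exact: n1_integrandCM.
move=> h mh h0; rewrite (kE _ mh h0); apply: lee_wpmul2l; first by rewrite lee_fin ltW.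
have mI : measurable_fun setT (EFin \o (\1_(@pdcone R N) : H -> R)).
  by apply/measurable_EFinP; apply: measurable_indic; exact: measurable_pdcone.
apply: ge0_le_integral => //.
- by move=> y _; apply: mule_ge0; rewrite ?lee_fin.
- exact: emeasurable_funM.
- move=> y _; rewrite indicE; case: (_ \in _); first by rewrite mul1e.
  by rewrite mul0e.
Qed.

Lemma cint_cI (D : set H) (f : H -> C) : cint D f = cI lebH (fun y => f y * cindic D y).
Proof.
rewrite /cint /rint /cI /Rintegral; congr (Complex (fine _) (fine _)).
  rewrite [LHS]integral_mkcond; apply: eq_integral => y _.
  rewrite patchE /cindic indicE !cReImE /=.
  by case: (_ \in _); rewrite ?mulr1 ?mulr0 subr0.
rewrite [LHS]integral_mkcond; apply: eq_integral => y _.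
rewrite patchE /cindic indicE !cReImE /=.
by case: (_ \in _); rewrite ?mulr1 ?mulr0 ?add0r ?addr0.
Qed.

Definition inner0 (a : H) (r : R) : C := ft w lebH (fun y => eY y * cindic (cube r) y) (@topp R _) a.

Lemma innerHM_E (V : 'M[C]_N -> C) a r :
  innerHM V (Ypot P Q) (hermmat a) r = cexp (V (hermmat a)) * inner0 a r.
Proof.
have [kappa k0 kE] := ft_integrandCM.
have mt : measurable_fun setT (@topp R (N * N)) by apply: measurable_topp.
rewrite /innerHM cint_cI /inner0 /ft -cIZ; last first.
  have ie := cintg_eY_cube IF (@measurable_gram R N) k0 kE r.
  exact: (cintg_ft_kernel w ie mt a).
apply: eq_cI => y; rewrite /integrandHM !cexpD /eY.
have -> : cexp (- 'i * N%:R * \tr (hermmat a *m hermmat y)) = cis (theta w (topp y) a).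
  by rewrite theta_topp cisN !mulNr theta_tr /cis; apply: complex_eq; rewrite /= ?expR0 ?oppr0 ?expR0 ?cosN ?sinN ?mulrN.
by ring.
Qed.

Let g0 (a : H) : C := clim_pinfty (innerHM (fun=> 0) (Ypot P Q) (hermmat a)).

Let Ig0 : cintg lebH g0. Proof. exact: hm0.2. Qed.

Lemma ae_inner0 : {ae lebH, forall a, ccvg_pinfty (inner0 a) /\ g0 a = clim_pinfty (inner0 a)}.
Proof.
apply: filterS hm0.1 => a [_].
have -> : innerHM (fun=> 0) (Ypot P Q) (hermmat a) = inner0 a.
  by apply/funext => r; rewrite innerHM_E cexp0 mul1r.
by move=> cv; split => //; rewrite /g0; congr clim_pinfty; apply/funext => r; rewrite innerHM_E cexp0 mul1r.
Qed.

Lemma ae_gs_cvg : {ae lebH, forall a, ccvg ((gs w eY)^~ a) (g0 a)}.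
Proof.
apply: filterS ae_inner0 => a [[cr ci] ->].
have cn : (j%:R : R) @[j --> \oo] --> +oo by exact: cvgr_idn.
by split; [apply: (cvg_comp _ _ cn cr)|apply: (cvg_comp _ _ cn ci)].
Qed.

(** [V] depends on the outer variable only, so its exponential leaves the inner integral and the
    limit; convergence is needed for zero potential alone. *)
Lemma ae_clim (V : 'M[C]_N -> C) : {ae lebH, forall a,
  clim_pinfty (innerHM V (Ypot P Q) (hermmat a)) = g0 a * cexp (V (hermmat a))}.
Proof.
apply: filterS ae_inner0 => a [[cr ci] ->].
have -> : innerHM V (Ypot P Q) (hermmat a) = (fun r => cexp (V (hermmat a)) * inner0 a r).
  by apply/funext => r; exact: innerHM_E.
move: (cexp _) => z; rewrite [RHS]mulrC; apply: complex_eq; rewrite /clim_pinfty !cReImE /=.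
  apply: cvg_lim => //; under eq_fun do rewrite cReM.
  exact: (cvgB (cvgM (cvg_cst _) cr) (cvgM (cvg_cst _) ci)).
apply: cvg_lim => //; under eq_fun do rewrite cImM.
exact: (cvgD (cvgM (cvg_cst _) ci) (cvgM (cvg_cst _) cr)).
Qed.

Lemma ae_pdcone_gram : {ae lebX, forall x, pdcone (gram x)}.
Proof. by apply: filterS (@ae_unitmx R N) => x; exact: pdcone_gram. Qed.

(** The constant is chosen before [V]: it is made of the Fourier constant of the Gaussian and of
    [poisC]. The potential enters as a test function on the cone. *)
Lemma ZHM_ZCM : exists K : C, forall V : 'M[C]_N -> C,
  CM_well_defined V P Q -> HM_well_defined V (Ypot P Q) ->
  ZHM V (Ypot P Q) = K * ZCM V P Q.
Proof.
have [kappa k0 kE] := ft_integrandCM; have [k bd] := bounded_density_gram.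
have mg := @measurable_gram R N.
exists (kappa' w kappa) => V cmV hmV.
pose Wg (x : X) : C := cexp (V (hermmat (gram x))).
have cmE x : integrandCM V P Q x = F x * Wg x.
  by rewrite /F /integrandCM /Wg hermmat_gram -cexpD addr0.
have mWg : cmeas Wg.
  (* The Gaussian factor never vanishes, so dividing the measurable integrand by it shows that the
     exponential of the potential is measurable along [gram]. *)
  have -> : Wg = (fun x => cexp (sform (N%:R *: ((invmx Q)^T *t invmx P)) (vrow (cmat x))) *
      integrandCM V P Q x).
    apply/funext => x; rewrite cmE mulrA /F integrandCM_sform -cexpD subrr cexp0 mul1r.
    by [].
  apply: cmeasM; first by apply: cmeas_cexp; exact: cmeas_sform.
  have cV : cintg lebX (integrandCM V P Q) by exact: cmV.
  exact: cintg_meas cV.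
pose s (a : H) : X := cvec (chol (hermmat a)).
have ms : measurable_fun setT s.
  by apply: measurable_cvec; apply: mxmeas_chol; exact: mxmeas_hermmat_id.
have sK a : pdcone a -> gram (s a) = a by case=> aE _; rewrite /gram cvecK aE hermmatK.
(* Composition with the section [s] gives a measurable function on the whole space that equals the
   exponential of [V] on the cone. Off the cone it may be set to 0, because [g0] vanishes there
   almost everywhere. *)
pose W a : C := cindic (@pdcone R N) a * Wg (s a).
have mW : cmeas W.
  by apply: cmeasM; [apply: cmeas_cindic; exact: measurable_pdcone|exact: (cmeas_comp mWg ms)].
have WE a : pdcone a -> W a = cexp (V (hermmat a)).
  by move=> pa; rewrite /W /Wg sK// /cindic indicE mem_set// mul1r.
have gcv := ae_gs_cvg.
have off := ae_zero_off w0 IF mg bd k0 kE Ig0 gcv (@measurable_pdcone R N) ae_pdcone_gram.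
have hmE : {ae lebH, forall a, clim_pinfty (innerHM V (Ypot P Q) (hermmat a)) = g0 a * W a}.
  apply: filterS2 (ae_clim V) off => a -> ha.
  have [pa|pa] := pselect (pdcone a); first by rewrite WE.
  by rewrite ha// !mul0r.
have mgW : cmeas (fun a => g0 a * W a) by apply: cmeasM => //; exact: cintg_meas Ig0.
have [i1 e1] := cI_ae mgW hmV.2 hmE.
have cmE' : {ae lebX, forall x, integrandCM V P Q x = F x * W (gram x)}.
  by apply: filterS ae_pdcone_gram => x px; rewrite cmE WE.
have mFW : cmeas (fun x => F x * W (gram x)).
  by apply: cmeasM; [exact: cintg_meas IF|exact: (cmeas_comp mW mg)].
have [i2 e2] := cI_ae mFW cmV cmE'.
transitivity (cI lebH (fun a => g0 a * W a)); first by rewrite e1.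
rewrite (integrable_identity w0 IF mg bd k0 kE Ig0 gcv mW i1 i2).
by rewrite e2.
Qed.

End transfer.

Unset Implicit Arguments.

Theorem theorem4p3 (R : realType) (N : nat) (P Q : 'M[R[i]]_N)
    (V : 'M[R[i]]_N -> R[i]) :
  (0 < N)%N -> P \in unitmx -> Q \in unitmx ->
  CM_well_defined V P Q -> CM_well_defined (fun _ => 0) P Q ->
  ZCM (fun _ => 0) P Q != 0 ->
  HM_well_defined V (Ypot P Q) -> HM_well_defined (fun _ => 0) (Ypot P Q) ->
  ZHM (fun _ => 0) (Ypot P Q) != 0 ->
  ZCM V P Q / ZCM (fun _ => 0) P Q
  = ZHM V (Ypot P Q) / ZHM (fun _ => 0) (Ypot P Q).
Proof.
move=> N0 Pu Qu cV c0 _ hV h0 Z0.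
have [K KE] := ZHM_ZCM N0 Pu Qu c0 h0.
have K0 : K != 0 by apply: contraNneq Z0 => K0; rewrite (KE _ c0 h0) K0 mul0r.
by rewrite (KE _ cV hV) (KE _ c0 h0) invfM mulrACA mulfV// mul1r.
Qed.
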